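(* Let $p$ be a natural number greater than $1$ and, for $0<r<1$, let $\varphi$ be an $r$-block homomorphism on $H_b(B_{\ell_p})$. Then $$S(\varphi)=\{\varphi^z:\ z\in\ell_p,\ \|z\|^p+r^p<1\}.$$
   Context: $\ell_p$ is the complex sequence space and $B_{\ell_p}$ its open unit ball. $H_b(B_{\ell_p})$ is the Fréchet algebra of holomorphic functions on $B_{\ell_p}$ bounded on each $sB_{\ell_p}$, $0<s<1$, with uniform convergence on these sets. $M_b(B_{\ell_p})$ is the set of nonzero continuous linear multiplicative functionals on $H_b(B_{\ell_p})$; $\varphi\prec A$ means $|\varphi(f)|\le\sup_A|f|$ for all $f\in H_b(B_{\ell_p})$. The map $\pi:M_b(B_{\ell_p})\to\ell_p''=\ell_p$ is $\pi(\varphi)=\varphi|_{\ell_p'}$. For $\varphi\in M_b(B_{\ell_p})$ and $z\in\ell_p$, put $\varphi^z(f)=\sum_{n=0}^\infty\varphi\big(y\mapsto\frac{d^nf(y)}{n!}(z)\big)$ whenever this defines an element of $M_b(B_{\ell_p})$; this is the case if $\varphi\prec sB_{\ell_p}$ for some $0<s<1$ and $\|z\|<1-s$. (The claim includes that $\varphi^z$ is a well-defined element of $M_b(B_{\ell_p})$ for all the $z$ appearing in it.) $M_b(B_{\ell_p})$ carries the Hausdorff topology with basis the sets $\{\varphi^z:\|z\|<\varepsilon\}$, with $\varphi\prec sB_{\ell_p}$ and $0<\varepsilon<1-s$; with it $(M_b(B_{\ell_p}),\pi)$ is a Riemann domain over $\ell_p$ (i.e. $\pi$ is a local homeomorphism).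 $S(\varphi)$, the sheet of $\varphi$, is the connected component of $M_b(B_{\ell_p})$ containing $\varphi$. For $0<r<1$, $\varphi\in M_b(B_{\ell_p})$ is an $r$-block homomorphism if it is an adherent (cluster) point, for the topology of pointwise convergence on $H_b(B_{\ell_p})$, of the sequence of evaluations $(\delta_{x_n})_n$ at the elements of a block basic sequence $(x_n)_n$ with $\|x_n\|=r$ for all $n$; that is, $x_n=\sum_{k\in J_n}\alpha_ke_k$ with $J_n\subset\mathbb N$ finite, $\max J_n<\min J_{n+1}$, $(e_k)$ the canonical basis. *)

(* Defs.v *)
From HB Require Import structures.
From mathcomp Require Import all_boot all_order all_algebra finmap.
From mathcomp Require Import complex.
From mathcomp Require Import all_classical all_reals all_analysis.
Set Implicit Arguments.
Unset Strict Implicit.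
Unset Printing Implicit Defensive.
Import numFieldNormedType.Exports.
Import Order.TTheory GRing.Theory Num.Theory.
Local Open Scope classical_set_scope.
Local Open Scope ring_scope.
Local Open Scope complex_scope.

(* The library puts the usual topology on [K^o] for a numeric field [K], but
   not on the concrete type [R[i]]. *)
HB.instance Definition _ (R : realType) := NormedModule.copy R[i] R[i]^o.

(* Norms of normed modules over [R[i]] are [R[i]]-valued (with zero imaginary
   part); [rnorm] is the same norm as an element of [R]. *)
Definition rnorm (R : realType) (V : normedModType R[i]) (x : V) : R :=
  complex.Re `|x|.

Section lp_def.
Context (R : realType) (p : nat).
Implicit Types (u v : nat -> R[i]).

Definition lp_series u : R^nat := series (fun k => rnorm (u k) ^+ p).

Definition lp_mem : {pred (nat -> R[i])} := fun u => `[< cvgn (lp_series u) >].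

Definition lp_norm u : R := limn (lp_series u) `^ p%:R^-1.

Lemma rnormE (V : normedModType R[i]) (x : V) : (rnorm x)%:C = `|x|.
Proof. by rewrite /rnorm RRe_real. Qed.

Lemma rnorm_ge0 (V : normedModType R[i]) (x : V) : 0 <= rnorm x.
Proof. by rewrite -lecR rnormE; exact: (normr_ge0 x). Qed.

Lemma rnormD (V : normedModType R[i]) (x y : V) :
  rnorm (x + y) <= rnorm x + rnorm y.
Proof. by rewrite -lecR rmorphD/= !rnormE ler_normD. Qed.

Lemma rnorm0_eq0 (V : normedModType R[i]) (x : V) : rnorm x = 0 -> x = 0.
Proof. by move=> x0; apply: normr0_eq0; rewrite -rnormE x0. Qed.

Lemma rnormZ (V : normedModType R[i]) (c : R[i]) (x : V) :
  rnorm (c *: x) = rnorm c * rnorm x.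
Proof.
by apply: (@complexI R); rewrite rmorphM/= !rnormE normrZ.
Qed.

Lemma lp_series_nd u : nondecreasing_seq (lp_series u).
Proof.
by apply/nondecreasing_seqP => n; rewrite /lp_series seriesSr lerDl exprn_ge0// rnorm_ge0.
Qed.

Lemma lp_series_le u n : lp_mem u -> lp_series u n <= limn (lp_series u).
Proof. move=> /asboolP cu. exact: (nondecreasing_cvgn_le (@lp_series_nd u) cu). Qed.

Lemma lp_lim_ge0 u : lp_mem u -> 0 <= limn (lp_series u).
Proof. by move=> /(lp_series_le 0); rewrite /lp_series /series/= big_geq. Qed.

Lemma lp_mem_bound u (M : R) : (forall n, lp_series u n <= M) ->
  lp_mem u /\ limn (lp_series u) <= M.
Proof.
move=> uM; have cu : cvgn (lp_series u).
  apply: nondecreasing_is_cvgn; first exact: lp_series_nd.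
  by exists M => _ [n _ <-].
by split; [exact/asboolP|apply: limr_le => //; exact: nearW].
Qed.

Hypothesis p1 : (1 < p)%N.
Let p0 : (0 < p)%N. Proof. exact: ltnW. Qed.

Lemma lp_normX u : lp_mem u -> lp_norm u ^+ p = limn (lp_series u).
Proof.
move=> /lp_lim_ge0 l0; rewrite /lp_norm -powR_mulrn ?powR_ge0// -powRrM.
by rewrite mulVf ?powRr1// pnatr_eq0 -lt0n.
Qed.

Lemma lp_norm_ge0 u : 0 <= lp_norm u. Proof. exact: powR_ge0. Qed.

Lemma lp_norm_le u (a : R) : 0 <= a ->
  (forall n, lp_series u n <= a ^+ p) -> lp_mem u /\ lp_norm u <= a.
Proof.
move=> a0 /lp_mem_bound [um ul]; split=> //.
by rewrite -(@ler_pXn2r _ p)// ?nnegrE ?lp_norm_ge0// lp_normX.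
Qed.

Lemma lp_norm0_eq0 u : lp_mem u -> lp_norm u = 0 -> u = 0.
Proof.
move=> um u0; apply/funext => k; apply: rnorm0_eq0.
have : lp_series u k.+1 <= 0.
  by rewrite (le_trans (lp_series_le _ um))// -lp_normX// u0 expr0n gtn_eqF.
rewrite /lp_series seriesSr => le0.
have sk : 0 <= lp_series u k.
  by apply: sumr_ge0 => i _; rewrite exprn_ge0 ?rnorm_ge0.
have h : rnorm (u k) ^+ p <= 0 by apply: le_trans le0; rewrite lerDr.
have : rnorm (u k) ^+ p == 0 by rewrite eq_le h exprn_ge0 ?rnorm_ge0.
by rewrite expf_eq0 p0 => /eqP.
Qed.

Lemma lp_seriesZ (c : R[i]) u :
  lp_series (c *: u) = (rnorm c ^+ p) *: lp_series u.
Proof.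
apply/funext => n.
rewrite -[RHS]/(rnorm c ^+ p * lp_series u n) /lp_series /series/= mulr_sumr.
by apply: eq_bigr => k _; rewrite rnormZ exprMn.
Qed.

Lemma lp_memZ (c : R[i]) u : lp_mem u -> lp_mem (c *: u).
Proof.
by move=> /asboolP cu; apply/asboolP; rewrite lp_seriesZ; exact: (@is_cvgZl_tmp R R^o).
Qed.

Lemma lp_normZ (c : R[i]) u : lp_mem u ->
  lp_norm (c *: u) = rnorm c * lp_norm u.
Proof.
move=> um; have cu := lp_memZ c um; apply/eqP.
rewrite -(@eqrXn2 _ p) ?p0 ?mulr_ge0 ?rnorm_ge0 ?lp_norm_ge0//; apply/eqP.
rewrite exprMn (lp_normX cu) (lp_normX um) lp_seriesZ.
by apply: (@limZl_tmp R R^o); exact/asboolP.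
Qed.

Let convexX (t x y : R) : 0 <= t <= 1 -> 0 <= x -> 0 <= y ->
  (t * x + (1 - t) * y) ^+ p <= t * x ^+ p + (1 - t) * y ^+ p.
Proof.
move=> /andP[t0 t1] x0 y0.
have := @convex_powR R p%:R _ (Itv01 t0 t1) x y.
rewrite !inE/= !in_itv/= x0 y0 => /(_ _ isT isT).
rewrite -!powR_mulrn//; first by apply; rewrite ler1n.
by rewrite addr_ge0// mulr_ge0// subr_ge0.
Qed.

Let minkowskiX (x y a b : R) : 0 < a -> 0 < b -> 0 <= x -> 0 <= y ->
  (x + y) ^+ p <=
  (a + b) ^+ p * (a / (a + b) * (x ^+ p / a ^+ p) + b / (a + b) * (y ^+ p / b ^+ p)).
Proof.
move=> a0 b0 x0 y0; have ab0 : 0 < a + b by rewrite addr_gt0.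
have e c d : 0 < c -> (a + b) * (c / (a + b) * (d / c)) = d.
  move=> c0; rewrite mulrA [_ * (c / _)]mulrC divfK ?gt_eqF//.
  by rewrite mulrC divfK ?gt_eqF.
have tE : b / (a + b) = 1 - a / (a + b).
  by rewrite -[1](divff (lt0r_neq0 ab0)) -mulrBl addrAC subrr add0r.
rewrite -!expr_div_n -[in leLHS](e a x a0) -[in leLHS](e b y b0) -mulrDr exprMn.
rewrite ler_pM2l ?exprn_gt0// tE; apply: convexX.
- by rewrite divr_ge0 ?(ltW a0) ?(ltW ab0)//= ler_pdivrMr// mul1r lerDl ltW.
- exact: divr_ge0 x0 (ltW a0).
- exact: divr_ge0 y0 (ltW b0).
Qed.

Lemma lp_normD u v : lp_mem u -> lp_mem v ->
  lp_mem (u + v) /\ lp_norm (u + v) <= lp_norm u + lp_norm v.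
Proof.
move=> um vm.
have [/(lp_norm0_eq0 um) ->|] := eqVneq (lp_norm u) 0.
  by rewrite add0r lerDr lp_norm_ge0.
have [/(lp_norm0_eq0 vm) -> _|] := eqVneq (lp_norm v) 0.
  by rewrite addr0 lerDl lp_norm_ge0.
move: (lp_normX um) (lp_normX vm) (lp_norm_ge0 u) (lp_norm_ge0 v).
move: (lp_norm u) (lp_norm v) => a b aE bE age0 bge0 bn0 an0.
have a0 : 0 < a by rewrite lt0r an0.
have b0 : 0 < b by rewrite lt0r bn0.
have ab0 : 0 < a + b by rewrite addr_gt0.
apply: lp_norm_le => [|n]; first exact: ltW.
have ua : lp_series u n / a ^+ p <= 1.
  by rewrite ler_pdivrMr ?exprn_gt0// mul1r aE; exact: lp_series_le.
have vb : lp_series v n / b ^+ p <= 1.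
  by rewrite ler_pdivrMr ?exprn_gt0// mul1r bE; exact: lp_series_le.
apply: (@le_trans _ _ ((a + b) ^+ p * (a / (a + b) * (lp_series u n / a ^+ p) +
   b / (a + b) * (lp_series v n / b ^+ p)))).
  rewrite /lp_series /series/= !mulr_suml !mulr_sumr -big_split/= mulr_sumr.
  apply: ler_sum => k _.
  apply: le_trans (minkowskiX a0 b0 (rnorm_ge0 (u k)) (rnorm_ge0 (v k))).
  by apply: lerXn2r (rnormD _ _); rewrite nnegrE ?addr_ge0 ?rnorm_ge0.
move: (lp_series u n / _) (lp_series v n / _) ua vb => c d c1 d1.
rewrite -[leRHS]mulr1 ler_pM2l ?exprn_gt0//.
rewrite -[leRHS](divff (lt0r_neq0 ab0)) mulrDl.
by apply: lerD; rewrite -[leRHS]mulr1 ler_wpM2l// divr_ge0// ltW.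
Qed.

End lp_def.

Section lp_type.
Context (R : realType) (p : nat) (p1 : (1 < p)%N).

Definition lp_pred of (1 < p)%N : {pred (nat -> R[i])} := @lp_mem R p.

Lemma lp_submod : GRing.submod_closed (lp_pred p1).
Proof.
split=> [|c u v um vm].
  have [] // := @lp_norm_le R p p1 0 0 (lexx _) => n.
  rewrite /lp_series /series/= big1 ?exprn_ge0// => k _.
  by rewrite /rnorm normr0 expr0n gtn_eqF// ltnW.
by have [] := lp_normD p1 (lp_memZ c um) vm.
Qed.
HB.instance Definition _ := GRing.isSubmodClosed.Build _ _ (lp_pred p1) lp_submod.

(* The proof of [1 < p] is a parameter so that the norm is one. *)
Record lp := Lp { lp_seq :> nat -> R[i]; lp_seqP : lp_seq \in lp_pred p1 }.

HB.instance Definition _ := [isSub for lp_seq].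
HB.instance Definition _ := [Choice of lp by <:].
HB.instance Definition _ := [SubChoice_isSubLmodule of lp by <:].

Lemma lp_ler_normD (x y : lp) :
  (lp_norm p (lp_seq (x + y)))%:C <=
  (lp_norm p (lp_seq x))%:C + (lp_norm p (lp_seq y))%:C.
Proof.
by rewrite -rmorphD/= lecR; have [] := lp_normD p1 (lp_seqP x) (lp_seqP y).
Qed.

Lemma lp_normrZ (c : R[i]) (x : lp) :
  (lp_norm p (lp_seq (c *: x)))%:C = `|c| * (lp_norm p (lp_seq x))%:C.
Proof.
by rewrite -(@rnormE R R[i]) -rmorphM/= -(lp_normZ p1)//; exact: lp_seqP.
Qed.

Lemma lp_normr0_eq0 (x : lp) : (lp_norm p (lp_seq x))%:C = 0 -> x = 0.
Proof.
move=> /(@complexI R) x0; apply: val_inj.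
exact: (lp_norm0_eq0 p1 (lp_seqP x)).
Qed.

HB.instance Definition _ := Lmodule_isNormed.Build R[i] lp
  lp_ler_normD lp_normrZ lp_normr0_eq0.

Lemma lp_normE (x : lp) : `|x| = (lp_norm p (lp_seq x))%:C.
Proof. by []. Qed.

Definition lp_delta (k j : nat) : R[i] := (j == k)%:R.

Lemma lp_deltaP k : lp_delta k \in lp_pred p1.
Proof.
have [] // := @lp_norm_le R p p1 (lp_delta k) 1 ler01 => n.
rewrite expr1n /lp_series /series/= /lp_delta.
rewrite (eq_bigr (fun j => (j == k)%:R)) => [|j _]; last first.
  by rewrite /rnorm; case: eqP => _; rewrite ?normr1 ?normr0 ?expr1n// expr0n gtn_eqF// ltnW.
have [kn|nk] := ltnP k n.
  rewrite (bigD1_seq k) ?mem_index_iota ?iota_uniq//= eqxx big1 ?addr0// => j /negPf -> //.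
rewrite big_seq big1// => j; rewrite mem_index_iota => /andP[_ jn].
by rewrite ltn_eqF// (leq_trans jn nk).
Qed.

Definition lp_basis (k : nat) : lp := Lp (lp_deltaP k).

End lp_type.

Lemma near_eq_differentiable (R : realType) (V W : normedModType R[i])
    (f g : V -> W) (x : V) :
  (\forall y \near x, f y = g y) -> differentiable f x -> differentiable g x.
Proof.
move=> fg /diff_locallyP[cdf dfE].
have fgx : f x = g x by apply: nbhs_singleton fg.
have gE : g \o shift x = cst (g x) + 'd f x +o_ 0 id.
  apply/eqaddoP => e e0.
  have /eqaddoP/(_ e e0) := dfE.
  have fg0 : \forall h \near 0, f (h + x) = g (h + x).
    by move: fg; rewrite (near_shift 0)/= subr0.
  move=> H; near=> h.
  have : `|(f \o shift x - (cst (f x) + 'd f x)) h| <= e * `|h| by near: h.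
  rewrite !fctE/= fgx (_ : f (h + x) = g (h + x))//; near: h; exact: fg0.
by apply/diff_locallyP; rewrite (diff_unique cdf gE).
Unshelve. all: by end_near. Qed.

Section holomorphic_functions.
Context (R : realType) (p : nat) (p1 : (1 < p)%N).
Local Notation lp := (lp R p1).

Definition uball := {x : lp | `|x| < 1}.

(* s B_{l_p}, as a subset of the open unit ball. *)
Definition sball (s : R) : set uball := [set x | `|val x| < s%:C].

(* Differentials are defined for functions on the whole space; at points of the
   open unit ball they do not depend on the extension. *)
Definition extend0 (f : uball -> R[i]) (x : lp) : R[i] := oapp f 0 (insub x).

Definition holomorphic (f : uball -> R[i]) :=
  forall x : uball, differentiable (extend0 f) (val x).

Definition bounded_type (f : uball -> R[i]) :=
  forall s : R, 0 < s < 1 ->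
    exists M : R, forall x, sball s x -> `|f x| <= M%:C.

Definition Hb_pred : {pred (uball -> R[i])} :=
  fun f => `[< holomorphic f /\ bounded_type f >].

Lemma extend0_val f (x : uball) : extend0 f (val x) = f x.
Proof. by rewrite /extend0 valK. Qed.

Lemma near_uball (x : uball) : \forall y \near val x, `|y| < 1.
Proof.
have x1 := valP x; apply/nbhs_ballP; exists (1 - `|val x|) => /=.
  by rewrite subr_gt0.
move=> y; rewrite -ball_normE/= => xy.
rewrite -[y](subrK (val x)) (le_lt_trans (ler_normD _ _))//.
by rewrite distrC -ltrBrDr.
Qed.

Lemma holomorphic_cst (c : R[i]) : holomorphic (fun=> c).
Proof.
move=> x; apply: (@near_eq_differentiable R lp R[i] (cst c)); last first.
  exact: differentiable_cst.
by apply: filterS (near_uball x) => y y1; rewrite /extend0 insubT.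
Qed.

Lemma bounded_type_cst (c : R[i]) : bounded_type (fun=> c).
Proof. by move=> s _; exists (rnorm c) => x _; rewrite rnormE. Qed.

Lemma holomorphicZD (c : R[i]) f g :
  holomorphic f -> holomorphic g -> holomorphic (c *: f + g).
Proof.
move=> hf hg x.
rewrite (_ : extend0 _ = c *: extend0 f + extend0 g).
  exact: (differentiableD (differentiableZ c (hf x)) (hg x)).
by apply/funext => y; rewrite !fctE /extend0; case: insubP => //= _; rewrite scaler0 addr0.
Qed.

Lemma bounded_typeZD (c : R[i]) f g :
  bounded_type f -> bounded_type g -> bounded_type (c *: f + g).
Proof.
move=> bf bg s s01; have [M fM] := bf s s01; have [N gN] := bg s s01.
exists (rnorm c * M + N) => x xs.
rewrite rmorphD rmorphM/= rnormE (le_trans (ler_normD _ _))// lerD ?gN//.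
by rewrite normrZ ler_wpM2l// fM.
Qed.

Lemma holomorphicM f g : holomorphic f -> holomorphic g -> holomorphic (f * g).
Proof.
move=> hf hg x.
rewrite (_ : extend0 _ = extend0 f * extend0 g).
  exact: (differentiableM (hf x) (hg x)).
by apply/funext => y; rewrite !fctE /extend0; case: insubP => //= _; rewrite mulr0.
Qed.

Lemma bounded_typeM f g :
  bounded_type f -> bounded_type g -> bounded_type (f * g).
Proof.
move=> bf bg s s01; have [M fM] := bf s s01; have [N gN] := bg s s01.
exists (M * N) => x xs.
by rewrite rmorphM/= normrM ler_pM ?normr_ge0 ?fM ?gN.
Qed.

Lemma Hb_submod : GRing.submod_closed Hb_pred.
Proof.
split=> [|c f g /asboolP[hf bf] /asboolP[hg bg]]; apply/asboolP.
  split; [exact: holomorphic_cst|exact: bounded_type_cst].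
split; [exact: holomorphicZD|exact: bounded_typeZD].
Qed.
HB.instance Definition _ := GRing.isSubmodClosed.Build _ _ Hb_pred Hb_submod.

Lemma Hb_mulr_closed : GRing.mulr_closed Hb_pred.
Proof.
split=> [|f g /asboolP[hf bf] /asboolP[hg bg]]; apply/asboolP.
  split; [exact: holomorphic_cst|exact: bounded_type_cst].
split; [exact: holomorphicM|exact: bounded_typeM].
Qed.
HB.instance Definition _ := GRing.isMulClosed.Build _ Hb_pred Hb_mulr_closed.

Record Hb := MkHb { Hb_fun :> uball -> R[i]; HbP : Hb_fun \in Hb_pred }.

HB.instance Definition _ := [isSub for Hb_fun].
HB.instance Definition _ := [Choice of Hb by <:].
HB.instance Definition _ := [SubChoice_isSubLmodule of Hb by <:].
HB.instance Definition _ :=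
  GRing.SubZmodule_isSubPzRing.Build _ _ Hb (subringClosedP _).
HB.instance Definition _ := GRing.SubPzRing_isSubComPzRing.Build _ _ Hb.

HB.instance Definition _ := Uniform.copy Hb
  (initial_topology (Hb_fun :
     Hb -> {family [set sball s | s in [set s : R | 0 < s < 1]], uball -> R[i]})).

(* The n-th differential [d^n f(y)(z) = d^n f(y)(z,...,z)] is obtained by
   differentiating n times in the direction z. *)
Definition taylor (f : uball -> R[i]) (n : nat) (z : lp) (y : uball) : R[i] :=
  iter n (fun (g : lp -> R[i]) x => 'd g x z) (extend0 f) (val y) / n`!%:R.

Definition prec (phi : Hb -> R[i]) (A : set uball) :=
  forall f : Hb, ((rnorm (phi f))%:E <= ereal_sup [set (rnorm (f x))%:E | x in A])%E.

Record Mb := MkMb {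
  Mb_fun :> Hb -> R[i];
  Mb_linear : scalar Mb_fun;
  Mb_mult : {morph Mb_fun : f g / f * g};
  Mb_continuous : continuous Mb_fun;
  Mb_neq0 : exists f, Mb_fun f != 0 }.

HB.instance Definition _ := gen_eqMixin Mb.
HB.instance Definition _ := gen_choiceMixin Mb.

(* [is_translate phi z psi] says that phi^z is a well-defined element of the
   spectrum, equal to psi. *)
Definition is_translate (phi : Mb) (z : lp) (psi : Mb) :=
  forall f : Hb, exists2 g : nat -> Hb,
    (forall n, Hb_fun (g n) = taylor f n z) &
    series (fun n => phi (g n)) @ \oo --> psi f.

Lemma is_translate_inj phi z psi1 psi2 :
  is_translate phi z psi1 -> is_translate phi z psi2 -> psi1 = psi2.
Proof.
move=> h1 h2; have e : Mb_fun psi1 = Mb_fun psi2.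
  apply/funext => f; have [g1 g1E c1] := h1 f; have [g2 g2E c2] := h2 f.
  have gE : g1 = g2 by apply/funext => n; apply: val_inj; rewrite /= g1E g2E.
  rewrite gE in c1; exact: (cvg_unique _ c1 c2).
case: psi1 psi2 e {h1 h2} => [f1 a1 b1 c1 d1] [f2 a2 b2 c2 d2]/= e.
by subst f2; f_equal; exact: Prop_irrelevance.
Qed.

Definition basic_nbhd (phi : Mb) (e : R) : set Mb :=
  [set psi | exists2 z : lp, `|z| < e%:C & is_translate phi z psi].

Definition Mb_base : set (set Mb) :=
  [set U | exists (phi : Mb) (s e : R),
     [/\ 0 < s < 1, prec phi (sball s), 0 < e < 1 - s & U = basic_nbhd phi e]].

(* [Mb_base] is a base of the topology of the Riemann domain, which is thus the
   topology it generates; generating it as from a subbase needs no proof of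
   that fact. *)
HB.instance Definition _ := isSubBaseTopological.Build Mb Mb_base id.

Definition sheet (phi : Mb) : set Mb := connected_component [set: Mb] phi.

Definition block_sequence (x : nat -> lp) :=
  exists (J : nat -> {fset nat}) (alpha : nat -> R[i]),
    [/\ forall n, J n != fset0,
        forall n j k, j \in J n -> k \in J n.+1 -> (j < k)%N &
        forall n, x n = \sum_(k <- J n) alpha k *: lp_basis R p1 k].

(* The cluster point is taken in the topology of pointwise convergence on [Hb],
   not in the topology of [Mb]. *)
Definition block_hom (r : R) (phi : Mb) :=
  exists x : nat -> uball,
    [/\ block_sequence (fun n => val (x n)),
        forall n, `|val (x n)| = r%:C &
        cluster ((fun n => (fun f : Hb => f (x n)) : {ptws Hb -> R[i]}) @ \oo)
          (Mb_fun phi)].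

End holomorphic_functions.

(* Main.v *)
Require Import Defs.
From HB Require Import structures.
From mathcomp Require Import all_boot all_order all_algebra finmap complex.
From mathcomp Require Import all_classical all_reals all_analysis.
From mathcomp Require Import ring lra.

(** An r-block homomorphism phi is a cluster point of the evaluations at the
    points x_n, so it is dominated by every tail {x_n : n >= N} (block_prec).
    The supports of the x_n run off to infinity; up to a small tail, a fixed z
    is therefore disjointly supported from x_n for n large, and ||x_n + z||^p
    tends to r^p + ||z||^p.

    Existence of phi^z. If r^p + ||z||^p < 1, the points x_n + c z stay in a
    fixed ball of radius less than 1 for all n large and all complex c with |c|
    <= rho, for some rho > 1 (admissible_tail). Cauchy's estimate for the
    Taylor remainder in the direction z then shows that the Taylor series of
    every f converges to f(x_n + z) uniformly on a tail. A functional dominated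
    by a set sees nothing but uniform limits on that set, hence phi^z(f) exists
    and may be computed along any sequence that converges uniformly on the tail
    to f translated by z (translate_unif_on). Linearity, multiplicativity,
    domination of phi^z by the translated set, and the law (phi^z)^u =
    phi^(z+u) all follow from this principle.

    The translates do not reach the boundary of their domain. Since p is a
    natural number, sum_k c_k y_k^p is a holomorphic polynomial of norm at most
    1 when |c_k| <= 1, and the c_k can be chosen so that its value at x_n + v
    is close to r^p + ||v||^p for all n large (block_poly). Testing phi^z,
    dominated by s B for some s < 1, where B is the unit ball (Mb_prec), on this
    polynomial translated by u gives r^p + ||z + u||^p <= (s + ||u||)^p
    (translate_block_norm). So z + u again satisfies the strict inequality
    whenever ||u|| < 1 - s, that is, whenever (phi^z)^u is one of the points of
    a basic neighbourhood of phi^z.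

    The sheet. The set of translates is consequently open. It is closed: if
    chi^w = phi^z for some small w then chi = (phi^z)^(-w) = phi^(z-w). It is
    connected by the paths t |-> phi^(tz). Hence it is the connected component
    of phi.

    A holomorphic function is here one that is Frechet differentiable over the
    complex field, so its expansions have to be derived from differentiability
    alone. Goursat's argument yields Cauchy's formula for a circle
    (cauchy_formula), whence the Taylor expansion with remainder of a function
    of one variable (cauchy_expansion), and, by restriction to complex lines,
    the estimates on normed spaces, including that pointwise limits of
    uniformly bounded holomorphic functions are holomorphic
    (differentiable_clim). The expansion is needed on a full disc, not only on
    a smaller concentric one, because the condition r^p + ||z||^p < 1 is
    sharp. *)

Set Implicit Arguments.
Unset Strict Implicit.
Unset Printing Implicit Defensive.
Import numFieldNormedType.Exports.
Import Order.TTheory GRing.Theory Num.Theory.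
Local Open Scope classical_set_scope.
Local Open Scope ring_scope.
Local Open Scope complex_scope.

(** * Real-valued norms, and limits of complex sequences *)
Section complex_modulus.
Context (R : realType).
Implicit Types (x y : R[i]).

Lemma cnormM x y : rnorm (x * y) = rnorm x * rnorm y.
Proof. by apply: (@complexI R); rewrite rmorphM/= !rnormE normrM. Qed.

Lemma cnormV x : rnorm x^-1 = (rnorm x)^-1.
Proof. by apply: (@complexI R); rewrite fmorphV/= !rnormE normfV. Qed.

Lemma cnormX x n : rnorm (x ^+ n) = rnorm x ^+ n.
Proof. by apply: (@complexI R); rewrite rmorphXn/= !rnormE normrX. Qed.

Lemma rnormN (V : normedModType R[i]) (x : V) : rnorm (- x) = rnorm x.
Proof. by rewrite /rnorm normrN. Qed.

Lemma rnormB (V : normedModType R[i]) (x y : V) : rnorm (x - y) <= rnorm x + rnorm y.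
Proof. by rewrite -(rnormN y); exact: rnormD. Qed.

Lemma rnormBC (V : normedModType R[i]) (x y : V) : rnorm (x - y) = rnorm (y - x).
Proof. by rewrite /rnorm distrC. Qed.

Lemma rnorm0 (V : normedModType R[i]) : rnorm (0 : V) = 0.
Proof. by rewrite /rnorm normr0. Qed.

Lemma rnorm_gt0 (V : normedModType R[i]) (x : V) : (0 < rnorm x) = (x != 0).
Proof. by rewrite -ltcR rnormE normr_gt0. Qed.

Lemma cnorm1 : rnorm (1 : R[i]) = 1.
Proof. by rewrite /rnorm normr1. Qed.

Lemma cnormR (a : R) : rnorm (a%:C : R[i]) = `|a|.
Proof.
by rewrite /rnorm normc_def/= expr0n addr0 sqrtr_sqr.
Qed.

Lemma cnormi : rnorm ('i : R[i]) = 1.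
Proof. by rewrite /rnorm normc_def/= expr0n expr1n add0r sqrtr1. Qed.

Lemma Re_le_cnorm x : `|complex.Re x| <= rnorm x.
Proof. by rewrite -lecR rnormE; exact: normc_ge_Re. Qed.

Lemma Im_le_cnorm x : `|complex.Im x| <= rnorm x.
Proof.
by case: x => a b; rewrite /rnorm normc_def/= -sqrtr_sqr ler_wsqrtr// lerDr sqr_ge0.
Qed.

Lemma cnorm_le_ReIm x : rnorm x <= `|complex.Re x| + `|complex.Im x|.
Proof.
rewrite [X in rnorm X]complexE (le_trans (rnormD _ _))// cnormM cnormi mul1r.
by rewrite !cnormR.
Qed.

Lemma cnorm_sum (I : Type) (s : seq I) (P : pred I) (F : I -> R[i]) :
  rnorm (\sum_(i <- s | P i) F i) <= \sum_(i <- s | P i) rnorm (F i).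
Proof.
elim/big_rec2 : _ => [|i y1 y2 _ h]; first by rewrite rnorm0.
by rewrite (le_trans (rnormD _ _))// lerD2l.
Qed.

Lemma ReB x y : complex.Re (x - y) = complex.Re x - complex.Re y.
Proof. exact: raddfB. Qed.
Lemma ImB x y : complex.Im (x - y) = complex.Im x - complex.Im y.
Proof. exact: raddfB. Qed.

Definition clim (u : nat -> R[i]) (l : R[i]) :=
  forall e : R, 0 < e -> exists N, forall n, (N <= n)%N -> rnorm (u n - l) <= e.

Lemma clim_cvg u l : clim u l <-> u @ \oo --> l.
Proof.
split=> [h|/cvgrPdist_le h e e0].
  apply/cvgrPdist_le => e e0.
  have eE : e = (complex.Re e)%:C by rewrite RRe_real// gtr0_real.
  have [|N hN] := h (complex.Re e); first by rewrite -ltcR -eE.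
  near=> n; rewrite eE distrC -rnormE lecR hN//; near: n; exact: nbhs_infty_ge.
have [|N _ hN] := h e%:C; first by rewrite ltcR.
by exists N => n /hN; rewrite distrC -rnormE lecR.
Unshelve. all: by end_near. Qed.

Lemma clim_uniq u l l' : clim u l -> clim u l' -> l = l'.
Proof. by move=> /clim_cvg h /clim_cvg; exact: cvg_unique. Qed.

(** The real and imaginary parts are real Cauchy sequences. *)
Lemma clim_cauchy u : (forall e : R, 0 < e ->
    exists N, forall n m, (N <= n)%N -> (N <= m)%N -> rnorm (u n - u m) <= e) ->
  exists l, clim u l.
Proof.
move=> h.
have aux (F : R[i] -> R) : (forall x y, `|F x - F y| <= rnorm (x - y)) ->
    cvgn (F \o u).
  move=> hF; apply/cauchy_cvgP/cauchy_ballP => e e0.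
  have [|N hN] := h (e / 2); first by rewrite divr_gt0.
  exists ([set F (u n) | n in [set n | (N <= n)%N]], [set F (u n) | n in [set n | (N <= n)%N]]).
    split; (apply/nbhs_ballP => /= || exists N => // n /= Nn; by exists n).
  move=> [_ _] [[n Nn <-] [m Nm <-]] /=.
  rewrite /ball/= (le_lt_trans (hF _ _))// (le_lt_trans (hN n m Nn Nm))//.
  by rewrite gtr_pMr// invf_lt1// ltr1n.
have /cvgrPdist_le cr := aux (@complex.Re R) (fun x y => ltac:(rewrite -ReB; exact: Re_le_cnorm)).
have /cvgrPdist_le ci := aux (@complex.Im R) (fun x y => ltac:(rewrite -ImB; exact: Im_le_cnorm)).
exists (limn (@complex.Re R \o u) +i* limn (@complex.Im R \o u)) => e e0.
have e20 : 0 < e / 2 by rewrite divr_gt0.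
have [N1 _ h1] := cr _ e20; have [N2 _ h2] := ci _ e20.
exists (maxn N1 N2) => n; rewrite geq_max => /andP[n1 n2].
rewrite (le_trans (cnorm_le_ReIm _))// ReB ImB/= [e]splitr lerD// distrC; [exact: h1|exact: h2].
Qed.

End complex_modulus.

(** * Integrals of continuous functions as differences of primitives *)
Section primitives.
Context (R : realType).
Local Notation mu := (@lebesgue_measure R).
Implicit Types (u v U F : R -> R) (a b x : R).

Lemma is_deriveP (F : R -> R) (x d : R) :
  is_derive x 1 F d <->
  forall e : R, 0 < e -> exists2 k : R, 0 < k &
    forall h, `|h| < k -> `|F (x + h) - F x - h * d| <= e * `|h|.
Proof.
split=> [[+ dE]|H].
  rewrite /derivable -/(derive F x 1) => /cvg_ex[l /= Fl].
  have ld : l = d by rewrite -dE; apply/esym/cvg_lim.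
  move: Fl; rewrite ld => /cvgrPdist_le Fd e e0.
  have /nbhs_ballP[k /= k0 hk] := Fd e e0.
  exists k => // h hk'; have [->|h0] := eqVneq h 0.
    by rewrite addr0 subrr mul0r subrr normr0 mulr0.
  have := hk h; rewrite /ball/= sub0r normrN => /(_ hk' h0) /=.
  rewrite [h *: 1]mulr1 [h + x]addrC => hh.
  have -> : F (x + h) - F x - h * d = - (h * (d - h^-1 * (F (x + h) - F x))).
    by field.
  by rewrite normrN normrM mulrC ler_wpM2r.
have c : h^-1 *: (F (h *: 1 + x) - F x) @[h --> 0^'] --> d.
  apply/cvgrPdist_le => e e0; have [k k0 hk] := H e e0.
  apply/nbhs_ballP; exists k => //= h; rewrite /ball/= sub0r normrN => hk' h0.
  rewrite [h *: 1]mulr1 [h + x]addrC.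
  rewrite -(ler_pM2r (_ : 0 < `|h|)) ?normr_gt0// -normrM.
  rewrite (le_trans _ (hk h hk'))// -normrN le_eqVlt; apply/orP; left; apply/eqP.
  rewrite -[h^-1 *: (F (x + h) - F x)]/(h^-1 * (F (x + h) - F x)).
  by congr (`| _ |); field.
by split; [apply/cvg_ex; exists d|apply: cvg_lim].
Qed.

(** Based at -1, it is differentiable on a neighbourhood of every interval with
    end points in [0, +oo[, so one-sided derivatives never occur. *)
Definition primitive (u : R -> R) (x : R) : R := \int[mu]_(t in `[-1, x]) u t.

Lemma is_derive_primitive u : continuous u ->
  forall x, -1 < x -> is_derive x 1 (primitive u) (u x).
Proof.
move=> cu x x1.
have iu : mu.-integrable `[-1, x + 1] (EFin \o u).
  apply: continuous_compact_integrable; first exact: segment_compact.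
  exact: continuous_subspaceT.
have xx1 : x < x + 1 by rewrite ltrDl.
have [d1 d2] := continuous_FTC1_closed xx1 iu x1 (cu x).
by split; [exact: d1|rewrite -derive1E].
Qed.

(** With this definition additivity in the interval is a telescoping identity
    that asks nothing of the order of the end points, and everything else
    follows from the mean value theorem. *)
Definition rintegral_def u a b := primitive u b - primitive u a.
Definition rintegral := locked rintegral_def.

Lemma rintegralE u a b : rintegral u a b = primitive u b - primitive u a.
Proof. by rewrite /rintegral -lock. Qed.

Let mean_value (F : R -> R) (df : R -> R) (a b : R) : 0 <= a -> a <= b ->
  (forall x, -1 < x -> is_derive x 1 F (df x)) ->
  exists2 c, a <= c <= b & F b - F a = df c * (b - a).
Proof.
move=> a0 ab dF.
have N1 x : a <= x -> -1 < x by move=> ax; rewrite (lt_le_trans _ ax)// (lt_le_trans _ a0)// ltrN10.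
have [x xab||c cab FE] := @MVT_segment R F df a b ab.
- by apply: dF; apply: N1; move: xab; rewrite in_itv/= => /andP[/ltW].
- apply: continuous_in_subspaceT => x; rewrite inE/= in_itv/= => /andP[ax _].
  have [dx _] := dF x (N1 _ ax).
  by apply: differentiable_continuous; apply/derivable1_diffP.
- by exists c => //; move: cab; rewrite in_itv.
Qed.

Lemma rintegral_ftc u U a b : continuous u -> 0 <= a -> a <= b ->
  (forall x, -1 < x -> is_derive x 1 U (u x)) -> rintegral u a b = U b - U a.
Proof.
move=> cu a0 ab dU.
have dd x : -1 < x -> is_derive x 1 (primitive u - U) 0.
  move=> x1; have h1 := is_derive_primitive cu x1; have h2 := dU x x1.
  by rewrite -(subrr (u x)); exact: is_deriveB.
have [c _] := mean_value a0 ab dd; rewrite mul0r !fctE rintegralE => E.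
by apply/eqP; rewrite -subr_eq0 -E; apply/eqP; ring.
Qed.

Lemma rintegral_le u a b M : continuous u -> 0 <= a -> a <= b ->
  (forall x, a <= x <= b -> `|u x| <= M) -> `|rintegral u a b| <= M * (b - a).
Proof.
move=> cu a0 ab hu; rewrite rintegralE.
have [c cab ->] := mean_value a0 ab (is_derive_primitive cu).
by rewrite normrM [X in _ * X]ger0_norm ?subr_ge0// ler_wpM2r ?subr_ge0// hu.
Qed.

Lemma rintegralD u v a b : continuous u -> continuous v -> 0 <= a -> a <= b ->
  rintegral (fun x => u x + v x) a b = rintegral u a b + rintegral v a b.
Proof.
move=> cu cv a0 ab.
have cuv : continuous (fun x => u x + v x) by move=> x; apply: cvgD; [exact: cu|exact: cv].
transitivity ((primitive u + primitive v) b - (primitive u + primitive v) a); last first.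
  by rewrite !fctE !rintegralE; ring.
apply: rintegral_ftc => // x x1.
have := is_derive_primitive cu x1; have := is_derive_primitive cv x1; move=> h1 h2.
exact: is_deriveD.
Qed.

Lemma rintegralZ k u a b : continuous u -> 0 <= a -> a <= b ->
  rintegral (fun x => k * u x) a b = k * rintegral u a b.
Proof.
move=> cu a0 ab.
have cku : continuous (fun x => k * u x) by move=> x; apply: cvgMr; exact: cu.
transitivity ((k *: primitive u) b - (k *: primitive u) a); last first.
  by rewrite !fctE !rintegralE -![k *: _]/(k * _); ring.
apply: rintegral_ftc => // x x1.
have := is_derive_primitive cu x1; move=> h1.
exact: is_deriveZ.
Qed.

Lemma rintegral_split u a b c : rintegral u a b + rintegral u b c = rintegral u a c.
Proof. by rewrite !rintegralE; ring. Qed.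

End primitives.

(** * Integrals of complex curves and complex derivatives *)
Section complex_integral.
Context (R : realType).
Implicit Types (u v U : R -> R[i]) (a b x : R) (H : R[i] -> R[i]).

Lemma ccontP u x : {for x, continuous u} <->
  forall e : R, 0 < e -> exists2 k : R, 0 < k &
    forall h, `|h| < k -> rnorm (u (x + h) - u x) <= e.
Proof.
split=> [/cvgrPdist_le H e e0|H].
  have [|k /= k0 hk] := (nbhs_ballP _ _).1 (H e%:C _); first by rewrite ltcR.
  exists k => // h hk'; have := hk (x + h).
  rewrite /ball/= opprD addNKr normrN => /(_ hk') /=.
  by rewrite distrC -rnormE lecR.
apply/cvgrPdist_le => e e0.
have eE : e = (complex.Re e)%:C by rewrite RRe_real// gtr0_real.
have [|k k0 hk] := H (complex.Re e); first by rewrite -ltcR -eE.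
apply/nbhs_ballP; exists k => //= y; rewrite /ball/= distrC => /hk.
by rewrite subrKC distrC eE -rnormE lecR.
Qed.

Lemma ccont_Re u : continuous u -> continuous (@complex.Re R \o u).
Proof.
move=> cu x; apply/cvgrPdist_le => e e0.
have [k k0 hk] := (ccontP _ _).1 (cu x) e e0.
apply/nbhs_ballP; exists k => //= y; rewrite /ball/= distrC => /hk.
by rewrite subrKC distrC; apply: le_trans; rewrite -ReB Re_le_cnorm.
Qed.

Lemma ccont_Im u : continuous u -> continuous (@complex.Im R \o u).
Proof.
move=> cu x; apply/cvgrPdist_le => e e0.
have [k k0 hk] := (ccontP _ _).1 (cu x) e e0.
apply/nbhs_ballP; exists k => //= y; rewrite /ball/= distrC => /hk.
by rewrite subrKC distrC; apply: le_trans; rewrite -ImB Im_le_cnorm.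
Qed.

Lemma ccont_real (f : R -> R) : continuous f -> continuous (fun x => (f x)%:C : R[i]).
Proof.
move=> cf x; apply/ccontP => e e0.
have /cvgrPdist_le/(_ e e0)/nbhs_ballP[k /= k0 hk] := cf x.
exists k => // h hh; rewrite -rmorphB/= cnormR distrC; apply: hk.
by rewrite /ball/= opprD addNKr normrN.
Qed.

Definition cint_def u a b : R[i] :=
  rintegral (@complex.Re R \o u) a b +i* rintegral (@complex.Im R \o u) a b.
Definition cint := locked cint_def.

Lemma cintE u a b : cint u a b =
  rintegral (@complex.Re R \o u) a b +i* rintegral (@complex.Im R \o u) a b.
Proof. by rewrite /cint -lock. Qed.

Lemma cint_split u a b c : cint u a b + cint u b c = cint u a c.
Proof. by rewrite !cintE; simpc; rewrite !rintegral_split. Qed.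

Lemma cintD u v a b : continuous u -> continuous v -> 0 <= a -> a <= b ->
  cint (fun x => u x + v x) a b = cint u a b + cint v a b.
Proof.
move=> cu cv a0 ab; rewrite !cintE; simpc.
have eR : @complex.Re R \o (fun x => u x + v x) = fun x => (@complex.Re R \o u) x + (@complex.Re R \o v) x.
  by apply/funext => x /=; rewrite raddfD.
have eI : @complex.Im R \o (fun x => u x + v x) = fun x => (@complex.Im R \o u) x + (@complex.Im R \o v) x.
  by apply/funext => x /=; rewrite raddfD.
by rewrite eR eI !rintegralD//; (exact: ccont_Re || exact: ccont_Im).
Qed.

Lemma cintZ k u a b : continuous u -> 0 <= a -> a <= b ->
  cint (fun x => k * u x) a b = k * cint u a b.
Proof.
move=> cu a0 ab; case: k => k1 k2; rewrite !cintE; simpc.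
have cR := ccont_Re cu; have cI := ccont_Im cu.
have cZ (k : R) (f : R -> R) : continuous f -> continuous (fun x => k * f x).
  by move=> cf x; apply: cvgMr; exact: cf.
have eR : @complex.Re R \o (fun x => (k1 +i* k2) * u x) = fun x => k1 * (@complex.Re R \o u) x + (- k2) * (@complex.Im R \o u) x.
  by apply/funext => x /=; case: (u x) => c d; simpc.
have eI : @complex.Im R \o (fun x => (k1 +i* k2) * u x) = fun x => k1 * (@complex.Im R \o u) x + k2 * (@complex.Re R \o u) x.
  by apply/funext => x /=; case: (u x) => c d; simpc.
rewrite eR eI !rintegralD ?rintegralZ//; try exact: cZ.
by congr (_ +i* _); ring.
Qed.

Lemma cintB u v a b : continuous u -> continuous v -> 0 <= a -> a <= b ->
  cint (fun x => u x - v x) a b = cint u a b - cint v a b.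
Proof.
move=> cu cv a0 ab; have cNv : continuous (fun x => -1 * v x).
  by move=> x; apply: cvgMr; exact: cv.
have -> : (fun x => u x - v x) = (fun x => u x + -1 * v x).
  by apply/funext => x; rewrite mulN1r.
by rewrite (cintD cu cNv a0 ab) (cintZ (-1) cv a0 ab) mulN1r.
Qed.

Lemma cint_sum n (F : nat -> R -> R[i]) a b : (forall k, continuous (F k)) ->
  0 <= a -> a <= b ->
  cint (fun x => \sum_(0 <= k < n) F k x) a b = \sum_(0 <= k < n) cint (F k) a b.
Proof.
move=> cF a0 ab; elim: n => [|n IH].
  rewrite big_geq// -[RHS](mul0r (cint (fun=> 0) a b)) -cintZ//; last first.
    by move=> x; exact: cst_continuous.
  by congr cint; apply/funext => x; rewrite big_geq// mul0r.
rewrite big_nat_recr//= -IH -cintD//.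
- by congr cint; apply/funext => x; rewrite big_nat_recr.
- elim: n {IH} => [|n IH] x.
    rewrite (_ : (fun _ => _) = fun=> 0); first exact: cst_continuous.
    by apply/funext => y; rewrite big_geq.
  rewrite (_ : (fun _ => _) = fun y => \sum_(0 <= k < n) F k y + F n y).
    by apply: cvgD; [exact: IH|exact: cF].
  by apply/funext => y; rewrite big_nat_recr.
Qed.

(** The real and the imaginary parts are estimated separately. The factor 2 so
    lost is harmless: below, only the rate at which bounds tend to 0 matters. *)
Lemma cint_le u a b M : continuous u -> 0 <= a -> a <= b ->
  (forall x, a <= x <= b -> rnorm (u x) <= M) ->
  rnorm (cint u a b) <= 2 * M * (b - a).
Proof.
move=> cu a0 ab hu; rewrite (le_trans (cnorm_le_ReIm _))// cintE /=.
rewrite -mulrA mulr_natl mulr2n lerD//; apply: rintegral_le => //.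
- exact: ccont_Re.
- by move=> x /hu; apply: le_trans; exact: Re_le_cnorm.
- exact: ccont_Im.
- by move=> x /hu; apply: le_trans; exact: Im_le_cnorm.
Qed.

Definition cder U x (d : R[i]) := forall e : R, 0 < e -> exists2 k : R, 0 < k &
  forall h : R, `|h| < k -> rnorm (U (x + h) - U x - h%:C * d) <= e * `|h|.

Lemma cint_ftc u U a b : continuous u -> 0 <= a -> a <= b ->
  (forall x, -1 < x -> cder U x (u x)) -> cint u a b = U b - U a.
Proof.
move=> cu a0 ab dU; rewrite cintE.
have -> : rintegral (@complex.Re R \o u) a b = (@complex.Re R \o U) b - (@complex.Re R \o U) a.
  apply: rintegral_ftc => //; first exact: ccont_Re.
  move=> x x1; apply/is_deriveP => e e0; have [k k0 hk] := dU x x1 e e0.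
  exists k => // h hh; apply: le_trans (hk h hh); apply: le_trans (Re_le_cnorm _) => /=.
  by rewrite !ReB /=; case: (u x) => c d; simpc.
have -> : rintegral (@complex.Im R \o u) a b = (@complex.Im R \o U) b - (@complex.Im R \o U) a.
  apply: rintegral_ftc => //; first exact: ccont_Im.
  move=> x x1; apply/is_deriveP => e e0; have [k k0 hk] := dU x x1 e e0.
  exists k => // h hh; apply: le_trans (hk h hh); apply: le_trans (Im_le_cnorm _) => /=.
  by rewrite !ImB /=; case: (u x) => c d; simpc.
by rewrite /= -ReB -ImB; case: (U b - U a).
Qed.

Definition cdiff H (z d : R[i]) := forall e : R, 0 < e -> exists2 k : R, 0 < k &
  forall w : R[i], rnorm w < k -> rnorm (H (z + w) - H z - w * d) <= e * rnorm w.

Lemma cdiff_lip H z d : cdiff H z d -> exists2 k : R, 0 < k &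
  forall w, rnorm w < k -> rnorm (H (z + w) - H z) <= (1 + rnorm d) * rnorm w.
Proof.
move=> /(_ 1 ltr01)[k k0 hk]; exists k => // w /hk hw.
rewrite -[H (z + w) - H z](subrK (w * d)) (le_trans (rnormD _ _))//.
by rewrite mulrDl lerD// cnormM mulrC.
Qed.

Lemma cder_lip U z d : cder U z d -> exists2 k : R, 0 < k &
  forall w, `|w| < k -> rnorm (U (z + w) - U z) <= (1 + rnorm d) * `|w|.
Proof.
move=> /(_ 1 ltr01)[k k0 hk]; exists k => // w /hk hw.
rewrite -[U (z + w) - U z](subrK (w%:C * d)) (le_trans (rnormD _ _))//.
by rewrite mulrDl lerD// cnormM cnormR mulrC.
Qed.

Lemma cder_comp H U x d g : cdiff H (U x) d -> cder U x g -> cder (H \o U) x (g * d).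
Proof.
move=> dH dU e e0.
have [k1 k10 h1] := cder_lip dU.
set L := 1 + rnorm g; have L0 : 0 < L by rewrite ltr_wpDr// rnorm_ge0.
have [|k2 k20 h2] := dH (e / 2 / L); first by rewrite !divr_gt0.
set M := 1 + rnorm d; have M0 : 0 < M by rewrite ltr_wpDr// rnorm_ge0.
have [|k3 k30 h3] := dU (e / 2 / M); first by rewrite !divr_gt0.
exists (Num.min k1 (Num.min k3 (k2 / L))).
  by rewrite !lt_min k10 k30 divr_gt0.
move=> h; rewrite !lt_min => /and3P[hk1 hk3 hk2].
set w := U (x + h) - U x.
have wL : rnorm w <= L * `|h| by exact: h1.
have := h2 w; rewrite /w subrKC -/w => h2w.
have {}h2w : rnorm (H (U (x + h)) - H (U x) - w * d) <= e / 2 * `|h|.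
  rewrite (le_trans (h2w _))//.
    by rewrite (le_lt_trans wL)// mulrC -ltr_pdivlMr.
  rewrite (le_trans (ler_wpM2l _ wL))//; first by rewrite !divr_ge0// ltW.
  by rewrite mulrA divfK// gt_eqF.
have h3w : rnorm ((w - h%:C * g) * d) <= e / 2 * `|h|.
  have -> : e / 2 * `|h| = e / 2 / M * `|h| * M by field; rewrite gt_eqF.
  by rewrite cnormM ler_pM ?rnorm_ge0 ?lerDr// h3.
rewrite /= [leRHS](_ : _ = e / 2 * `|h| + e / 2 * `|h|); last by field.
have -> : H (U (x + h)) - H (U x) - h%:C * (g * d) =
  (H (U (x + h)) - H (U x) - w * d) + (w - h%:C * g) * d by ring.
by rewrite (le_trans (rnormD _ _))// lerD.
Qed.

Lemma cdiff_cst (c z : R[i]) : cdiff (fun=> c) z 0.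
Proof.
move=> e e0; exists 1 => // w _.
by rewrite subrr mulr0 subrr rnorm0 mulr_ge0 ?rnorm_ge0// ltW.
Qed.

Lemma cdiff_id (z : R[i]) : cdiff id z 1.
Proof.
move=> e e0; exists 1 => // w _.
by rewrite /= mulr1 addrAC addrK subrr rnorm0 mulr_ge0 ?rnorm_ge0// ltW.
Qed.

Lemma cdiffM F H z (a b : R[i]) : cdiff F z a -> cdiff H z b ->
  cdiff (fun y => F y * H y) z (a * H z + F z * b).
Proof.
move=> dF dH e e0.
have [k1 k10 h1] := cdiff_lip dF.
have [k2 k20 h2] := cdiff_lip dH.
set A := 1 + rnorm a; have A0 : 0 < A by rewrite ltr_wpDr// rnorm_ge0.
set B := 1 + rnorm b; have B0 : 0 < B by rewrite ltr_wpDr// rnorm_ge0.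
set K := 1 + rnorm (H z) + rnorm (F z).
have K0 : 0 < K by rewrite ltr_wpDr ?rnorm_ge0// ltr_wpDr// rnorm_ge0.
have [|k3 k30 h3] := dF (e / 2 / K); first by rewrite !divr_gt0.
have [|k4 k40 h4] := dH (e / 2 / K); first by rewrite !divr_gt0.
exists (Num.min (Num.min k1 k2) (Num.min (Num.min k3 k4) (e / 2 / (A * B)))).
  by rewrite !lt_min k10 k30 k20 k40 !divr_gt0// mulr_gt0.
move=> w; rewrite !lt_min => /andP[/andP[w1 w2] /andP[/andP[w3 w4] w5]].
have -> : F (z + w) * H (z + w) - F z * H z - w * (a * H z + F z * b) =
  (F (z + w) - F z) * (H (z + w) - H z) + ((F (z + w) - F z - w * a) * H z
   + (H (z + w) - H z - w * b) * F z) by ring.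
have e2 : e * rnorm w = e / 2 * rnorm w + e / 2 * rnorm w by field.
rewrite e2 (le_trans (rnormD _ _))// lerD//.
  rewrite cnormM (le_trans (ler_pM _ _ (h1 _ w1) (h2 _ w2))) ?rnorm_ge0//.
  rewrite -/A -/B mulrACA mulrA ler_wpM2r ?rnorm_ge0//.
  by rewrite mulrC -ler_pdivlMr ?mulr_gt0// ltW.
have -> : e / 2 * rnorm w = e / 2 / K * rnorm w * K by field; rewrite gt_eqF.
rewrite (le_trans (rnormD _ _))// !cnormM.
have eK : 0 <= e / 2 / K * rnorm w by rewrite mulr_ge0 ?rnorm_ge0// !divr_ge0 ?ltW.
apply: (@le_trans _ _ (e / 2 / K * rnorm w * (rnorm (H z) + rnorm (F z)))).
  by rewrite mulrDr lerD// ler_wpM2r ?rnorm_ge0// ?h3 ?h4.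
by rewrite ler_wpM2l// /K -addrA lerDr.
Qed.

Lemma cdiff_eq H z (a b : R[i]) : a = b -> cdiff H z a -> cdiff H z b.
Proof. by move=> ->. Qed.

Lemma cdiffV (z : R[i]) : z != 0 -> cdiff GRing.inv z (- z ^- 2).
Proof.
move=> z0 e e0.
have nz : 0 < rnorm z by rewrite rnorm_gt0.
exists (Num.min (rnorm z / 2) (e * rnorm z ^+ 3 / 2)).
  by rewrite lt_min !divr_gt0// mulr_gt0// exprn_gt0.
move=> w; rewrite lt_min => /andP[w1 w2].
have zw : rnorm z / 2 <= rnorm (z + w).
  have := rnormB (z + w) w; rewrite addrK => h; lra.
have zw0 : z + w != 0 by rewrite -rnorm_gt0 (lt_le_trans _ zw)// divr_gt0.
have -> : (z + w)^-1 - z^-1 - w * (- z ^- 2) = w * w / (z ^+ 2 * (z + w)).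
  by field; rewrite z0 zw0.
rewrite !cnormM cnormV cnormM cnormX mulrAC ler_wpM2r ?rnorm_ge0//.
have h : 0 < rnorm z ^+ 2 * rnorm (z + w) by rewrite mulr_gt0 ?exprn_gt0// rnorm_gt0.
rewrite ler_pdivrMr//; apply/ltW/(lt_le_trans w2).
have -> : e * rnorm z ^+ 3 / 2 = e * (rnorm z ^+ 2 * (rnorm z / 2)) by field.
by rewrite ler_pM2l// ler_pM2l ?exprn_gt0.
Qed.

Lemma cdiff_negX n (z : R[i]) : z != 0 ->
  cdiff (fun y => y ^- n) z (- n%:R * z ^- n.+1).
Proof.
move=> z0; elim: n => [|n IH].
  have -> : (fun y : R[i] => y ^- 0) = fun=> 1.
    by apply/funext => y; rewrite expr0 invr1.
  by rewrite oppr0 mul0r; exact: cdiff_cst.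
have -> : (fun y : R[i] => y ^- n.+1) = fun y => y ^- n * y^-1.
  by apply/funext => y; rewrite exprSr invfM.
apply: cdiff_eq (cdiffM IH (cdiffV z0)).
by rewrite -(natr1 n) !exprS; field; rewrite z0 expf_neq0.
Qed.

Lemma cdiff_cont H z d (u : R -> R[i]) x : cdiff H z d -> u x = z ->
  {for x, continuous u} -> {for x, continuous (H \o u)}.
Proof.
move=> dH uz cu; apply/ccontP => e e0.
have [k k0 hk] := cdiff_lip dH.
set L := 1 + rnorm d in hk; have L0 : 0 < L by rewrite ltr_wpDr// rnorm_ge0.
have [|k' k'0 hk'] := (ccontP _ _).1 cu (Num.min (k / 2) (e / L)).
  by rewrite lt_min !divr_gt0.
exists k' => // h /hk'; rewrite le_min => /andP[h1 h2].
have := hk (u (x + h) - u x); rewrite -uz subrKC /= => h3.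
rewrite (le_trans (h3 _))//.
  by rewrite (le_lt_trans h1)// ltr_pdivrMr// ltr_pMr// ltr1n.
by rewrite mulrC -ler_pdivlMr.
Qed.

Definition cis (x : R) : R[i] := cos x +i* sin x.

Lemma cnorm_cis x : rnorm (cis x) = 1.
Proof. by rewrite /rnorm normc_def/= cos2Dsin2 sqrtr1. Qed.

Lemma cis0 : cis 0 = 1.
Proof. by rewrite /cis cos0 sin0. Qed.

Lemma cis2pi : cis (pi *+ 2) = 1.
Proof. by rewrite /cis cos2pi sin2pi. Qed.

Lemma cder_cis x : cder cis x ('i * cis x).
Proof.
move=> e e0; have e20 : 0 < e / 2 by rewrite divr_gt0.
have [k1 k10 h1] := (is_deriveP _ _ _).1 (is_derive_cos x) _ e20.
have [k2 k20 h2] := (is_deriveP _ _ _).1 (is_derive_sin x) _ e20.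
exists (Num.min k1 k2); first by rewrite lt_min k10.
move=> h; rewrite lt_min => /andP[hk1 hk2].
have -> : cis (x + h) - cis x - h%:C * ('i * cis x) =
    (cos (x + h) - cos x - h * - sin x) +i* (sin (x + h) - sin x - h * cos x).
  by rewrite /cis; simpc; congr (_ +i* _); ring.
rewrite (le_trans (cnorm_le_ReIm _))//=.
have -> : e * `|h| = e / 2 * `|h| + e / 2 * `|h| by field.
by rewrite lerD ?h1 ?h2.
Qed.

Lemma continuous_cis : continuous cis.
Proof.
move=> x; apply/ccontP => e e0; have [k k0 hk] := cder_lip (cder_cis x).
rewrite cnormM cnormi cnorm_cis mulr1 in hk.
exists (Num.min k (e / 2)); first by rewrite lt_min k0 divr_gt0.
move=> h; rewrite lt_min => /andP[/hk h1 h2].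
by rewrite (le_trans h1)// mulrC -ler_pdivlMr// ltW.
Qed.

End complex_integral.

(** * Goursat's subdivision argument *)
Section goursat.
Context (R : realType).

Lemma geometric_small (c q e : R) : 0 <= q < 1 -> 0 < e ->
  exists N, forall n, (N <= n)%N -> `|c * q ^+ n| <= e.
Proof.
move=> /andP[q0 q1] e0.
have : (fun n => c * q ^+ n) @ \oo --> c * 0.
  by apply: cvgMr; apply: cvg_expr; rewrite ger0_norm.
move=> /cvgrPdist_le/(_ e e0)[N _ hN]; exists N => n /hN.
by rewrite mulr0 sub0r normrN.
Qed.

(** A function of rectangles, additive under both kinds of cuts, vanishes if at
    each point the rectangles of sides at most d around it have value o(d^2).
    When a rectangle is quartered, some quarter keeps at least a quarter of the
    modulus. If the modulus is c > 0 to start with, it is at least c / 4^n on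
    the n-th of the nested quarters; but it is also o(1 / 4^n), by the
    hypothesis at the point to which they shrink. *)
Lemma goursat (G : R -> R -> R -> R -> R[i]) (a1 b1 a2 b2 : R) :
  a1 <= b1 -> a2 <= b2 ->
  (forall s1 s2 s3 t1 t2, G s1 s3 t1 t2 = G s1 s2 t1 t2 + G s2 s3 t1 t2) ->
  (forall s1 s2 t1 t2 t3, G s1 s2 t1 t3 = G s1 s2 t1 t2 + G s1 s2 t2 t3) ->
  (forall s t (e : R), a1 <= s <= b1 -> a2 <= t <= b2 -> 0 < e ->
    exists2 k : R, 0 < k & forall d s1 s2 t1 t2, d < k ->
      a1 <= s1 <= s -> s <= s2 <= b1 -> a2 <= t1 <= t -> t <= t2 <= b2 ->
      s2 - s1 <= d -> t2 - t1 <= d -> rnorm (G s1 s2 t1 t2) <= e * d ^+ 2) ->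
  G a1 b1 a2 b2 = 0.
Proof.
move=> ab1 ab2 G1 G2 Gloc.
apply/rnorm0_eq0/eqP; rewrite eq_le rnorm_ge0 andbT leNgt; apply/negP.
set c := rnorm _ => c0.
pose w1 n : R := (b1 - a1) / 2 ^+ n; pose w2 n : R := (b2 - a2) / 2 ^+ n.
have w1_ge0 n : 0 <= w1 n by rewrite divr_ge0 ?subr_ge0// exprn_ge0.
have w2_ge0 n : 0 <= w2 n by rewrite divr_ge0 ?subr_ge0// exprn_ge0.
have w1S n : w1 n = w1 n.+1 + w1 n.+1.
  by rewrite /w1 exprS; field; rewrite expf_neq0.
have w2S n : w2 n = w2 n.+1 + w2 n.+1.
  by rewrite /w2 exprS; field; rewrite expf_neq0.
pose g n (x : R * R) := rnorm (G x.1 (x.1 + w1 n) x.2 (x.2 + w2 n)).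
have step (np : nat * (R * R)) : exists q : R * R,
   [/\ np.2.1 <= q.1 <= np.2.1 + w1 np.1.+1,
       np.2.2 <= q.2 <= np.2.2 + w2 np.1.+1 &
       g np.1 np.2 <= 4 * g np.1.+1 q].
  case: np => n [s t] /=; set u := w1 n.+1; set v := w2 n.+1.
  have u0 : 0 <= u by exact: w1_ge0.
  have v0 : 0 <= v by exact: w2_ge0.
  (* otherwise each of the four quarters has less than a quarter of the modulus *)
  apply: contrapT => H.
  have H' (q : R * R) : s <= q.1 <= s + u -> t <= q.2 <= t + v ->
      4 * g n.+1 q < g n (s, t).
    by move=> h1 h2; rewrite ltNge; apply/negP => h3; apply: H; exists q.
  have := H' (s, t); have := H' (s + u, t).
  have := H' (s, t + v); have := H' (s + u, t + v).
  rewrite /= !lexx !lerDl u0 v0 /=.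
  move=> /(_ isT isT) e1 /(_ isT isT) e2 /(_ isT isT) e3 /(_ isT isT) e4.
  have : g n (s, t) <= g n.+1 (s, t) + g n.+1 (s + u, t) +
                      (g n.+1 (s, t + v) + g n.+1 (s + u, t + v)).
    rewrite /g/= -/u -/v (w1S n) (w2S n) -/u -/v [s + (u + u)]addrA [t + (v + v)]addrA.
    rewrite (G1 s (s + u)) (G2 s (s + u) t (t + v)) (G2 (s + u) _ t (t + v)).
    by rewrite [leRHS]addrACA (le_trans (rnormD _ _))// lerD ?rnormD.
  by move: e1 e2 e3 e4; lra.
have [F hF] := choice step.
(* the lower left corners of the selected rectangles *)
pose f := fix f n := if n is m.+1 then F (m, f m) else (a1, a2).
have f1 n : (f n).1 <= (f n.+1).1 <= (f n).1 + w1 n.+1 by have [] := hF (n, f n).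
have f2 n : (f n).2 <= (f n.+1).2 <= (f n).2 + w2 n.+1 by have [] := hF (n, f n).
have fg n : c <= 4 ^+ n * g n (f n).
  elim: n => [|n IH]; first by rewrite expr0 mul1r /g /w1 /w2 /= !divr1 !subrKC.
  rewrite (le_trans IH)// exprSr -mulrA ler_wpM2l ?exprn_ge0//.
  by have [] := hF (n, f n).
(* nested intervals, used once for each coordinate *)
have nest (l w : nat -> R) (b : R) : (forall n, 0 <= w n) -> (forall n, w n = w n.+1 + w n.+1) ->
    (forall n, l n <= l n.+1 <= l n + w n.+1) ->
    l 0%N + w 0%N <= b ->
    exists x, forall n, [/\ l 0%N <= l n <= x, x <= l n + w n & l n + w n <= b].
  move=> w0 wS lw lb.
  have mono n m : (n <= m)%N -> l n <= l m /\ l m + w m <= l n + w n.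
    elim: m => [|m IH]; first by rewrite leqn0 => /eqP ->.
    rewrite leq_eqVlt => /predU1P[->//|/IH[i1 i2]].
    by have := lw m; have := wS m; move: i1 i2; lra.
  have all n m : l n <= l m + w m.
    have := mono n (maxn n m) (leq_maxl _ _).
    have := mono m (maxn n m) (leq_maxr _ _).
    by have := w0 (maxn n m); lra.
  exists (sup (range l)) => n.
  have hs : has_sup (range l).
    by split; [exists (l n), n|exists (l n + w n) => _ [m _ <-]].
  split.
  - by rewrite (proj1 (mono 0%N n (leq0n n)))/=; apply: ub_le_sup; [case: hs|exists n].
  - by apply: ge_sup; [case: hs|move=> _ [m _ <-]].
  - by rewrite (le_trans (proj2 (mono 0%N n (leq0n n)))).
have [|s hs] := nest (fun n => (f n).1) w1 b1 w1_ge0 w1S f1.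
  by rewrite /w1 /= divr1 subrKC.
have [|t ht] := nest (fun n => (f n).2) w2 b2 w2_ge0 w2S f2.
  by rewrite /w2 /= divr1 subrKC.
(* both sides of the N-th rectangle are at most L / 2 ^ N; the constant below
   makes its value at most half of what the selection guarantees *)
pose L := (b1 - a1) + (b2 - a2) + 1.
have L0 : 0 < L by rewrite ltr_wpDl// addr_ge0// subr_ge0.
have [|||k k0 hk] := Gloc s t (c / (2 * L ^+ 2)).
- by have [/andP[h0 h1] h2 h3] := hs 0%N; move: h0 h1 h2 h3; rewrite /=; lra.
- by have [/andP[h0 h1] h2 h3] := ht 0%N; move: h0 h1 h2 h3; rewrite /=; lra.
- by rewrite divr_gt0// mulr_gt0// exprn_gt0.
have [||N hN] := @geometric_small L 2^-1 (k / 2).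
- by rewrite invr_ge0 invf_lt1// ltr1n ler0n.
- by rewrite divr_gt0.
have := hN N (leqnn _); rewrite exprVn ger0_norm; last first.
  by rewrite mulr_ge0 ?ltW// invr_gt0 exprn_gt0.
move=> dk; have [h0 h1 h2] := hs N; have [i0 i1 i2] := ht N.
have := hk (L / 2 ^+ N) (f N).1 ((f N).1 + w1 N) (f N).2 ((f N).2 + w2 N).
have p2 : 0 < (2 : R) ^+ N by rewrite exprn_gt0.
have w1L : w1 N <= L / 2 ^+ N.
  by rewrite ler_pM2r ?invr_gt0// /L; move: ab2; lra.
have w2L : w2 N <= L / 2 ^+ N.
  by rewrite ler_pM2r ?invr_gt0// /L; move: ab1; lra.
rewrite h0 i0 h1 h2 i1 i2 !(addrC _ (w1 N)) !(addrC _ (w2 N)) !addrK.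
move=> /(_ _ isT isT isT isT w1L w2L) H.
have {}H : g N (f N) <= c / (2 * L ^+ 2) * (L / 2 ^+ N) ^+ 2.
  by rewrite /g !(addrC _ (w1 N)) !(addrC _ (w2 N)); apply: H; move: dk; lra.
have E : 4 ^+ N * (c / (2 * L ^+ 2) * (L / 2 ^+ N) ^+ 2) = c / 2.
  have -> : (4 : R) ^+ N = 2 ^+ N * 2 ^+ N by rewrite -exprMn; congr (_ ^+ _); lra.
  by field; rewrite !gt_eqF.
have := le_trans (fg N) (ler_wpM2l (exprn_ge0 N (ler0n R 4)) H).
by rewrite E; move: c0; lra.
Qed.

End goursat.

(** * Cauchy's formula on a circle *)
Section cauchy.
Context (R : realType) (rho : R) (rho0 : 0 < rho).
Local Notation C := R[i].

Definition circ_def (x : R) : C := rho%:C * cis x.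
Definition circ := locked circ_def.

Lemma circE x : circ x = rho%:C * cis x.
Proof. by rewrite /circ -lock. Qed.

Lemma cnorm_circ x : rnorm (circ x) = rho.
Proof. by rewrite circE cnormM cnorm_cis mulr1 cnormR ger0_norm ?ltW. Qed.

Lemma circ_neq0 x : circ x != 0.
Proof. by rewrite -rnorm_gt0 cnorm_circ. Qed.

Lemma circ2pi : circ (pi *+ 2) = circ 0.
Proof. by rewrite !circE cis2pi cis0. Qed.

Lemma cder_circ x : cder circ x ('i * circ x).
Proof.
have -> : circ = circ_def by rewrite /circ -lock.
have := cder_comp (cdiffM (cdiff_cst rho%:C (cis x)) (cdiff_id (cis x))) (cder_cis x).
rewrite mul0r add0r mulr1.
by have -> : 'i * circ_def x = 'i * cis x * rho%:C by rewrite /circ_def; ring.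
Qed.

Lemma continuous_circ : continuous circ.
Proof.
have -> : circ = circ_def by rewrite /circ -lock.
by move=> x; apply: cvgMr; exact: continuous_cis.
Qed.

Lemma circ_lip x y : 0 <= x -> 0 <= y -> rnorm (circ y - circ x) <= 2 * rho * `|y - x|.
Proof.
have cc : continuous (fun x => 'i * circ x : C).
  by move=> z; apply: cvgMr; exact: continuous_circ.
wlog xy : x y / x <= y => [H x0 y0|x0 y0].
  have [/H|/ltW/H] := leP x y; first exact.
  by rewrite rnormBC distrC; apply.
rewrite ger0_norm ?subr_ge0//.
rewrite -(cint_ftc cc x0 xy (fun z _ => cder_circ z)).
by apply: cint_le => // z _; rewrite cnormM cnormi cnorm_circ mul1r.
Qed.

Definition hol_disc (h : C -> C) := forall z, rnorm z <= rho -> exists d, cdiff h z d.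

Section fixed_point.
Variables (a : C) (a1 : rnorm a < rho).

Lemma circB_neq0 x : circ x - a != 0.
Proof.
have := rnormD (circ x - a) a; rewrite subrK cnorm_circ -rnorm_gt0.
by move: a1; lra.
Qed.

(** Up to the factor i, the pull-back of dz / (z - a) along the circle. *)
Definition cauchy_ker_def (x : R) : C := circ x / (circ x - a).
Definition cauchy_ker := locked cauchy_ker_def.

Lemma cauchy_kerE x : cauchy_ker x = circ x / (circ x - a).
Proof. by rewrite /cauchy_ker -lock. Qed.

Lemma continuous_cauchy_ker : continuous cauchy_ker.
Proof.
have -> : cauchy_ker = cauchy_ker_def by rewrite /cauchy_ker -lock.
move=> x; apply: cvgM; first exact: continuous_circ.
apply: cvgV; first exact: circB_neq0.
by apply: cvgB; [exact: continuous_circ|exact: cvg_cst].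
Qed.

Lemma cnorm_cauchy_ker x : rnorm (cauchy_ker x) <= rho / (rho - rnorm a).
Proof.
rewrite cauchy_kerE cnormM cnormV cnorm_circ ler_pM2l//.
rewrite lef_pV2 ?posrE ?subr_gt0// ?rnorm_gt0 ?circB_neq0//.
by rewrite -(cnorm_circ x) lerBlDr -[X in rnorm X <= _](subrK a) rnormD.
Qed.

Section boundary_homotopy.
Variables (t0 : R) (t00 : 0 < t0) (t01 : t0 <= 1).

(** Cutting the radial parameter off makes the coefficients below continuous on
    the whole line, as the integral requires, and keeps them away from s = 0,
    where the radial one is singular. *)
Definition clamp (s : R) := Num.max t0 (Num.min s 1).

Lemma clampP s : t0 <= clamp s <= 1.
Proof. by rewrite /clamp le_max lexx/= ge_max t01 ge_min lexx orbT. Qed.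

Lemma clamp_gt0 s : 0 < clamp s.
Proof. by have /andP[h _] := clampP s; exact: lt_le_trans h. Qed.

Lemma clamp_id s : t0 <= s <= 1 -> clamp s = s.
Proof. by move=> /andP[h1 h2]; rewrite /clamp min_l// max_r. Qed.

Lemma continuous_clamp : continuous clamp.
Proof.
move=> s.
have h : {for s, continuous ((fun=> t0) \max ((fun x : R => x) \min (fun=> 1)) : R -> R^o)}.
  apply: continuous_max; first exact: cvg_cst.
  by apply: continuous_min; [exact: cvg_id|exact: cvg_cst].
exact: h.
Qed.

(** The segments from a to the circle: a homotopy from a small circle around a
    to the full one. *)
Definition cone (s x : R) : C := a + (clamp s)%:C * (circ x - a).

Lemma cnorm_cone s x : rnorm (cone s x) <= rho.
Proof.
have /andP[h1 h2] := clampP s.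
have -> : cone s x = (1 - clamp s)%:C * a + (clamp s)%:C * circ x.
  by rewrite /cone rmorphB rmorph1; ring.
rewrite (le_trans (rnormD _ _))// !cnormM !cnormR cnorm_circ.
rewrite !ger0_norm ?subr_ge0//; last exact/ltW/clamp_gt0.
have : 0 <= (1 - clamp s) * (rho - rnorm a) by rewrite mulr_ge0// subr_ge0// ltW.
lra.
Qed.

Lemma continuous_cone_l x : continuous (fun s => cone s x).
Proof.
move=> s; apply: cvgD; first exact: cvg_cst.
by apply: cvgMl; exact: (ccont_real continuous_clamp).
Qed.

Lemma continuous_cone_r s : continuous (cone s).
Proof.
move=> x; apply: cvgD; first exact: cvg_cst.
by apply: cvgMr; apply: cvgB; [exact: continuous_circ|exact: cvg_cst].
Qed.

(** For H of one complex variable, angular and radial are the coefficients of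
    dx and ds in the pull-back of the form H(z) dz / (z - a) under (s, x) |->
    cone s x, and boundary is its integral over the boundary of a rectangle. *)
Definition angular (H : C -> C) s x : C := H (cone s x) * ('i * cauchy_ker x).
Definition radial (H : C -> C) x s : C := H (cone s x) / (clamp s)%:C.

Definition boundary H s1 s2 t1 t2 :=
  cint (angular H s2) t1 t2 - cint (angular H s1) t1 t2
  - (cint (radial H t2) s1 s2 - cint (radial H t1) s1 s2).

Definition disc_cont (H : C -> C) := (forall s, continuous (fun x => H (cone s x))) /\
  (forall x, continuous (fun s => H (cone s x))).

Lemma hol_disc_cont h : hol_disc h -> disc_cont h.
Proof.
move=> hh; split=> [s x|x s]; have [d dh] := hh _ (cnorm_cone s x).
  exact: (@cdiff_cont _ h _ d (cone s) x dh erefl (@continuous_cone_r s x)).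
exact: (@cdiff_cont _ h _ d (fun s => cone s x) s dh erefl (@continuous_cone_l x s)).
Qed.

Lemma continuous_angular H s : disc_cont H -> continuous (angular H s).
Proof.
move=> [h _] x; apply: cvgM; first exact: h.
by apply: cvgMr; exact: continuous_cauchy_ker.
Qed.

Lemma continuous_invclamp : continuous (fun s => (clamp s)%:C^-1 : C).
Proof.
move=> s; apply: cvgV; last exact: (ccont_real continuous_clamp).
by rewrite -rnorm_gt0 cnormR normr_gt0 gt_eqF// clamp_gt0.
Qed.

Lemma continuous_radial H x : disc_cont H -> continuous (radial H x).
Proof.
by move=> [_ h] s; apply: cvgM; [exact: h|exact: continuous_invclamp].
Qed.

Lemma boundaryD H K s1 s2 t1 t2 : disc_cont H -> disc_cont K ->
  0 <= s1 -> s1 <= s2 -> 0 <= t1 -> t1 <= t2 ->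
  boundary (fun z => H z + K z) s1 s2 t1 t2 = boundary H s1 s2 t1 t2 + boundary K s1 s2 t1 t2.
Proof.
move=> cH cK s10 s12 t10 t12.
have bE s : angular (fun z => H z + K z) s = fun x => angular H s x + angular K s x.
  by apply/funext => x; rewrite /angular mulrDl.
have aE x : radial (fun z => H z + K z) x = fun s => radial H x s + radial K x s.
  by apply/funext => s; rewrite /radial mulrDl.
rewrite /boundary !bE !aE.
have cb := fun s => @continuous_angular H s cH; have cb' := fun s => @continuous_angular K s cK.
have ca := fun x => @continuous_radial H x cH; have ca' := fun x => @continuous_radial K x cK.
rewrite (cintD (cb s2) (cb' s2) t10 t12) (cintD (cb s1) (cb' s1) t10 t12).
rewrite (cintD (ca t2) (ca' t2) s10 s12) (cintD (ca t1) (ca' t1) s10 s12).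
by ring.
Qed.

(** One has (al + be z) dz / (z - a) = (al + be a) dz / (z - a) + be dz. The
    first form has a coefficient in dx independent of s and a coefficient in ds
    independent of x, and the second one is exact. *)
Lemma boundary_affine (al be : C) s1 s2 t1 t2 :
  t0 <= s1 -> s1 <= s2 -> s2 <= 1 -> 0 <= t1 -> t1 <= t2 ->
  boundary (fun z => al + be * z) s1 s2 t1 t2 = 0.
Proof.
move=> s1t s12 s21 t10 t12.
have s10 : 0 <= s1 by rewrite (le_trans _ s1t)// ltW.
have cik : continuous (fun x => 'i * cauchy_ker x : C).
  by move=> x; apply: cvgMr; exact: continuous_cauchy_ker.
have cic : continuous (fun x => 'i * circ x : C).
  by move=> x; apply: cvgMr; exact: continuous_circ.
have c1 : continuous (fun _ : R => 1 : C) by move=> ?; exact: cst_continuous.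
have bI s : cint (angular (fun z => al + be * z) s) t1 t2 =
   (al + be * a) * cint (fun x => 'i * cauchy_ker x) t1 t2 +
   be * (clamp s)%:C * (circ t2 - circ t1).
  rewrite -(cint_ftc cic t10 t12 (fun z _ => cder_circ z)).
  rewrite -(cintZ _ cik t10 t12) -(cintZ _ cic t10 t12).
  rewrite -(cintD _ _ t10 t12); last 2 first.
  - by move=> x; apply: cvgMr; exact: cik.
  - by move=> x; apply: cvgMr; exact: cic.
  congr cint; apply/funext => x; rewrite /angular /cone cauchy_kerE.
  by field; exact: circB_neq0.
have aI x : cint (radial (fun z => al + be * z) x) s1 s2 =
   (al + be * a) * cint (fun s => (clamp s)%:C^-1) s1 s2 +
   be * (circ x - a) * cint (fun=> 1) s1 s2.
  rewrite -(cintZ _ continuous_invclamp s10 s12) -(cintZ _ c1 s10 s12).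
  rewrite -(cintD _ _ s10 s12); last 2 first.
  - by move=> s; apply: cvgMr; exact: continuous_invclamp.
  - by move=> s; apply: cvgMr; exact: c1.
  congr cint; apply/funext => s; rewrite /radial /cone.
  by field; rewrite -rnorm_gt0 cnormR normr_gt0 gt_eqF// clamp_gt0.
have I1 : cint (fun=> 1) s1 s2 = s2%:C - s1%:C :> C.
  apply: (@cint_ftc R (fun=> 1) (fun s => s%:C) s1 s2 c1 s10 s12) => x _ e e0; exists 1 => // h _; rewrite rmorphD/= mulr1 [x%:C + _]addrC addrK subrr.
  by rewrite rnorm0 mulr_ge0// ltW.
have e1 : clamp s1 = s1 by apply: clamp_id; rewrite s1t (le_trans s12).
have e2 : clamp s2 = s2 by apply: clamp_id; rewrite s21 (le_trans s1t).
rewrite /boundary !bI !aI I1 e1 e2.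
by ring.
Qed.

Lemma cone_lip s s' x x' : 0 <= x -> 0 <= x' -> t0 <= s <= 1 -> t0 <= s' <= 1 ->
  rnorm (cone s' x' - cone s x) <= 2 * rho * `|x' - x| + 2 * rho * `|s' - s|.
Proof.
move=> x0 x'0 hs hs'; rewrite /cone !clamp_id//.
have -> : a + s'%:C * (circ x' - a) - (a + s%:C * (circ x - a)) =
  s'%:C * (circ x' - circ x) + (s' - s)%:C * (circ x - a).
  by rewrite rmorphB; ring.
have s'0 : 0 <= s' by case/andP: hs' => h _; rewrite (le_trans _ h)// ltW.
rewrite (le_trans (rnormD _ _))// lerD// cnormM cnormR.
  rewrite (le_trans _ (circ_lip x0 x'0))// ler_piMl ?rnorm_ge0//.
  by rewrite ger0_norm//; case/andP: hs'.
rewrite mulrC ler_wpM2r// (le_trans (rnormB _ _))// cnorm_circ.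
by move: a1; lra.
Qed.

Lemma boundary_le H s1 s2 t1 t2 M d : disc_cont H ->
  t0 <= s1 -> s1 <= s2 -> s2 <= 1 -> 0 <= t1 -> t1 <= t2 ->
  s2 - s1 <= d -> t2 - t1 <= d -> 0 <= M ->
  (forall s x, s1 <= s <= s2 -> t1 <= x <= t2 -> rnorm (H (cone s x)) <= M) ->
  rnorm (boundary H s1 s2 t1 t2) <= 4 * M * (rho / (rho - rnorm a) + t0^-1) * d.
Proof.
move=> cH s1t s12 s21 t10 t12 sd td M0 HM.
set q := rho / (rho - rnorm a).
have q0 : 0 <= q by rewrite divr_ge0 ?subr_ge0 ?ltW.
have s10 : 0 <= s1 by rewrite (le_trans _ s1t)// ltW.
have bB s : s1 <= s <= s2 -> rnorm (cint (angular H s) t1 t2) <= 2 * (M * q) * d.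
  move=> hs; apply: (@le_trans _ _ (2 * (M * q) * (t2 - t1))).
    apply: cint_le => //; first exact: continuous_angular.
    move=> x hx; rewrite /angular cnormM ler_pM ?rnorm_ge0 ?HM//.
    by rewrite cnormM cnormi mul1r cnorm_cauchy_ker.
  by rewrite ler_wpM2l// mulr_ge0// mulr_ge0.
have aB x : t1 <= x <= t2 -> rnorm (cint (radial H x) s1 s2) <= 2 * (M / t0) * d.
  move=> hx; apply: (@le_trans _ _ (2 * (M / t0) * (s2 - s1))).
    apply: cint_le => //; first exact: continuous_radial.
    move=> s hs; rewrite /radial cnormM ler_pM ?rnorm_ge0 ?HM//.
    rewrite cnormV cnormR ger0_norm; last exact/ltW/clamp_gt0.
    by rewrite lef_pV2 ?posrE ?clamp_gt0//; have /andP[] := clampP s.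
  by rewrite ler_wpM2l// mulr_ge0// divr_ge0// ltW.
rewrite /boundary.
have h1 := bB s2; have h2 := bB s1; have h3 := aB t2; have h4 := aB t1.
rewrite !lexx ?s12 ?t12 in h1 h2 h3 h4.
have := le_trans (rnormB _ _) (lerD (h1 isT) (h2 isT)).
have := le_trans (rnormB _ _) (lerD (h3 isT) (h4 isT)).
move=> {h1 h2 h3 h4} h1 h2.
apply: le_trans (rnormB _ _) _; apply: le_trans (lerD h2 h1) _.
by rewrite le_eqVlt; apply/orP; left; apply/eqP; ring.
Qed.

(** The value on a rectangle of size d is o(d^2): near a point, h is affine up
    to an error o(d), the affine part contributes nothing, and the edges have
    length at most d. So the integral over the full boundary vanishes. Its
    radial edges, at the angles 0 and 2 pi, coincide and cancel, and what is
    left are the two circles. *)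
Lemma boundary_homotopy h : hol_disc h -> cint (angular h 1) 0 (pi *+ 2) = cint (angular h t0) 0 (pi *+ 2).
Proof.
move=> hh; have ch := hol_disc_cont hh.
have p0 : (0 : R) <= pi *+ 2 by rewrite mulrn_wge0// pi_ge0.
have : boundary h t0 1 0 (pi *+ 2) = 0.
  apply: goursat => //.
  - by move=> s1 s2 s3 t1 t2; rewrite /boundary -!(cint_split _ s1 s2 s3); ring.
  - by move=> s1 s2 t1 t2 t3; rewrite /boundary -!(cint_split _ t1 t2 t3); ring.
  move=> s t e hs ht e0.
  have [be db] := hh _ (cnorm_cone s t).
  set q := rho / (rho - rnorm a) + t0^-1.
  have q0 : 0 < q by rewrite addr_gt0 ?divr_gt0 ?invr_gt0 ?subr_gt0.
  (* cone moves by at most 4 rho d on a rectangle of size d, and boundary_le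
     brings in another factor 4 q *)
  pose e' := e / (16 * rho * q).
  have e'0 : 0 < e' by rewrite divr_gt0// !mulr_gt0.
  have [k k0 hk] := db e' e'0.
  exists (k / (4 * rho)); first by rewrite divr_gt0// mulr_gt0.
  move=> d s1 s2 t1 t2 dk /andP[as1 s1s] /andP[ss2 s2b] /andP[at1 t1t] /andP[tt2 t2b] sd td.
  pose al := h (cone s t) - be * cone s t.
  pose rem z := h z - (al + be * z).
  have d0 : 0 <= d by move: s1s ss2 sd; lra.
  have cpoly : disc_cont (fun z => al + be * z).
    split=> [u x|x u]; (apply: cvgD; first exact: cvg_cst); apply: cvgMr;
      [exact: continuous_cone_r|exact: continuous_cone_l].
  have crem : disc_cont rem.
    case: ch cpoly => [c1 c2] [c3 c4].
    by split=> u x; apply: cvgB; (exact: c1 || exact: c2 || exact: c3 || exact: c4).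
  have s12 := le_trans s1s ss2; have t12 := le_trans t1t tt2.
  have s10 : 0 <= s1 by rewrite (le_trans _ as1)// ltW.
  have -> : h = fun z => rem z + (al + be * z).
    by apply/funext => z; rewrite /rem subrK.
  rewrite boundaryD// boundary_affine// addr0.
  have eE : e * d ^+ 2 = 4 * (e' * (4 * rho * d)) * q * d.
    by rewrite /e'; field; rewrite !gt_eqF.
  rewrite eE; apply: boundary_le => //; first by rewrite mulr_ge0 ?(ltW e'0)// mulr_ge0// mulr_ge0// ltW.
  move=> u x /andP[su us] /andP[tx xt].
  have L : rnorm (cone u x - cone s t) <= 4 * rho * d.
    have := @cone_lip s u t x.
    have hd1 : `|x - t| <= d by rewrite ler_norml; move: t1t tt2 tx xt td; lra.
    have hd2 : `|u - s| <= d by rewrite ler_norml; move: s1s ss2 su us sd; lra.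
    move=> /(_ (le_trans at1 t1t) (le_trans at1 tx) hs _) hl.
    apply: (le_trans (hl _)); first by apply/andP; split; [exact: le_trans su|exact: le_trans s2b].
    have -> : 4 * rho * d = 2 * rho * d + 2 * rho * d by ring.
    by rewrite lerD// ler_wpM2l// mulr_ge0// ltW.
  have := hk (cone u x - cone s t); rewrite subrKC => hk'.
  have -> : rem (cone u x) = h (cone u x) - h (cone s t) - (cone u x - cone s t) * be.
    by rewrite /rem /al; ring.
  rewrite (le_trans (hk' _))//.
    by rewrite (le_lt_trans L)// mulrC -ltr_pdivlMr// mulr_gt0.
  by rewrite ler_wpM2l// ltW.
rewrite /boundary.
have -> : radial h (pi *+ 2) = radial h 0 by apply/funext => s; rewrite /radial /cone circ2pi.
by rewrite subrr subr0 => /eqP; rewrite subr_eq0 => /eqP.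
Qed.

End boundary_homotopy.

(** Shrink the small circle to a: on it h differs from h a by O(t0), while the
    kernel is bounded. *)
Lemma cauchy_formula h : hol_disc h ->
  cint (fun x => h (circ x) * ('i * cauchy_ker x)) 0 (pi *+ 2) =
  h a * cint (fun x => 'i * cauchy_ker x) 0 (pi *+ 2).
Proof.
move=> hh.
have p0 : (0 : R) <= pi *+ 2 by rewrite mulrn_wge0// pi_ge0.
have cik : continuous (fun x => 'i * cauchy_ker x : C).
  by move=> x; apply: cvgMr; exact: continuous_cauchy_ker.
set q := rho / (rho - rnorm a).
have q0 : 0 < q by rewrite divr_gt0 ?subr_gt0.
set J := cint _ _ _.
have key (e : R) : 0 < e ->
    rnorm (J - h a * cint (fun x => 'i * cauchy_ker x) 0 (pi *+ 2)) <= e * (2 * q * (pi *+ 2)).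
  move=> e0; have [d dh] := hh a (ltW a1).
  have [k k0 hk] := cdiff_lip dh.
  set L := 1 + rnorm d in hk; have L0 : 0 < L by rewrite ltr_wpDr// rnorm_ge0.
  pose t0 := Num.min 1 (Num.min (k / (4 * rho)) (e / (L * (2 * rho)))).
  have t00 : 0 < t0 by rewrite !lt_min ltr01 !divr_gt0 ?mulr_gt0.
  have t01 : t0 <= 1 by rewrite ge_min lexx.
  have := boundary_homotopy t00 t01 hh.
  have -> : cint (angular t0 h 1) 0 (pi *+ 2) = J.
    congr cint; apply/funext => x; rewrite /angular /cone clamp_id ?lexx ?t01//.
    by rewrite mul1r subrKC.
  move=> ->; rewrite -(cintZ _ cik (lexx _) p0).
  have cB : continuous (angular t0 h t0) by apply: continuous_angular; exact: hol_disc_cont.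
  have cik' : continuous (fun x => h a * ('i * cauchy_ker x) : C).
    by move=> x; apply: cvgMr; exact: cik.
  rewrite -(cintB cB cik' (lexx _) p0).
  have -> : e * (2 * q * (pi *+ 2)) = 2 * (e * q) * (pi *+ 2 - 0) by rewrite subr0; ring.
  have cD : continuous (fun x => angular t0 h t0 x - h a * ('i * cauchy_ker x)).
    by move=> x; apply: cvgB; [exact: cB|exact: cik'].
  apply: (cint_le cD (lexx _) p0) => x _; rewrite /angular -mulrBl cnormM ler_pM ?rnorm_ge0//; last first.
    by rewrite cnormM cnormi mul1r cnorm_cauchy_ker.
  rewrite /cone clamp_id ?lexx ?t01//.
  have bnd : rnorm (t0%:C * (circ x - a)) <= t0 * (2 * rho).
    rewrite cnormM cnormR ger0_norm ?(ltW t00)// ler_pM2l//.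
    by rewrite (le_trans (rnormB _ _))// cnorm_circ; move: a1; lra.
  rewrite (le_trans (hk _ _))//.
    rewrite (le_lt_trans bnd)//.
    have : t0 <= k / (4 * rho) by rewrite /t0 !ge_min lexx orbT.
    rewrite ler_pdivlMr ?mulr_gt0// => h1.
    by rewrite (@le_lt_trans _ _ (k / 2))//; move: k0 h1; lra.
  rewrite (le_trans (ler_wpM2l (ltW L0) bnd))//.
  have : t0 <= e / (L * (2 * rho)) by rewrite /t0 !ge_min lexx !orbT.
  by rewrite ler_pdivlMr ?mulr_gt0// mulrCA.
apply/eqP; rewrite -subr_eq0; apply/eqP/rnorm0_eq0/eqP.
rewrite eq_le rnorm_ge0 andbT leNgt; apply/negP => h0.
set c := 2 * q * (pi *+ 2) in key.
have c0 : 0 < c.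
  have pi2 : (0 : R) < pi *+ 2 by rewrite pmulrn_lgt0// pi_gt0.
  by rewrite mulr_gt0// mulr_gt0.
have := key _ (divr_gt0 (divr_gt0 h0 (ltr0Sn R 1)) c0).
by rewrite divfK ?gt_eqF//; move: h0; lra.
Qed.

End fixed_point.

End cauchy.

(** * Taylor expansion in one variable *)
Section expansion.
Context (R : realType) (rho : R) (rho0 : 0 < rho).
Local Notation C := R[i].
Local Notation circ := (circ rho).
Local Notation p2 := (pi *+ 2 : R).

Let p20 : 0 < p2. Proof. by rewrite pmulrn_lgt0// pi_gt0. Qed.
Let p20' : 0 <= p2. Proof. exact: ltW. Qed.
Let p2C : p2%:C != 0 :> C.
Proof. by rewrite -rnorm_gt0 cnormR normr_gt0 gt_eqF. Qed.

Lemma continuous_circV k : continuous (fun x => circ x ^- k).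
Proof.
move=> x; apply: (@cdiff_cont _ (fun y => y ^- k) _ _ circ x (cdiff_negX k (circ_neq0 rho0 x)) erefl).
exact: continuous_circ.
Qed.

(** A multiple of the derivative of a periodic curve. *)
Lemma cint_circV k : cint (fun x => circ x ^- k.+1) 0 p2 = 0.
Proof.
have cc := @continuous_circV k.+1.
have E : cint (fun x => (- k.+1%:R * 'i) * circ x ^- k.+1) 0 p2 = 0.
  have cc' : continuous (fun x => (- k.+1%:R * 'i) * circ x ^- k.+1 : C).
    by move=> x; apply: cvgMr; exact: cc.
  rewrite (@cint_ftc _ _ (fun x => circ x ^- k.+1) 0 p2 cc' (lexx _) p20').
    by rewrite circ2pi subrr.
  move=> x _; have := cder_comp (cdiff_negX k.+1 (circ_neq0 rho0 x)) (cder_circ rho x).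
  have -> : 'i * circ x * (- k.+1%:R * circ x ^- k.+2) = (- k.+1%:R * 'i) * circ x ^- k.+1; last exact.
  by rewrite !exprS; field; rewrite circ_neq0// expf_neq0// circ_neq0.
rewrite (cintZ _ cc (lexx _) p20') in E.
move/eqP: E; rewrite mulf_eq0 mulf_eq0 oppr_eq0 pnatr_eq0/= => /orP[|/eqP//].
by rewrite -[_ == 0]negbK -rnorm_gt0 cnormi ltr01.
Qed.

Lemma cint1 : cint (fun x => circ x ^- 0) 0 p2 = p2%:C.
Proof.
rewrite (@cint_ftc _ _ (fun x => x%:C) 0 p2 (@continuous_circV 0) (lexx _) p20').
  by rewrite subr0.
move=> x _ e e0; exists 1 => // h _.
by rewrite expr0 invr1 rmorphD/= mulr1 [x%:C + _]addrC addrK subrr rnorm0 mulr_ge0// ltW.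
Qed.

(** The Fourier coefficients of u, which become Cauchy's integrals for the
    Taylor coefficients when u is the restriction of a function to the circle. *)
Definition moment (u : R -> C) k := cint (fun x => u x * circ x ^- k) 0 p2.

Lemma continuous_moment (u : R -> C) k : continuous u -> continuous (fun x => u x * circ x ^- k).
Proof. by move=> cu x; apply: cvgM; [exact: cu|exact: continuous_circV]. Qed.

Lemma moment_le (u : R -> C) k M : continuous u -> (forall x, rnorm (u x) <= M) ->
  rnorm (moment u k) <= 2 * (M / rho ^+ k) * p2.
Proof.
move=> cu uM; have := @cint_le R _ 0 p2 (M / rho ^+ k) (@continuous_moment u k cu) (lexx _) p20'.
rewrite subr0; apply=> x _.
by rewrite cnormM cnormV cnormX cnorm_circ// ler_wpM2r// invr_ge0 exprn_ge0// ltW.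
Qed.

Section fixed_point.
Variables (a : C) (a1 : rnorm a < rho).
Local Notation cauchy_ker := (cauchy_ker rho a).
Let q := rho / (rho - rnorm a).
Let q0 : 0 <= q. Proof. by rewrite divr_ge0 ?subr_ge0 ?ltW. Qed.

(** The geometric series in a / z with its exact remainder. *)
Lemma cauchy_ker_series K x : cauchy_ker x =
  \sum_(0 <= k < K) a ^+ k * circ x ^- k + a ^+ K * circ x ^- K * cauchy_ker x.
Proof.
elim: K => [|K IH].
  by rewrite big_geq// add0r !expr0 invr1 !mul1r.
rewrite big_nat_recr//= {1}IH -addrA; congr (_ + _).
rewrite !cauchy_kerE !exprS; field.
by rewrite circB_neq0// circ_neq0// expf_neq0// circ_neq0.
Qed.

Lemma cint_cauchy_ker_series (u : R -> C) K M : continuous u -> (forall x, rnorm (u x) <= M) ->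
  rnorm (cint (fun x => u x * cauchy_ker x) 0 p2 - \sum_(0 <= k < K) a ^+ k * moment u k)
    <= 2 * (M * (rnorm a / rho) ^+ K * q) * p2.
Proof.
move=> cu uM.
have cm := fun k => @continuous_moment u k cu.
pose F k x := a ^+ k * (u x * circ x ^- k).
have cF k : continuous (F k) by move=> x; apply: cvgMr; exact: cm.
have cr : continuous (fun x => F K x * cauchy_ker x).
  by move=> x; apply: cvgM; [exact: cF|exact: continuous_cauchy_ker].
have E : (fun x => u x * cauchy_ker x) = fun x => \sum_(0 <= k < K) F k x + F K x * cauchy_ker x.
  apply/funext => x; rewrite {1}(cauchy_ker_series K x) mulrDr mulr_sumr; congr (_ + _).
    by apply: eq_bigr => k _; rewrite mulrCA.
  by rewrite /F; ring.
have cS n : continuous (fun x => \sum_(0 <= k < n) F k x).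
  elim: n => [|n IH] x.
    rewrite (_ : (fun _ => _) = fun=> 0); first exact: cst_continuous.
    by apply/funext => y; rewrite big_geq.
  rewrite (_ : (fun _ => _) = fun y => \sum_(0 <= k < n) F k y + F n y).
    by apply: cvgD; [exact: IH|exact: cF].
  by apply/funext => y; rewrite big_nat_recr.
rewrite E (cintD (@cS K) cr (lexx _) p20') (cint_sum _ cF (lexx _) p20').
rewrite (eq_bigr (fun k => a ^+ k * moment u k)); last first.
  by move=> k _; rewrite /F (cintZ _ (@cm k) (lexx _) p20').
rewrite addrAC subrr add0r -[X in _ * X]subr0.
apply: (cint_le cr (lexx _) p20') => x _.
rewrite /F cnormM ler_pM ?rnorm_ge0//; last exact: cnorm_cauchy_ker.
rewrite cnormM cnormX cnormM cnormV cnormX cnorm_circ// expr_div_n mulrCA.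
by rewrite ler_wpM2r// mulr_ge0 ?invr_ge0 ?exprn_ge0 ?rnorm_ge0 ?ltW.
Qed.

(** The case u = 1 of the expansion above, whose only non-zero moment is the
    one of order 0. *)
Lemma cint_cauchy_ker : cint cauchy_ker 0 p2 = p2%:C.
Proof.
have bnd K : (0 < K)%N -> rnorm (cint cauchy_ker 0 p2 - p2%:C) <= 2 * (1 * (rnorm a / rho) ^+ K * q) * p2.
  move=> K0; have := @cint_cauchy_ker_series (fun=> 1) K 1 (@cst_continuous _ _ _) _.
  rewrite (_ : \sum_(0 <= k < K) _ = p2%:C).
    rewrite (_ : (fun x => _) = cauchy_ker); last by apply/funext => x; rewrite mul1r.
    by apply=> ?; rewrite cnorm1.
  case: K K0 => // K _; rewrite big_nat_recl// big1 ?addr0.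
    rewrite expr0 mul1r /moment -cint1; congr cint.
    by apply/funext => x; rewrite mul1r.
  move=> k _; rewrite /moment (_ : (fun x => _) = fun x => circ x ^- k.+1).
    by rewrite cint_circV mulr0.
  by apply/funext => x; rewrite mul1r.
apply/eqP; rewrite -subr_eq0; apply/eqP/rnorm0_eq0/eqP.
rewrite eq_le rnorm_ge0 andbT leNgt; apply/negP => h0.
have [||N hN] := @geometric_small R (2 * q * p2) (rnorm a / rho) (rnorm (cint cauchy_ker 0 p2 - p2%:C) / 2).
- by rewrite divr_ge0 ?rnorm_ge0 ?ltW//= ltr_pdivrMr// mul1r.
- by rewrite divr_gt0.
have := le_trans (ler_norm _) (hN N.+1 (leqnSn _)).
have := bnd N.+1 isT.
have -> : 2 * (1 * (rnorm a / rho) ^+ N.+1 * q) * p2 = 2 * q * p2 * (rnorm a / rho) ^+ N.+1 by ring.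
by move: h0; lra.
Qed.

End fixed_point.

Section holomorphic.
Variables (h : C -> C) (M : R).
Hypotheses (hh : hol_disc rho h) (hM : forall z, rnorm z <= rho -> rnorm (h z) <= M).

Definition cauchy_coef (g : C -> C) k : C := moment (fun x => g (circ x)) k / p2%:C.

Lemma hol_disc_circ g : hol_disc rho g -> continuous (fun x => g (circ x)).
Proof.
move=> hg x; have [d dg] : exists d, cdiff g (circ x) d by apply: hg; rewrite cnorm_circ.
exact: (@cdiff_cont _ g _ d circ x dg erefl (@continuous_circ R rho x)).
Qed.

Lemma cauchy_coef_le k : rnorm (cauchy_coef h k) <= 2 * M / rho ^+ k.
Proof.
rewrite /cauchy_coef cnormM cnormV cnormR ger0_norm// ler_pdivrMr// -[2 * M / _]mulrA.
by apply: moment_le => [|x]; [exact: hol_disc_circ|rewrite hM// cnorm_circ].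
Qed.

(** Valid for every a in the open disc: translations are studied up to the
    boundary of their domain, so no fixed fraction of the radius may be given
    away here. *)
Theorem cauchy_expansion a K : rnorm a < rho ->
  rnorm (h a - \sum_(0 <= k < K) cauchy_coef h k * a ^+ k) <=
  2 * M * (rnorm a / rho) ^+ K * (rho / (rho - rnorm a)).
Proof.
move=> a1; have cu := hol_disc_circ hh.
have ck := @continuous_cauchy_ker R rho rho0 a a1.
have cik : continuous (fun x => h (circ x) * cauchy_ker rho a x).
  by move=> x; apply: cvgM; [exact: cu|exact: ck].
have := cauchy_formula rho0 a1 hh.
rewrite (cintZ 'i ck (lexx _) p20') (cint_cauchy_ker a1).
have -> : (fun x => h (circ x) * ('i * cauchy_ker rho a x)) = fun x => 'i * (h (circ x) * cauchy_ker rho a x).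
  by apply/funext => x; rewrite mulrCA.
rewrite (cintZ 'i cik (lexx _) p20') mulrCA.
have i0 : 'i != 0 :> C by rewrite -rnorm_gt0 cnormi.
move=> /(mulfI i0) E.
have := @cint_cauchy_ker_series a a1 _ K M cu _; rewrite E => H.
rewrite -(ler_pM2r p20) -[X in _ * X](ger0_norm p20') -cnormR -cnormM.
rewrite mulrBl mulr_suml.
rewrite (eq_bigr (fun k => a ^+ k * moment (fun x => h (circ x)) k)); last first.
  by move=> k _; rewrite /cauchy_coef mulrAC divfK// mulrC.
rewrite (le_trans (H _))//; first by move=> x; rewrite hM// cnorm_circ.
by rewrite !mulrA.
Qed.

Lemma cauchy_coef0 : cauchy_coef h 0 = h 0.
Proof.
have := @cauchy_expansion 0 1; rewrite rnorm0 mul0r expr1 mulr0 mul0r => /(_ rho0).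
rewrite big_nat1 expr0 mulr1 => h0.
by apply/esym/eqP; rewrite -subr_eq0; apply/eqP/rnorm0_eq0/eqP; rewrite eq_le h0 rnorm_ge0.
Qed.

(** The expansion to second order and the definition of the derivative both
    approximate h t - h 0 with an error o(t) for t > 0 small. *)
Lemma cauchy_coef1 d : cdiff h 0 d -> cauchy_coef h 1 = d.
Proof.
move=> dh; apply/eqP; rewrite -subr_eq0; apply/eqP/rnorm0_eq0/eqP.
rewrite eq_le rnorm_ge0 andbT leNgt; apply/negP.
set c := rnorm _ => c0.
have [|k k0 hk] := dh (c / 4); first by rewrite divr_gt0.
have M0 : 0 <= M by rewrite (le_trans _ (hM (z := 0) _)) ?rnorm_ge0// rnorm0 ltW.
(* the last bound makes the remainder of the expansion, at most 4 M t ^ 2 / rho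
   ^ 2, no larger than c t / 4 *)
pose t := Num.min (k / 2) (Num.min (rho / 2) (c * rho ^+ 2 / (16 * (M + 1)))).
have t0 : 0 < t.
  by rewrite !lt_min !divr_gt0// ?mulr_gt0// ?exprn_gt0// ltr_wpDl.
have tk : t < k.
  have : t <= k / 2 by rewrite /t ge_min lexx.
  by move: k0; lra.
have tr : t <= rho / 2 by rewrite /t !ge_min lexx orbT.
have tc : t * (16 * (M + 1)) <= c * rho ^+ 2.
  rewrite -ler_pdivlMr; last by rewrite mulr_gt0// ltr_wpDl.
  by rewrite /t !ge_min lexx !orbT.
have tn : rnorm (t%:C : C) = t by rewrite cnormR ger0_norm// ltW.
have := hk t%:C; rewrite tn => /(_ tk); rewrite add0r => h1.
have := @cauchy_expansion t%:C 2; rewrite tn => /(_ _)h2.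
have {}h2 : rnorm (h t%:C - (h 0 + cauchy_coef h 1 * t%:C)) <= 2 * M * (t / rho) ^+ 2 * 2.
  rewrite big_nat_recr// big_nat1/= expr0 mulr1 expr1 cauchy_coef0 in h2.
  rewrite (le_trans (h2 _))//; first by move: tr rho0; lra.
  rewrite ler_wpM2l//.
    by rewrite mulr_ge0 ?exprn_ge0 ?divr_ge0 ?(ltW t0) ?(ltW rho0)// mulr_ge0.
  by rewrite ler_pdivrMr; move: tr rho0 t0; lra.
have : c * t <= c / 4 * t + 2 * M * (t / rho) ^+ 2 * 2.
  rewrite -{1}tn -cnormM.
  have -> : (cauchy_coef h 1 - d) * t%:C = (h t%:C - h 0 - t%:C * d) - (h t%:C - (h 0 + cauchy_coef h 1 * t%:C)).
    by ring.
  by rewrite (le_trans (rnormB _ _))// lerD.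
have -> : 2 * M * (t / rho) ^+ 2 * 2 = t * (t * (16 * M)) / rho ^+ 2 / 4.
  by field; rewrite gt_eqF.
have : t * (t * (16 * M)) / rho ^+ 2 <= t * c.
  rewrite ler_pdivrMr ?exprn_gt0// -mulrA ler_wpM2l ?(ltW t0)//.
  by rewrite (le_trans _ tc)// ler_wpM2l ?(ltW t0)//; move: M0; lra.
have : 0 < c * t by rewrite mulr_gt0.
by lra.
Qed.

End holomorphic.

(** Integration by parts: the derivative of z^-(k+1) h(z) along the circle
    integrates to 0. *)
Lemma cauchy_coef_deriv (h h' : C -> C) k :
  (forall z, rnorm z <= rho -> cdiff h z (h' z)) -> hol_disc rho h' ->
  cauchy_coef h' k = k.+1%:R * cauchy_coef h k.+1.
Proof.
move=> dh hh'.
have hh : hol_disc rho h by move=> z /dh; exists (h' z).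
have cu := hol_disc_circ hh; have cu' := hol_disc_circ hh'.
have c1 := @continuous_moment _ k cu'.
have c2 := @continuous_moment _ k.+1 cu.
have c3 : continuous (fun x => k.+1%:R * (h (circ x) * circ x ^- k.+1) : C).
  by move=> x; apply: cvgMr; exact: c2.
have c4 : continuous (fun x => h' (circ x) * circ x ^- k - k.+1%:R * (h (circ x) * circ x ^- k.+1) : C).
  by move=> x; apply: cvgB; [exact: c1|exact: c3].
have c5 : continuous (fun x => 'i * (h' (circ x) * circ x ^- k - k.+1%:R * (h (circ x) * circ x ^- k.+1)) : C).
  by move=> x; apply: cvgMr; exact: c4.
have : cint (fun x => 'i * (h' (circ x) * circ x ^- k - k.+1%:R * (h (circ x) * circ x ^- k.+1))) 0 p2 = 0.
  rewrite (@cint_ftc _ _ (fun x => h (circ x) * circ x ^- k.+1) 0 p2 c5 (lexx _) p20').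
    by rewrite circ2pi subrr.
  move=> x _; have xr : rnorm (circ x) <= rho by rewrite cnorm_circ.
  have := cder_comp (cdiffM (dh _ xr) (cdiff_negX k.+1 (circ_neq0 rho0 x))) (cder_circ rho x).
  set A := (X in cder _ _ X); set B := (X in _ -> cder _ _ X).
  have -> : A = B; last exact.
  by rewrite /A /B !exprS; field; rewrite circ_neq0// expf_neq0// circ_neq0.
have i0 : 'i != 0 :> C by rewrite -rnorm_gt0 cnormi.
rewrite (cintZ 'i c4 (lexx _) p20') (cintB c1 c3 (lexx _) p20') (cintZ _ c2 (lexx _) p20').
move=> /eqP; rewrite mulf_eq0 (negPf i0)/= subr_eq0 => /eqP E.
by rewrite /cauchy_coef /moment E mulrA.
Qed.

(** Each derivative lowers the order by one, down to the coefficient of order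
    0, the value at 0. In particular the coefficients, which are integrals over
    the circle of radius rho, do not depend on rho. *)
Lemma cauchy_coef_iter (hs : nat -> C -> C) :
  (forall k z, rnorm z <= rho -> cdiff (hs k) z (hs k.+1 z)) ->
  (forall k, exists M, forall z, rnorm z <= rho -> rnorm (hs k z) <= M) ->
  forall k, cauchy_coef (hs 0%N) k = hs k 0 / k`!%:R.
Proof.
move=> dh bh k.
have hh n : hol_disc rho (hs n) by move=> z /(dh n); exists (hs n.+1 z).
have H n : cauchy_coef (hs n) k = hs (n + k)%N 0 / k`!%:R.
  elim: k n => [|k IH] n.
    by have [M hM] := bh n; rewrite (cauchy_coef0 (hh n) hM) addn0 fact0 divr1.
  have := @cauchy_coef_deriv (hs n) (hs n.+1) k (dh n) (hh n.+1).
  rewrite IH addSnnS => E.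
  have k0 : k.+1%:R != 0 :> C by rewrite pnatr_eq0.
  have f0 : k`!%:R != 0 :> C by rewrite pnatr_eq0 -lt0n fact_gt0.
  apply: (mulfI k0); rewrite -E factS natrM.
  by rewrite invfM mulrCA mulVKf.
exact: H.
Qed.

End expansion.

(** * Holomorphic functions on a normed space *)
Section banach.
Context (R : realType) (V : normedModType R[i]).
Local Notation C := R[i].
Implicit Types (f : V -> C) (x y h w : V).

Lemma diff_eps f x : differentiable f x -> forall e : R, 0 < e -> exists2 k : R, 0 < k &
  forall h, rnorm h < k -> rnorm (f (x + h) - f x - 'd f x h) <= e * rnorm h.
Proof.
move=> /diff_locallyP[_ /eqaddoP H] e e0.
have e0' : 0 < e%:C by rewrite ltcR.
have /nbhs_ballP[k /= k0 hk] := H _ e0'.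
have kE : k = (complex.Re k)%:C by rewrite RRe_real// gtr0_real.
exists (complex.Re k) => [|h]; first by rewrite -ltcR -kE.
rewrite -ltcR -kE rnormE => hh.
have := hk h; rewrite -ball_normE/= sub0r normrN => /(_ hh).
by rewrite !fctE/= -!rnormE -rmorphM/= lecR opprD addrA [h + x]addrC.
Qed.

(** The bound on L serves to make it continuous, as a differential has to be. *)
Lemma eps_diff f x (L : V -> C) (c : R) : linear L -> (forall h, rnorm (L h) <= c * rnorm h) ->
  (forall e : R, 0 < e -> exists2 k : R, 0 < k &
    forall h, rnorm h < k -> rnorm (f (x + h) - f x - L h) <= e * rnorm h) ->
  differentiable f x /\ forall h, 'd f x h = L h.
Proof.
move=> linL cL H.
pose Lm := GRing.isLinear.Build _ _ _ _ L linL.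
pose LL : {linear V -> C} := HB.pack L Lm.
have cLL : continuous LL.
  apply: bounded_linear_continuous; apply/linear_boundedP.
  near=> r => y; rewrite -(rnormE (LL y)) -(rnormE y).
  have r0 : `|c|%:C <= r by near: r; apply: nbhs_pinfty_ge; rewrite realE lecR normr_ge0.
  rewrite (le_trans (y := (c * rnorm y)%:C)) ?lecR ?cL//.
  rewrite rmorphM/= ler_wpM2r ?lecR ?rnorm_ge0//.
  by rewrite (le_trans _ r0)// lecR ler_norm.
have E : f \o shift x = cst (f x) + LL +o_ 0 id.
  apply/eqaddoP => e e0.
  have eE : e = (complex.Re e)%:C by rewrite RRe_real// gtr0_real.
  have [|k k0 hk] := H (complex.Re e); first by rewrite -ltcR -eE.
  apply/nbhs_ballP; exists k%:C => /=; first by rewrite ltcR.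
  move=> h; rewrite -ball_normE/= sub0r normrN -rnormE ltcR => /hk.
  by rewrite !fctE/= -!rnormE eE -rmorphM/= lecR opprD addrA [h + x]addrC.
have dE := diff_unique cLL E.
split; last by move=> h; rewrite dE.
by apply/diff_locallyP; rewrite dE.
Unshelve. all: by end_near. Qed.

Lemma cdiff_line f y w z : differentiable f (y + z *: w) ->
  cdiff (fun u => f (y + u *: w)) z ('d f (y + z *: w) w).
Proof.
move=> df e e0; set W := 1 + rnorm w.
have W0 : 0 < W by rewrite ltr_wpDr// rnorm_ge0.
have [|k k0 hk] := diff_eps df (e := e / W); first by rewrite divr_gt0.
exists (k / W); first by rewrite divr_gt0.
move=> u; rewrite ltr_pdivlMr// => uk.
have uW : rnorm (u *: w) <= rnorm u * W.
  by rewrite rnormZ ler_wpM2l ?rnorm_ge0// lerDr.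
have := hk (u *: w) (le_lt_trans uW uk).
rewrite linearZ/= -[u *: 'd f (y + z *: w) w]/(u * 'd f (y + z *: w) w).
rewrite -[y + z *: w + u *: w]addrA -scalerDl => h; rewrite (le_trans h)//.
rewrite (le_trans (ler_wpM2l _ uW))//; first by rewrite divr_ge0 ?ltW.
by rewrite mulrCA divfK ?gt_eqF// mulrC.
Qed.

Section cauchy_ball.
Variables (f : V -> C) (x : V) (d M : R).
Hypotheses (d0 : 0 < d) (df : forall y, rnorm (y - x) < d -> differentiable f y)
  (fM : forall y, rnorm (y - x) < d -> rnorm (f y) <= M).

Let line h (rho : R) : rho * rnorm h < d ->
  (forall z : C, rnorm z <= rho -> rnorm (x + z *: h - x) < d).
Proof.
move=> hd z zr; rewrite addrAC subrr add0r rnormZ (le_lt_trans _ hd)//.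
by rewrite ler_wpM2r ?rnorm_ge0.
Qed.

Let line_hol h (rho : R) : rho * rnorm h < d -> hol_disc rho (fun u => f (x + u *: h)).
Proof.
by move=> hd z zr; eexists; apply: cdiff_line; apply: df; exact: line zr.
Qed.

Let M0 : 0 <= M.
Proof. by rewrite (le_trans _ (fM (y := x) _)) ?rnorm_ge0// subrr rnorm0. Qed.

(** Restrict f to the line through x in the direction h, on a disc of radius d
    / (2 ||h||); the differential is the first Taylor coefficient. *)
Lemma cauchy_diff_le h : rnorm ('d f x h) <= 4 * M / d * rnorm h.
Proof.
have [->|h0] := eqVneq h 0.
  by rewrite linear0 !rnorm0 mulr0.
have hn : 0 < rnorm h by rewrite rnorm_gt0.
pose rho := d / (2 * rnorm h).
have rho0 : 0 < rho by rewrite divr_gt0 ?mulr_gt0.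
have hd : rho * rnorm h < d.
  have -> : rho * rnorm h = d / 2 by rewrite /rho; field; rewrite gt_eqF.
  by move: d0; lra.
have hb (z : C) : rnorm z <= rho -> rnorm (f (x + z *: h)) <= M.
  by move=> zr; apply: fM; exact: line zr.
have dx : differentiable f (x + 0 *: h).
  by rewrite scale0r addr0; apply: df; rewrite subrr rnorm0.
have := cauchy_coef1 rho0 (line_hol hd) hb (cdiff_line dx).
rewrite scale0r addr0 => <-.
rewrite (le_trans (cauchy_coef_le rho0 (line_hol hd) hb 1))// expr1.
by rewrite le_eqVlt; apply/orP; left; apply/eqP; rewrite /rho; field; rewrite !gt_eqF.
Qed.

(** That the constants depend on f only through M is what makes limits of such
    functions differentiable. *)
Lemma cauchy_remainder h : rnorm h <= d / 4 ->
  rnorm (f (x + h) - f x - 'd f x h) <= 16 * M / d ^+ 2 * rnorm h ^+ 2 /\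
  rnorm (f (x + h) - f x) <= 8 * M / d * rnorm h.
Proof.
move=> hd4; have [->|h0] := eqVneq h 0.
  by rewrite addr0 linear0 !subrr !rnorm0 expr0n !mulr0.
have hn : 0 < rnorm h by rewrite rnorm_gt0.
pose rho := d / (2 * rnorm h).
have rho0 : 0 < rho by rewrite divr_gt0 ?mulr_gt0.
have hd : rho * rnorm h < d.
  have -> : rho * rnorm h = d / 2 by rewrite /rho; field; rewrite gt_eqF.
  by move: d0; lra.
have hb (z : C) : rnorm z <= rho -> rnorm (f (x + z *: h)) <= M.
  by move=> zr; apply: fM; exact: line zr.
have dx : differentiable f (x + 0 *: h).
  by rewrite scale0r addr0; apply: df; rewrite subrr rnorm0.
have rho2 : 2 <= rho.
  by rewrite /rho ler_pdivlMr ?mulr_gt0//; move: hd4; lra.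
have q2 : rho / (rho - 1) <= 2.
  by rewrite ler_pdivrMr; move: rho2; lra.
have H K : 2 * M * (1 / rho) ^+ K * (rho / (rho - 1)) <= 4 * M * rho^-1 ^+ K.
  rewrite div1r -[leRHS](_ : 2 * M * rho^-1 ^+ K * 2 = _); last by ring.
  by rewrite ler_wpM2l// mulr_ge0 ?mulr_ge0// exprn_ge0// invr_ge0 ltW.
have a1 : rnorm (1 : C) < rho by rewrite cnorm1; move: rho2; lra.
have e1 := cauchy_expansion rho0 (line_hol hd) hb 1 a1.
have e2 := cauchy_expansion rho0 (line_hol hd) hb 2 a1.
rewrite cnorm1 scale1r in e1 e2.
have c1 := cauchy_coef1 rho0 (line_hol hd) hb (cdiff_line dx).
have c0 := cauchy_coef0 rho0 (line_hol hd) hb.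
rewrite !scale0r !addr0 in c0 c1.
rewrite big_nat1 c0 expr0 mulr1 in e1.
rewrite big_nat_recr//= big_nat1 c0 c1 expr0 expr1 !mulr1 opprD addrA in e2.
split.
  rewrite (le_trans e2)// (le_trans (H 2%N))//.
  by rewrite le_eqVlt; apply/orP; left; apply/eqP; rewrite /rho; field; rewrite !gt_eqF.
rewrite (le_trans e1)// (le_trans (H 1%N))//.
by rewrite le_eqVlt; apply/orP; left; apply/eqP; rewrite /rho; field; rewrite !gt_eqF.
Qed.

End cauchy_ball.

Lemma clim_le (u : nat -> C) (l a : C) (M : R) : clim u l ->
  (forall n, rnorm (u n - a) <= M) -> rnorm (l - a) <= M.
Proof.
move=> ul uM; rewrite leNgt; apply/negP => h.
have [|N hN] := ul ((rnorm (l - a) - M) / 2); first by rewrite divr_gt0// subr_gt0.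
have h1 := hN N (leqnn _); have h2 := uM N; rewrite rnormBC in h1.
have : rnorm (l - a) <= rnorm (l - u N) + rnorm (u N - a).
  by have := rnormD (l - u N) (u N - a); rewrite addrA subrK.
by move: h h1 h2; lra.
Qed.

(** By the uniform quadratic remainder, the differentials at x are difference
    quotients of the functions up to an error independent of n and small with
    the step. Pointwise convergence of the functions thus makes the
    differentials a Cauchy sequence in each direction; its limit L is linear
    and bounded, and inherits the quadratic remainder. *)
Lemma differentiable_clim (fs : nat -> V -> C) (f : V -> C) x (d M : R) : 0 < d ->
  (forall n y, rnorm (y - x) < d -> differentiable (fs n) y) ->
  (forall n y, rnorm (y - x) < d -> rnorm (fs n y) <= M) ->
  (forall y, rnorm (y - x) < d -> clim (fun n => fs n y) (f y)) ->
  differentiable f x.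
Proof.
move=> d0 dfs fsM fsf.
have M0 : 0 <= M by rewrite (le_trans _ (fsM 0%N x _)) ?rnorm_ge0// subrr rnorm0.
set K := 16 * M / d ^+ 2.
have K0 : 0 <= K by rewrite divr_ge0 ?exprn_ge0 ?mulr_ge0 ?(ltW d0).
have [D [linD leD rem]] : exists D : nat -> V -> C, [/\ forall n, linear (D n),
    forall n h, rnorm (D n h) <= 4 * M / d * rnorm h &
    forall n h, rnorm h <= d / 4 -> rnorm (fs n (x + h) - fs n x - D n h) <= K * rnorm h ^+ 2].
  exists (fun n h => 'd (fs n) x h); split=> [n c h k|n h|n h hd].
  - exact: linearP.
  - exact: cauchy_diff_le d0 (dfs n) (fsM n) h.
  - by have [] := cauchy_remainder d0 (dfs n) (fsM n) hd.
have DZ n c h : D n (c *: h) = c * D n h.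
  have D0 : D n 0 = 0 by have := linD n (-1) 0 0; rewrite scaler0 addr0 scaleN1r addNr.
  by have := linD n c h 0; rewrite !addr0 D0 addr0.
have inb h : rnorm h <= d / 4 -> rnorm (x + h - x) < d.
  by rewrite addrAC subrr add0r; move: d0; lra.
have x0 : rnorm (x - x) < d by rewrite subrr rnorm0.
have cvL h : exists l, clim (fun n => D n h) l.
  apply: clim_cauchy => e e0.
  set W := 1 + rnorm h; have W0 : 0 < W by rewrite ltr_wpDr// rnorm_ge0.
  (* with the step t, the remainders contribute at most e / 2 to the difference
     of two differentials applied to h; n is chosen afterwards, depending on t *)
  pose t := Num.min (d / 4 / W) (e / (4 * (K + 1) * W ^+ 2)).
  have K1 : 0 < K + 1 by rewrite ltr_wpDl.
  have t0 : 0 < t by rewrite lt_min !divr_gt0// !mulr_gt0// exprn_gt0.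
  have td : t * W <= d / 4 by rewrite -ler_pdivlMr// /t ge_min lexx.
  have te : t * (4 * (K + 1) * W ^+ 2) <= e.
    by rewrite -ler_pdivlMr ?mulr_gt0 ?exprn_gt0// /t ge_min lexx orbT.
  pose u := t%:C *: h.
  have uW : rnorm u <= t * W by rewrite rnormZ cnormR ger0_norm ?(ltW t0)// ler_wpM2l ?(ltW t0)// lerDr.
  have ud : rnorm u <= d / 4 := le_trans uW td.
  have [|N1 h1] := fsf _ (inb _ ud) (e * t / 8); first by rewrite divr_gt0// mulr_gt0.
  have [|N2 h2] := fsf _ x0 (e * t / 8); first by rewrite divr_gt0// mulr_gt0.
  exists (maxn N1 N2) => n m; rewrite !geq_max => /andP[n1 n2] /andP[m1 m2].
  have tn : rnorm (t%:C : C) = t by rewrite cnormR ger0_norm// ltW.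
  rewrite -(ler_pM2l t0) -{1}tn -cnormM mulrBr.
  rewrite -!DZ -/u.
  have -> : D n u - D m u =
     ((fs m (x + u) - fs m x - D m u) - (fs n (x + u) - fs n x - D n u))
     + (((fs n (x + u) - f (x + u)) - (fs m (x + u) - f (x + u)))
     - ((fs n x - f x) - (fs m x - f x))) by ring.
  rewrite (le_trans (rnormD _ _))//.
  have b1 := le_trans (rnormB _ _) (lerD (rem m u ud) (rem n u ud)).
  have b2 := le_trans (rnormB _ _) (lerD (h1 n n1) (h1 m m1)).
  have b3 := le_trans (rnormB _ _) (lerD (h2 n n2) (h2 m m2)).
  have b4 := le_trans (rnormB _ _) (lerD b2 b3).
  have b5 : K * rnorm u ^+ 2 <= e * t / 4.
    apply: (@le_trans _ _ (K * (t * W) ^+ 2)).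
      by rewrite ler_wpM2l// ler_pXn2r ?nnegrE ?rnorm_ge0// mulr_ge0 ?ltW.
    apply: (@le_trans _ _ ((K + 1) * (t * W) ^+ 2)).
      by rewrite ler_wpM2r ?exprn_ge0 ?mulr_ge0 ?(ltW t0) ?(ltW W0)// lerDl.
    have -> : (K + 1) * (t * W) ^+ 2 = t * (4 * (K + 1) * W ^+ 2) * t / 4 by field.
    by rewrite ler_pM2r// ler_pM2r.
  rewrite (le_trans (lerD b1 b4))//.
  by move: b5; lra.
have [L hL] := choice cvL.
have linL : linear L.
  move=> c h k; apply: clim_uniq (hL _) _; apply/clim_cvg.
  rewrite (_ : (fun n => _) = fun n => c *: D n h + D n k).
    by apply: cvgD; [apply: cvgMr|]; exact/clim_cvg.
  by apply/funext => n; rewrite linD.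
have [] // := @eps_diff f x L (4 * M / d) linL.
  move=> h; rewrite -[L h]subr0; apply: clim_le (hL h) _ => n.
  by rewrite subr0.
have rem' h : rnorm h <= d / 4 -> rnorm (f (x + h) - f x - L h) <= K * rnorm h ^+ 2.
  move=> hd; rewrite -[X in rnorm X]subr0.
  apply: (@clim_le (fun n => fs n (x + h) - fs n x - D n h)) => [|n].
    apply/clim_cvg; apply: cvgB; [apply: cvgB|]; apply/clim_cvg.
    - exact: fsf (inb _ hd).
    - exact: fsf x0.
    - exact: hL.
  by rewrite subr0; exact: rem.
move=> e e0; exists (Num.min (d / 4) (e / (K + 1))).
  by rewrite lt_min !divr_gt0// ltr_wpDl.
move=> h; rewrite lt_min => /andP[hd he].
rewrite (le_trans (rem' _ (ltW hd)))// expr2 mulrA ler_wpM2r ?rnorm_ge0//.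
move: he; rewrite ltr_pdivlMr ?ltr_wpDl// => he.
by have := rnorm_ge0 h; move: he; lra.
Qed.

End banach.

(** * Taylor expansion on the unit ball *)
Section unit_ball.
Context (R : realType) (V : normedModType R[i]).
Local Notation C := R[i].
Implicit Types (F : V -> C) (x y w : V).

Definition holB F := forall x, rnorm x < 1 -> differentiable F x.

Definition bndB F := forall s : R, s < 1 -> exists M : R, forall x, rnorm x <= s -> rnorm (F x) <= M.

Definition dir_deriv w F x : C := 'd F x w.

Lemma bndB_dir_deriv F w : holB F -> bndB F -> bndB (dir_deriv w F).
Proof.
move=> hF bF s s1; pose d := (1 - s) / 2.
have d0 : 0 < d by rewrite divr_gt0// subr_gt0.
have [|M hM] := bF ((1 + s) / 2); first by move: s1; lra.
exists (4 * M / d * rnorm w) => x xs.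
have near y : rnorm (y - x) < d -> rnorm y <= (1 + s) / 2.
  by have := rnormD (y - x) x; rewrite subrK /d; move: xs; lra.
apply: cauchy_diff_le => // y /near ys; last exact: hM.
by apply: hF; move: ys s1; lra.
Qed.

(** Difference quotients n (F (y + w / n) - F y) are holomorphic, uniformly
    bounded near x by Cauchy's estimate, and converge to the derivative in the
    direction w; no second derivative of F has to be constructed. *)
Lemma holB_dir_deriv F w : holB F -> bndB F -> holB (dir_deriv w F).
Proof.
move=> hF bF x x1; pose d := (1 - rnorm x) / 8.
have d0 : 0 < d by rewrite divr_gt0// subr_gt0.
have [|M hM] := bF (rnorm x + 3 * d); first by rewrite /d; move: x1; lra.
have near y z : rnorm (y - x) < d -> rnorm (z - y) < 2 * d -> rnorm z <= rnorm x + 3 * d.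
  have := rnormD (z - y) (y - x + x); rewrite !subrK.
  by have := rnormD (y - x) x; rewrite subrK; lra.
have d20 : 0 < 2 * d by rewrite mulr_gt0.
have x3 : rnorm x + 3 * d < 1 by rewrite /d; move: x1; lra.
have dF y z : rnorm (y - x) < d -> rnorm (z - y) < 2 * d -> differentiable F z.
  by move=> h1 h2; apply: hF; exact: le_lt_trans (near _ _ h1 h2) x3.
have bF' y z : rnorm (y - x) < d -> rnorm (z - y) < 2 * d -> rnorm (F z) <= M.
  by move=> h1 h2; apply: hM; exact: near h1 h2.
have self y : rnorm (y - y) < 2 * d by rewrite subrr rnorm0.
(* start the sequence of quotients where the step w / n is at most d / 2 *)
pose N := (Num.bound (2 * (rnorm w + 1) / d)).+1.
have N0 : 0 < N%:R :> R by rewrite ltr0n.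
have hN n : rnorm w / (n + N)%:R <= d / 2.
  have w0 : 0 <= rnorm w := rnorm_ge0 w.
  have h0 : 0 <= 2 * (rnorm w + 1) / d by apply: divr_ge0 (ltW d0); apply: mulr_ge0 => //; apply: addr_ge0.
  have : 2 * (rnorm w + 1) / d < N%:R by rewrite (lt_le_trans (archi_boundP h0))// ler_nat.
  rewrite ltr_pdivrMr// => h.
  have h1 : N%:R <= (n + N)%:R :> R by rewrite ler_nat leq_addl.
  rewrite ler_pdivrMr; last exact: lt_le_trans h1.
  have := ler_wpM2l (ltW d0) h1; lra.
pose c n : C := (n + N)%:R.
have c0 n : c n != 0 by rewrite pnatr_eq0 addnS.
pose rm n : R := (n + N)%:R.
have cn n : rnorm (c n) = rm n by rewrite /c -(rmorph_nat (real_complex R)) cnormR ger0_norm.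
have m0 n : rm n != 0 by rewrite pnatr_eq0 addnS.
have un n : rnorm ((c n)^-1 *: w) <= d / 2 by rewrite rnormZ cnormV cn mulrC; exact: hN.
pose fs n y := c n * (F (y + (c n)^-1 *: w) - F y).
apply: (@differentiable_clim R V fs _ x d (8 * M / (2 * d) * rnorm w) d0).
- move=> n y yd.
  have dsh : differentiable (fun y => F (y + (c n)^-1 *: w)) y.
    have h : differentiable F (y + (c n)^-1 *: w).
      apply: (dF y) => //; rewrite addrAC subrr add0r.
      by have := un n; move: d0; lra.
    apply: (@differentiable_comp _ _ _ _ (fun y => y + (c n)^-1 *: w) F) => //.
  have dB : differentiable ((fun y => F (y + (c n)^-1 *: w)) - F) y.
    by apply: differentiableB; [exact: dsh|exact: (dF y)].
  exact: (differentiableZ (c n) dB).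
- move=> n y yd; rewrite /fs cnormM cn.
  have [|_ h] := @cauchy_remainder R V F y (2 * d) M d20 (fun z => dF y z yd) (fun z => bF' y z yd) ((c n)^-1 *: w).
    by have := un n; move: d0; lra.
  rewrite (le_trans (ler_wpM2l _ h))// rnormZ cnormV cn.
  rewrite le_eqVlt; apply/orP; left; apply/eqP.
  by move: (m0 n); generalize (rm n) => m m1; field; rewrite m1 gt_eqF.
- move=> y yd e e0.
  pose K := 16 * M / (2 * d) ^+ 2 * rnorm w ^+ 2.
  exists (Num.bound (`|K| / e)).+1 => n hn.
  have [|h _] := @cauchy_remainder R V F y (2 * d) M d20 (fun z => dF y z yd) (fun z => bF' y z yd) ((c n)^-1 *: w).
    by have := un n; move: d0; lra.
  have -> : fs n y - dir_deriv w F y = c n * (F (y + (c n)^-1 *: w) - F y - 'd F y ((c n)^-1 *: w)).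
    have -> : 'd F y ((c n)^-1 *: w) = (c n)^-1 * 'd F y w by rewrite linearZ.
    by rewrite [RHS]mulrBr mulVKf.
  rewrite cnormM (le_trans (ler_wpM2l (rnorm_ge0 _) h))// rnormZ cnormV cn.
  have -> : rm n * (16 * M / (2 * d) ^+ 2 * ((rm n)^-1 * rnorm w) ^+ 2) = K / rm n.
    by move: (m0 n); rewrite /K; generalize (rm n) => m m1; field; rewrite m1 gt_eqF.
  rewrite ler_pdivrMr; last by rewrite /rm ltr0n addnS.
  have : `|K| / e < (Num.bound (`|K| / e)).+1%:R by rewrite (lt_le_trans (archi_boundP _))// ?ler_nat// divr_ge0 ?(ltW e0).
  rewrite ltr_pdivrMr// => h1.
  rewrite (le_trans (ler_norm _))// (le_trans (ltW h1))// mulrC ler_wpM2l ?(ltW e0)//.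
  by rewrite ler_nat (leq_trans hn)// leq_addr.
Qed.

Lemma iter_dir_deriv F w n : holB F -> bndB F ->
  holB (iter n (dir_deriv w) F) /\ bndB (iter n (dir_deriv w) F).
Proof.
move=> hF bF; elim: n => [//|n [h b]]; split; [exact: holB_dir_deriv|exact: bndB_dir_deriv].
Qed.

Lemma taylor_remainder F y w (rho s M : R) (a : C) K : holB F -> bndB F ->
  0 < rho -> s < 1 -> (forall z : C, rnorm z <= rho -> rnorm (y + z *: w) <= s) ->
  (forall x, rnorm x <= s -> rnorm (F x) <= M) -> rnorm a < rho ->
  rnorm (F (y + a *: w) - \sum_(0 <= k < K) iter k (dir_deriv w) F y / k`!%:R * a ^+ k) <=
  2 * M * (rnorm a / rho) ^+ K * (rho / (rho - rnorm a)).
Proof.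
move=> hF bF rho0 s1 hs hM ar.
pose hs' k (z : C) := iter k (dir_deriv w) F (y + z *: w).
have dh k z : rnorm z <= rho -> cdiff (hs' k) z (hs' k.+1 z).
  move=> zr; apply: cdiff_line; have [h _] := iter_dir_deriv w k hF bF.
  by apply: h; rewrite (le_lt_trans _ s1)// hs.
have bh k : exists M, forall z, rnorm z <= rho -> rnorm (hs' k z) <= M.
  have [_ b] := iter_dir_deriv w k hF bF; have [N hN] := b s s1.
  by exists N => z zr; apply: hN; exact: hs.
have hh : hol_disc rho (hs' 0%N) by move=> z /(dh 0%N); exists (hs' 1%N z).
have := @cauchy_expansion R rho rho0 (hs' 0%N) M hh _ a K ar.
rewrite (eq_bigr (fun k => iter k (dir_deriv w) F y / k`!%:R * a ^+ k)); last first.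
  by move=> k _; rewrite (cauchy_coef_iter rho0 dh bh) /hs' scale0r addr0.
by apply=> z zr; apply: hM; exact: hs.
Qed.

End unit_ball.

(** * The algebra of functions of bounded type and its spectrum *)
Section Hb_algebra.
Context (R : realType) (p : nat) (p1 : (1 < p)%N).
Local Notation lp := (lp R p1).
Local Notation Hb := (Hb R p1).
Local Notation Mb := (Mb R p1).
Local Notation C := R[i].
Implicit Types (f g : Hb) (A : set (uball R p1)) (chi psi : Mb).

Lemma normr_lt1 (x : lp) : (`|x| < 1) = (rnorm x < 1).
Proof. by rewrite -rnormE -[1]/((1 : R)%:C) ltcR. Qed.

Lemma uball_lt1 (x : uball R p1) : rnorm (val x) < 1.
Proof. by rewrite -normr_lt1; exact: valP x. Qed.

Lemma normr_ltC (x : lp) (s : R) : (`|x| < s%:C) = (rnorm x < s).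
Proof. by rewrite -rnormE ltcR. Qed.

Lemma sballP s (x : uball R p1) : sball s x <-> rnorm (val x) < s.
Proof. by rewrite -normr_ltC; split. Qed.

Definition pt_ball (x : lp) (x1 : rnorm x < 1) : uball R p1 :=
  exist _ x (eq_ind_r is_true x1 (normr_lt1 x)).

Lemma extend0_pt f (x : lp) (x1 : rnorm x < 1) : extend0 f x = f (pt_ball x1).
Proof. by rewrite -extend0_val. Qed.

Lemma Hb_holB f : holB (extend0 f).
Proof.
move=> x x1; have /asboolP[h _] := HbP f; exact: (h (pt_ball x1)).
Qed.

Lemma Hb_bndB f : bndB (extend0 f).
Proof.
move=> s s1; have /asboolP[_ b] := HbP f.
have [|M hM] := b (Num.max (1 / 2) ((1 + s) / 2)).
  by rewrite lt_max gt_max; apply/andP; split; [apply/orP; left|apply/andP; split]; move: s1; lra.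
exists M => x xs; have x1 : rnorm x < 1 := le_lt_trans xs s1.
rewrite (extend0_pt f x1) -lecR rnormE; apply: hM.
by apply/sballP; rewrite /= lt_max; apply/orP; right; move: xs s1; lra.
Qed.

Lemma mem_Hb (F : lp -> C) : holB F -> bndB F -> (fun y : uball R p1 => F (val y)) \in @Hb_pred R p p1.
Proof.
move=> hF bF; apply/asboolP; split.
  move=> x; apply: near_eq_differentiable (hF _ (uball_lt1 x)).
  by apply: filterS (near_uball x) => y y1; rewrite /extend0 insubT.
move=> s /andP[s0 s1]; have [M hM] := bF s s1.
by exists M => x /sballP xs; rewrite -rnormE lecR hM// ltW.
Qed.

Definition mkHb (F : lp -> C) (hF : holB F) (bF : bndB F) : Hb := MkHb (mem_Hb hF bF).

Lemma mem_taylor f n w : taylor f n w \in @Hb_pred R p p1.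
Proof.
have [h b] := iter_dir_deriv w n (@Hb_holB f) (@Hb_bndB f).
apply: (@mem_Hb (fun y => iter n (dir_deriv w) (extend0 f) y / n`!%:R)) => [x x1|s s1].
  rewrite (_ : (fun _ => _) = n`!%:R^-1 *: iter n (dir_deriv w) (extend0 f)).
    by apply: differentiableZ; exact: h.
  by apply/funext => y; rewrite mulrC.
have [M hM] := b s s1; exists (M * rnorm (n`!%:R : C)^-1) => x xs.
by rewrite cnormM ler_wpM2r ?rnorm_ge0// hM.
Qed.

Definition taylor_Hb f n w : Hb := MkHb (mem_taylor f n w).

(** Domination without extended reals. On an empty set both sides fail, by the
    value -oo of the supremum and by the vacuous bound -1. *)
Lemma prec_le (phi : Hb -> C) A : prec phi A <->
  forall f (c : R), (forall x, A x -> rnorm (f x) <= c) -> rnorm (phi f) <= c.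
Proof.
split=> [H f c fc|H f].
  rewrite -lee_fin; apply: le_trans (H f) _.
  by apply: ge_ereal_sup => _ [x Ax <-]; rewrite lee_fin; exact: fc.
set S := ereal_sup _.
have ub x : A x -> ((rnorm (f x))%:E <= S)%E by move=> Ax; apply: ereal_sup_ubound; exists x.
case: S ub => [c| |] ub; first by rewrite lee_fin; apply: H => x /ub; rewrite lee_fin.
  by rewrite leey.
have h : rnorm (phi f) <= -1 by apply: H => x /ub; rewrite leeNy_eq.
by exfalso; have := rnorm_ge0 (phi f); move: h; lra.
Qed.

Lemma Hb_cvg (fs : nat -> Hb) f :
  (forall s : R, 0 < s < 1 -> forall e : R, 0 < e -> exists N, forall n, (N <= n)%N ->
     forall x, sball s x -> rnorm (fs n x - f x) <= e) ->
  fs @ \oo --> f.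
Proof.
move=> H U; rewrite nbhsE => -[B [[D oD <-] Df] BU].
have cv : (fun n => Hb_fun (fs n)) @ \oo -->
  (Hb_fun f : {family [set sball s | s in [set s : R | 0 < s < 1]], uball R p1 -> C}).
  apply/fam_cvgP => _ [s /= s01 <-] P /uniform_nbhs[E [entE EP]].
  have [e /= e0 eE] : exists2 e : R, 0 < e & [set xy : C * C | rnorm (xy.1 - xy.2) <= e] `<=` E.
    have /= := entE; rewrite -entourage_from_ballE => -[e /= e0 hE].
    have eE : e = (complex.Re e)%:C by rewrite RRe_real// gtr0_real.
    have e0' : 0 < complex.Re e by rewrite -ltcR -eE.
    exists (complex.Re e / 2); first by rewrite divr_gt0.
    move=> [a b] /= ab; apply: hE => /=; rewrite -ball_normE/= -rnormE eE ltcR.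
    by move: ab e0'; lra.
  have [N hN] := H s s01 e e0; exists N => // n /= Nn; apply: EP => /= y ys.
  by apply: eE => /=; rewrite rnormBC; exact: hN.
have /cv [N _ hN] : nbhs (Hb_fun f : {family [set sball s | s in [set s : R | 0 < s < 1]], uball R p1 -> C}) D.
  exact: open_nbhs_nbhs.
by exists N => // n /hN /= h; apply: BU.
Qed.

Lemma continuous_prec (psi : Hb -> C) s : 0 < s < 1 -> scalar psi -> prec psi (sball s) ->
  continuous psi.
Proof.
move=> s01 lpsi /prec_le H f.
apply/(@cvgrPdist_le _ _ _ (nbhs (f : Hb)) _ psi (psi f)) => e e0.
have eE : e = (complex.Re e)%:C by rewrite RRe_real// gtr0_real.
have e0' : 0 < complex.Re e by rewrite -ltcR -eE.
pose E := [set xy : C * C | ball xy.1 e xy.2].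
have entE : entourage E.
  by rewrite -entourage_from_ballE; exists e.
have /= n1 := @fam_nbhs (uball R p1) C [set sball s | s in [set s : R | 0 < s < 1]]
  (sball s) E (Hb_fun f) entE (ex_intro2 _ _ s s01 erefl).
have cH : continuous (@Hb_fun R p p1 : Hb -> {family [set sball s | s in [set s : R | 0 < s < 1]], uball R p1 -> C}).
  by move=> x; exact: initial_continuous.
apply: (@filterS _ (nbhs (f : Hb)) (nbhs_filter (f : Hb)) _ _ _ (cH f _ n1)) => g /= gE.
have -> : psi f - psi g = psi (f - g).
  have lE a u v : psi (a *: u + v) = a * psi u + psi v := lpsi a u v.
  by rewrite [f - g]addrC -[- g]scaleN1r lE mulN1r addrC.
rewrite -rnormE eE lecR; apply: H => x xs.
have := gE x xs; rewrite /E/= -ball_normE/= -rnormE eE ltcR => /ltW.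
exact.
Qed.

Lemma Mb0 chi : chi 0 = 0.
Proof.
by have := Mb_linear chi (-1) 0 0; rewrite scaler0 addr0 mulN1r addNr.
Qed.

Lemma MbB chi f g : chi (f - g) = chi f - chi g.
Proof.
by rewrite [f - g]addrC -scaleN1r (Mb_linear chi) mulN1r addrC.
Qed.

Lemma MbD chi f g : chi (f + g) = chi f + chi g.
Proof. by have := Mb_linear chi 1 f g; rewrite scale1r mul1r. Qed.

Lemma MbZ chi (c : C) f : chi (c *: f) = c * chi f.
Proof. by have := Mb_linear chi c f 0; rewrite !addr0 Mb0 addr0. Qed.

Lemma Mb1 chi : chi 1 = 1.
Proof.
have [f f0] := Mb_neq0 chi; apply: (mulIf f0).
by rewrite mul1r -Mb_mult mul1r.
Qed.

Lemma MbX chi f n : chi (f ^+ n) = chi f ^+ n.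
Proof. by elim: n => [|n IH]; rewrite ?expr0 ?Mb1// !exprS Mb_mult IH. Qed.

Lemma Mb_sum chi n (F : nat -> Hb) : chi (\sum_(0 <= k < n) F k) = \sum_(0 <= k < n) chi (F k).
Proof.
elim: n => [|n IH]; first by rewrite !big_geq// Mb0.
by rewrite !big_nat_recr//= MbD IH.
Qed.

Lemma Hb_sumE n (F : nat -> Hb) x : (\sum_(0 <= k < n) F k) x = \sum_(0 <= k < n) F k x.
Proof.
elim: n => [|n IH]; first by rewrite !big_geq.
by rewrite !big_nat_recr//= -IH.
Qed.

Lemma Hb_XE f n x : (f ^+ n) x = f x ^+ n.
Proof. by elim: n => [|n IH]; rewrite ?expr0// !exprS -IH. Qed.

(** Otherwise, for every ball s_n B with s_n -> 1 some f has |chi f| greater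
    than its supremum there. A high power of f / chi f is then small on s_n B
    and still mapped to 1, which yields a sequence tending to 0 whose image
    does not. *)
Lemma Mb_prec chi : exists2 s : R, 0 < s < 1 & prec chi (sball s).
Proof.
apply: contrapT => H.
pose sn n : R := 1 - n.+2%:R^-1.
have sn01 n : 0 < sn n < 1.
  by rewrite /sn subr_gt0 ltrBlDr ltrDl invr_gt0 ltr0n invf_lt1 ?ltr1n ?ltr0n.
have step n : exists g, chi g = 1 /\ forall x, sball (sn n) x -> rnorm (g x) <= n.+1%:R^-1.
  have : ~ prec chi (sball (sn n)) by move=> h; apply: H; exists (sn n).
  move=> /prec_le; rewrite -existsNP => -[f]; rewrite -existsNP => -[c].
  move=> /not_implyP[fc /negP]; rewrite -ltNge => cf.
  have c0 : 0 <= c.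
    have /andP[s0 s1] := sn01 n.
    have z1 : rnorm (0 : lp) < 1 by rewrite rnorm0.
    rewrite (le_trans (rnorm_ge0 (f (pt_ball z1))))// fc//.
    by apply/sballP; rewrite /= rnorm0.
  have chf0 : 0 < rnorm (chi f) by exact: le_lt_trans cf.
  have chf1 : chi f != 0 by rewrite -rnorm_gt0.
  have q1 : 0 <= c / rnorm (chi f) < 1 by rewrite divr_ge0 ?rnorm_ge0//= ltr_pdivrMr// mul1r.
  have [|N hN] := @geometric_small R 1 (c / rnorm (chi f)) n.+1%:R^-1 q1; first by rewrite invr_gt0 ltr0n.
  exists (((chi f)^-1 *: f) ^+ N); split.
    by rewrite MbX MbZ mulVf// expr1n.
  move=> x xs; rewrite Hb_XE cnormX.
  have := hN N (leqnn _); rewrite mul1r ger0_norm; last by rewrite exprn_ge0//; case/andP: q1.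
  apply: le_trans; apply: lerXn2r; rewrite ?nnegrE ?rnorm_ge0//; first by case/andP: q1.
  rewrite -[((chi f)^-1 *: f) x]/((chi f)^-1 * f x) cnormM cnormV mulrC.
  by rewrite ler_wpM2r ?invr_ge0 ?rnorm_ge0// fc.
have [g hg] := choice step.
have g0 : g @ \oo --> (0 : Hb).
  apply: Hb_cvg => s /andP[s0 s1] e e0.
  have h1 : 0 < 1 - s by rewrite subr_gt0.
  exists (maxn (Num.bound (1 - s)^-1) (Num.bound e^-1)) => n; rewrite geq_max => /andP[n1 n2] x /sballP xs.
  have b1 : (1 - s)^-1 < n.+2%:R.
    rewrite (lt_le_trans (archi_boundP _))// ?invr_ge0 ?(ltW h1)// ler_nat.
    by rewrite (leq_trans n1)// (leq_trans (leqnSn _)).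
  have b2 : e^-1 < n.+1%:R.
    by rewrite (lt_le_trans (archi_boundP _))// ?invr_ge0 ?(ltW e0)// ler_nat (leq_trans n2).
  have [_ hgn] := hg n; rewrite -[X in rnorm X]/(g n x - 0) subr0.
  rewrite (le_trans (hgn x _))//.
    apply/sballP; rewrite (lt_trans xs)// /sn ltrBrDl -ltrBrDr.
    by rewrite invf_plt ?posrE ?ltr0n.
  by rewrite invf_ple ?posrE ?ltr0n// ltW.
have cc : chi x @[x --> (0 : Hb)] --> chi 0 := @Mb_continuous _ _ _ chi 0.
have cg : (fun n => chi (g n)) @ \oo --> chi 0 := cvg_comp _ _ g0 cc.
have [|N hN] := (clim_cvg _ _).2 cg (1 / 2); first by rewrite divr_gt0.
have := hN N (leqnn _); have [-> _] := hg N.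
by rewrite Mb0 subr0 cnorm1; lra.
Qed.

End Hb_algebra.

(** * Translating a homomorphism *)
Section translation.
Context (R : realType) (p : nat) (p1 : (1 < p)%N).
Local Notation lp := (lp R p1).
Local Notation Hb := (Hb R p1).
Local Notation Mb := (Mb R p1).
Local Notation C := R[i].
Implicit Types (f g : Hb) (A B : set (uball R p1)) (chi psi : Mb) (w u : lp).

Lemma Mb_ext chi psi : (forall f, chi f = psi f) -> chi = psi.
Proof.
move=> H; have e : Mb_fun chi = Mb_fun psi by apply/funext.
case: chi psi e {H} => [f1 a1 b1 c1 d1] [f2 a2 b2 c2 d2]/= e.
by subst f2; f_equal; exact: Prop_irrelevance.
Qed.

(** The room that Cauchy's estimates need in order to give, uniformly on A, the
    convergence of Taylor series in the direction w: a disc of radius rho > 1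
    around each point of A stays in a fixed smaller ball. *)
Definition admissible A w := exists rho s : R, [/\ 1 < rho, s < 1 &
  forall y, A y -> forall z : C, rnorm z <= rho -> rnorm (val y + z *: w) <= s].

Definition taylor_sum f w K : Hb := \sum_(0 <= k < K) taylor_Hb f k w.

Definition unif_on A (h : nat -> Hb) (g : uball R p1 -> C) := forall e : R, 0 < e ->
  exists N, forall n, (N <= n)%N -> forall y, A y -> rnorm (h n y - g y) <= e.

Lemma admissible_in A w : admissible A w -> exists2 s : R, 0 < s < 1 & forall y, A y -> rnorm (val y + w) < s.
Proof.
move=> [rho [s [rho1 s1 H]]]; exists (Num.max (1 / 2) ((1 + s) / 2)).
  by rewrite lt_max gt_max; apply/andP; split; [apply/orP; left|apply/andP; split]; move: s1; lra.
move=> y Ay; rewrite lt_max; apply/orP; right.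
have := H y Ay 1; rewrite cnorm1 scale1r => /(_ (ltW rho1)).
by move: s1; lra.
Qed.

Lemma admissible_lt1 A w y : admissible A w -> A y -> rnorm (val y + w) < 1.
Proof. by move=> /admissible_in[s /andP[_ s1] H] Ay; exact: lt_trans (H y Ay) s1. Qed.

Lemma taylor_sum_unif A w f : admissible A w -> unif_on A (taylor_sum f w) (fun y => extend0 f (val y + w)).
Proof.
move=> [rho [s [rho1 s1 H]]] e e0.
have rho0 : 0 < rho by exact: lt_trans rho1.
have [M hM] := @Hb_bndB R p p1 f s s1.
have [||N hN] := @geometric_small R (2 * M * (rho / (rho - 1))) (1 / rho) e; [|by []|].
  by rewrite divr_ge0 ?(ltW rho0)//= ltr_pdivrMr// mul1r.
exists N => n Nn y Ay; rewrite rnormBC.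
have := @taylor_remainder R lp (extend0 f) (val y) w rho s M 1 n
  (@Hb_holB _ _ _ f) (@Hb_bndB _ _ _ f) rho0 s1 (H y Ay) hM.
rewrite cnorm1 scale1r => /(_ rho1) h.
have -> : taylor_sum f w n y =
    \sum_(0 <= k < n) iter k (dir_deriv w) (extend0 f) (val y) / k`!%:R * 1 ^+ k.
  by rewrite Hb_sumE; apply: eq_bigr => k _; rewrite expr1n mulr1.
rewrite (le_trans h)// (le_trans _ (hN n Nn))// (le_trans _ (ler_norm _))//.
by rewrite le_eqVlt; apply/orP; left; apply/eqP; ring.
Qed.

Lemma prec_close chi A f g (e : R) : prec chi A ->
  (forall y, A y -> rnorm (f y - g y) <= e) -> rnorm (chi f - chi g) <= e.
Proof. by move=> /prec_le H fg; rewrite -MbB; apply: H. Qed.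

Lemma unif_on_close A h1 h2 (g1 g2 : uball R p1 -> C) chi : prec chi A -> unif_on A h1 g1 -> unif_on A h2 g2 ->
  (forall y, A y -> g1 y = g2 y) -> forall e : R, 0 < e -> exists N, forall n m, (N <= n)%N -> (N <= m)%N ->
  rnorm (chi (h1 n) - chi (h2 m)) <= e.
Proof.
move=> cA u1 u2 g12 e e0; have e20 : 0 < e / 2 by rewrite divr_gt0.
have [N1 h1'] := u1 _ e20; have [N2 h2'] := u2 _ e20.
exists (maxn N1 N2) => n m; rewrite !geq_max => /andP[n1 _] /andP[_ n2].
apply: prec_close cA _ => y Ay.
have a1 := h1' n n1 y Ay; have a2 := h2' m n2 y Ay.
have -> : h1 n y - h2 m y = (h1 n y - g1 y) - (h2 m y - g2 y).
  by rewrite (g12 y Ay); ring.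
by rewrite (le_trans (rnormB _ _))//; move: a1 a2; lra.
Qed.

Lemma series_taylor_sum chi f w (g : nat -> Hb) : (forall n, Hb_fun (g n) = taylor f n w) ->
  series (fun n => chi (g n)) = fun K => chi (taylor_sum f w K).
Proof.
move=> gE; apply/funext => K; rewrite /taylor_sum Mb_sum /series/=.
by apply: eq_bigr => k _; congr (chi _); apply: val_inj; rewrite /= gE.
Qed.

Lemma translate_taylor_sum chi w psi f : is_translate chi w psi ->
  clim (fun K => chi (taylor_sum f w K)) (psi f).
Proof.
by move=> /(_ f)[g gE]; rewrite (series_taylor_sum _ gE) => /clim_cvg.
Qed.

Lemma taylor_sum_translate chi w psi : (forall f, clim (fun K => chi (taylor_sum f w K)) (psi f)) ->
  is_translate chi w psi.
Proof.
move=> H f; exists (fun n => taylor_Hb f n w) => //.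
by rewrite (@series_taylor_sum chi f w (fun n => taylor_Hb f n w))//; apply/clim_cvg.
Qed.

(** A functional dominated by A does not distinguish two sequences with the
    same uniform limit on A, so Taylor sums may be replaced by any other
    approximations. *)
Lemma translate_unif_on chi A w psi f h : prec chi A -> admissible A w ->
  is_translate chi w psi -> unif_on A h (fun y => extend0 f (val y + w)) ->
  clim (fun n => chi (h n)) (psi f).
Proof.
move=> cA gA tr uh e e0; have e20 : 0 < e / 2 by rewrite divr_gt0.
have [N1 h1] := unif_on_close cA uh (taylor_sum_unif f gA) (fun _ _ => erefl) e20.
have [N2 h2] := translate_taylor_sum f tr e20.
exists (maxn N1 N2) => n; rewrite geq_max => /andP[n1 n2].
have := h1 n n n1 n1; have := h2 n n2.
by have := rnormD (chi (h n) - chi (taylor_sum f w n)) (chi (taylor_sum f w n) - psi f);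
  rewrite addrA subrK; lra.
Qed.

Lemma clim_bound (v : nat -> C) l (c : R) : clim v l ->
  (forall e : R, 0 < e -> exists N, forall n, (N <= n)%N -> rnorm (v n) <= c + e) -> rnorm l <= c.
Proof.
move=> vl H; rewrite leNgt; apply/negP => h.
have e0 : 0 < (rnorm l - c) / 4 by rewrite divr_gt0// subr_gt0.
have [N1 h1] := vl _ e0; have [N2 h2] := H _ e0.
have := h1 (maxn N1 N2) (leq_maxl _ _); have := h2 (maxn N1 N2) (leq_maxr _ _).
rewrite rnormBC; have := rnormD (l - v (maxn N1 N2)) (v (maxn N1 N2)); rewrite subrK.
by move: h; lra.
Qed.

Lemma taylor_sum_prec chi A w f (c : R) (l : C) : prec chi A -> admissible A w ->
  clim (fun K => chi (taylor_sum f w K)) l ->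
  (forall y, A y -> rnorm (extend0 f (val y + w)) <= c) -> rnorm l <= c.
Proof.
move=> cA gA cl fc; apply: clim_bound cl _ => e e0.
have [N hN] := taylor_sum_unif f gA e0.
exists N => n Nn; apply: (prec_le _ _).1 cA _ _ _ => y Ay.
have := hN n Nn y Ay; have := fc y Ay.
have := rnormD (taylor_sum f w n y - extend0 f (val y + w)) (extend0 f (val y + w)).
by rewrite subrK; lra.
Qed.

Lemma translate_prec chi A w psi B : prec chi A -> admissible A w -> is_translate chi w psi ->
  (forall y, A y -> exists2 y', B y' & val y' = val y + w) -> prec psi B.
Proof.
move=> cA gA tr AB; apply/prec_le => f c fc.
apply: taylor_sum_prec cA gA (translate_taylor_sum f tr) _ => y Ay.
by have [y' By' <-] := AB y Ay; rewrite extend0_val; exact: fc.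
Qed.

Lemma extend0_lin (a : C) f g (x : lp) : rnorm x < 1 ->
  extend0 (a *: f + g) x = a * extend0 f x + extend0 g x.
Proof. by move=> x1; rewrite !(extend0_pt _ x1). Qed.

Lemma extend0_mul f g (x : lp) : rnorm x < 1 ->
  extend0 (f * g) x = extend0 f x * extend0 g x.
Proof. by move=> x1; rewrite !(extend0_pt _ x1). Qed.

(** The product of the Taylor sums of f and g is not the Taylor sum of f g, but
    both have the same uniform limit on A, so psi is multiplicative. *)
Lemma translate_ex chi A w : prec chi A -> admissible A w -> exists psi, is_translate chi w psi.
Proof.
move=> cA gA.
have cl f : exists l, clim (fun K => chi (taylor_sum f w K)) l.
  apply: clim_cauchy => e e0.
  have [N hN] := unif_on_close cA (taylor_sum_unif f gA) (taylor_sum_unif f gA) (fun _ _ => erefl) e0.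
  by exists N.
have [psi hpsi] := choice cl.
have key f h : unif_on A h (fun y => extend0 f (val y + w)) -> clim (fun n => chi (h n)) (psi f).
  move=> uh e e0; have e20 : 0 < e / 2 by rewrite divr_gt0.
  have [N1 h1] := unif_on_close cA uh (taylor_sum_unif f gA) (fun _ _ => erefl) e20.
  have [N2 h2] := hpsi f _ e20.
  exists (maxn N1 N2) => n; rewrite geq_max => /andP[n1 n2].
  have := h1 n n n1 n1; have := h2 n n2.
  by have := rnormD (chi (h n) - chi (taylor_sum f w n)) (chi (taylor_sum f w n) - psi f);
    rewrite addrA subrK; lra.
have lin : scalar psi.
  move=> a f g; pose h n : Hb := a *: taylor_sum f w n + taylor_sum g w n.
  have uh : unif_on A h (fun y => extend0 (a *: f + g) (val y + w)).
    move=> e e0; set a1 := 2 * (rnorm a + 1).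
    have a10 : 0 < a1 by rewrite mulr_gt0// ltr_wpDl// rnorm_ge0.
    have [N1 h1] := taylor_sum_unif f gA (divr_gt0 e0 a10).
    have [N2 h2] := taylor_sum_unif g gA (divr_gt0 e0 (ltr0Sn R 1)).
    exists (maxn N1 N2) => n; rewrite geq_max => /andP[n1 n2] y Ay.
    rewrite extend0_lin ?(admissible_lt1 gA)//.
    rewrite -[h n y]/(a * taylor_sum f w n y + taylor_sum g w n y) opprD addrACA -mulrBr.
    rewrite (le_trans (rnormD _ _))// [e]splitr lerD//; last exact: h2.
    rewrite cnormM (le_trans (ler_wpM2l (rnorm_ge0 a) (h1 n n1 y Ay)))//.
    rewrite mulrA ler_pdivrMr// /a1.
    by have := rnorm_ge0 a; move: e0; nra.
  apply: clim_uniq (key _ _ uh) _; apply/clim_cvg.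
  rewrite (_ : (fun n => _) = fun n => a * chi (taylor_sum f w n) + chi (taylor_sum g w n)).
    by apply: cvgD; [apply: cvgMr|]; exact/clim_cvg.
  by apply/funext => n; rewrite /h MbD MbZ.
have mul : {morph psi : f g / f * g}.
  move=> f g; pose h n : Hb := taylor_sum f w n * taylor_sum g w n.
  have [s /andP[s0 s1] hs] := admissible_in gA.
  have [M1 hM1] := @Hb_bndB R p p1 f s s1; have [M2 hM2] := @Hb_bndB R p p1 g s s1.
  have uh : unif_on A h (fun y => extend0 (f * g) (val y + w)).
    move=> e e0; pose M := `|M1| + `|M2| + 1.
    have M0 : 1 <= M by rewrite /M lerDr addr_ge0.
    have M0' : 0 < M by exact: lt_le_trans M0.
    pose d := Num.min 1 (e / (4 * M)).
    have d0 : 0 < d by rewrite lt_min ltr01 divr_gt0// mulr_gt0.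
    have d1 : d <= 1 by rewrite ge_min lexx.
    have de : d * (4 * M) <= e by rewrite -ler_pdivlMr ?mulr_gt0// ge_min lexx orbT.
    have [N1 h1] := taylor_sum_unif f gA d0.
    have [N2 h2] := taylor_sum_unif g gA d0.
    exists (maxn N1 N2) => n; rewrite geq_max => /andP[n1 n2] y Ay.
    rewrite extend0_mul ?(admissible_lt1 gA)//.
    rewrite -[h n y]/(taylor_sum f w n y * taylor_sum g w n y).
    have a1 := h1 n n1 y Ay; have a2 := h2 n n2 y Ay.
    have b1 : rnorm (extend0 f (val y + w)) <= M.
      rewrite (le_trans (hM1 _ (ltW (hs y Ay))))// /M.
      by have := ler_norm M1; have := normr_ge0 M2; lra.
    have b2 : rnorm (extend0 g (val y + w)) <= M.
      rewrite (le_trans (hM2 _ (ltW (hs y Ay))))// /M.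
      by have := ler_norm M2; have := normr_ge0 M1; lra.
    set F := taylor_sum f w n y in a1 *; set G := taylor_sum g w n y in a2 *.
    set F' := extend0 f _ in a1 b1 *; set G' := extend0 g _ in a2 b2 *.
    have -> : F * G - F' * G' = (F - F') * (G - G') + ((F - F') * G' + (G - G') * F') by ring.
    rewrite (le_trans (rnormD _ _))//.
    have c1 : rnorm ((F - F') * (G - G')) <= d * 1.
      by rewrite cnormM ler_pM ?rnorm_ge0// (le_trans a2).
    have c2 : rnorm ((F - F') * G') <= d * M by rewrite cnormM ler_pM ?rnorm_ge0.
    have c3 : rnorm ((G - G') * F') <= d * M by rewrite cnormM ler_pM ?rnorm_ge0.
    have := le_trans (rnormD _ _) (lerD c2 c3).
    by move: c1 de M0 d0; nra.
  apply: clim_uniq (key _ _ uh) _; apply/clim_cvg.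
  rewrite (_ : (fun n => _) = fun n => chi (taylor_sum f w n) * chi (taylor_sum g w n)).
    by apply: cvgM; exact/clim_cvg.
  by apply/funext => n; rewrite /h Mb_mult.
have [s s01 hs] := admissible_in gA.
have pr : prec psi (sball s).
  apply/prec_le => f c fc; apply: (taylor_sum_prec cA gA (hpsi f)) => y Ay.
  have y1 := admissible_lt1 gA Ay.
  by rewrite (extend0_pt _ y1); apply: fc; apply/sballP; exact: hs.
have ne0 : exists f, psi f != 0.
  exists 1; have u1 : unif_on A (fun=> 1) (fun y => extend0 (1 : Hb) (val y + w)).
    move=> e e0; exists 0%N => n _ y Ay; rewrite (extend0_pt _ (admissible_lt1 gA Ay)).
    by rewrite subrr rnorm0 ltW.
  have -> : psi 1 = 1.
    apply: clim_uniq (key _ _ u1) _ => e e0; exists 0%N => n _.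
    by rewrite Mb1 subrr rnorm0 ltW.
  exact: oner_neq0.
exists (MkMb lin mul (continuous_prec s01 lin pr) ne0).
by apply: taylor_sum_translate => f; exact: hpsi.
Qed.

(** Each psi (taylor_sum f u n) is a limit of values of chi at functions that
    approximate, uniformly on A, the n-th Taylor sum translated by w. A
    diagonal choice gives functions that converge uniformly on A to f
    translated by w + u. *)
Lemma translate_comp chi A w psi B u th : prec chi A -> admissible A w -> admissible A (w + u) ->
  is_translate chi w psi -> prec psi B -> admissible B u ->
  (forall y, A y -> exists2 y', B y' & val y' = val y + w) ->
  is_translate psi u th -> is_translate chi (w + u) th.
Proof.
move=> cA gw gwu tw pB gu AB tu.
have [th' t'] := translate_ex cA gwu.
suff -> : th = th' by [].
apply: Mb_ext => f.
have e0 (n : nat) : 0 < n.+1%:R^-1 :> R by rewrite invr_gt0 ltr0n.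
(* h approximates the n-th Taylor sum both under the functionals and on A *)
have ap n : exists h : Hb, rnorm (chi h - psi (taylor_sum f u n)) <= n.+1%:R^-1 /\
    forall y, A y -> rnorm (h y - extend0 (taylor_sum f u n) (val y + w)) <= n.+1%:R^-1.
  have [N1 h1] := translate_taylor_sum (taylor_sum f u n) tw (e0 n).
  have [N2 h2] := taylor_sum_unif (taylor_sum f u n) gw (e0 n).
  exists (taylor_sum (taylor_sum f u n) w (maxn N1 N2)); split; first exact: h1 (leq_maxl _ _).
  exact: h2 (leq_maxr _ _).
have [h hh] := choice ap.
have small (e : R) : 0 < e -> exists N, forall n, (N <= n)%N -> n.+1%:R^-1 <= e.
  move=> e1; exists (Num.bound e^-1) => n Nn.
  rewrite invf_ple ?posrE ?ltr0n// ltW// (lt_le_trans (archi_boundP _))//.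
    by rewrite invr_ge0 ltW.
  by rewrite ler_nat (leq_trans Nn).
have uh : unif_on A h (fun y => extend0 f (val y + (w + u))).
  move=> e e1; have e20 : 0 < e / 2 by rewrite divr_gt0.
  have [N1 h1] := small _ e20; have [N2 h2] := taylor_sum_unif f gu e20.
  exists (maxn N1 N2) => n; rewrite geq_max => /andP[n1 n2] y Ay.
  have [y' By' E] := AB y Ay.
  have q2 := h2 n n2 y' By'; have q1 := (hh n).2 y Ay; have q0 := h1 n n1.
  rewrite -E extend0_val in q1; rewrite addrA -E.
  have q3 := rnormD (h n y - taylor_sum f u n y') (taylor_sum f u n y' - extend0 f (val y' + u)).
  rewrite addrA subrK in q3; apply: (le_trans q3).
  by rewrite [e]splitr lerD// (le_trans q1).
apply: clim_uniq _ (translate_unif_on cA gwu t' uh) => e e1.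
have e20 : 0 < e / 2 by rewrite divr_gt0.
have [N1 h1] := small _ e20; have [N2 h2] := translate_taylor_sum f tu e20.
exists (maxn N1 N2) => n; rewrite geq_max => /andP[n1 n2].
have q3 := rnormD (chi (h n) - psi (taylor_sum f u n)) (psi (taylor_sum f u n) - th f).
rewrite addrA subrK in q3; apply: (le_trans q3).
rewrite [e]splitr lerD//; last exact: h2.
exact: le_trans (hh n).1 (h1 n n1).
Qed.

Lemma translate0 chi A : prec chi A -> admissible A 0 -> is_translate chi 0 chi.
Proof.
move=> cA g0; have [psi tr] := translate_ex cA g0.
suff E : psi = chi by rewrite E in tr.
apply: Mb_ext => f; apply: clim_uniq (translate_unif_on (f := f) (h := fun=> f) cA g0 tr _) _.
  move=> e e0; exists 0%N => n _ y Ay; rewrite addr0 extend0_val subrr rnorm0.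
  exact: ltW.
by move=> e e0; exists 0%N => n _; rewrite subrr rnorm0 ltW.
Qed.

End translation.

(** * Truncations and diagonal polynomials *)
Section lp_geometry.
Context (R : realType) (p : nat) (p1 : (1 < p)%N).
Local Notation lp := (lp R p1).
Local Notation C := R[i].
Implicit Types (x y v : lp).

Let p0 : (0 < p)%N. Proof. exact: ltnW. Qed.

Lemma rnorm_lp x : rnorm x = lp_norm p x.
Proof. by rewrite /rnorm lp_normE. Qed.

Lemma rnorm_lpX x : rnorm x ^+ p = limn (lp_series p x).
Proof. by rewrite rnorm_lp lp_normX//; exact: lp_seqP. Qed.

Lemma lp_series_le_rnorm x n : lp_series p x n <= rnorm x ^+ p.
Proof. by rewrite rnorm_lpX; apply: lp_series_le; exact: lp_seqP. Qed.

Lemma cvg_lp_series x : lp_series p x @ \oo --> rnorm x ^+ p.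
Proof. by rewrite rnorm_lpX; have /asboolP := lp_seqP x. Qed.

Lemma lp_addE x y k : (x + y) k = x k + y k.
Proof. by []. Qed.

Lemma lp_oppE x k : (- x) k = - x k.
Proof. by []. Qed.

Lemma lp_scaleE (c : C) x k : (c *: x) k = c * x k.
Proof. by []. Qed.

Lemma lp_ext x y : (forall k, x k = y k) -> x = y.
Proof. by move=> H; apply: val_inj; apply/funext. Qed.

Lemma ler_of_exprn (a b : R) : 0 <= a -> 0 <= b -> a ^+ p <= b ^+ p -> a <= b.
Proof. by move=> a0 b0; rewrite ler_pXn2r. Qed.

Lemma coord_le x k : rnorm (x k) <= rnorm x.
Proof.
apply: (ler_of_exprn (rnorm_ge0 _) (rnorm_ge0 _)).
apply: le_trans (lp_series_le_rnorm x k.+1).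
rewrite /lp_series seriesSr lerDr sumr_ge0// => i _.
by rewrite exprn_ge0// rnorm_ge0.
Qed.

Lemma rnorm_disjoint x y : (forall k, x k = 0 \/ y k = 0) ->
  rnorm (x + y) ^+ p = rnorm x ^+ p + rnorm y ^+ p.
Proof.
move=> H; apply: (cvg_unique _ (@cvg_lp_series (x + y))) => //.
have -> : lp_series p (x + y) = lp_series p x \+ lp_series p y.
  apply/funext => n; rewrite /lp_series /series/= -big_split/=.
  apply: eq_bigr => k _.
  change (rnorm (x k + y k) ^+ p = rnorm (x k) ^+ p + rnorm (y k) ^+ p).
  by have [->|->] := H k; rewrite ?add0r ?addr0 rnorm0 expr0n gtn_eqF// ?add0r ?addr0.
by apply: cvgD; exact: cvg_lp_series.
Qed.

Definition truncate_def M v : lp := \sum_(0 <= k < M) v k *: lp_basis R p1 k.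
Definition truncate := locked truncate_def.

Lemma truncate_coord M v k : truncate M v k = if (k < M)%N then v k else 0.
Proof.
rewrite /truncate -lock /truncate_def; elim: M => [|M IH]; first by rewrite big_geq.
have E : (\sum_(0 <= k < M.+1) v k *: lp_basis R p1 k) k =
    (\sum_(0 <= k < M) v k *: lp_basis R p1 k) k + v M * (k == M)%:R.
  by rewrite big_nat_recr.
rewrite E IH ltnS.
case: (ltngtP k M) => [_|_|->]; first by rewrite mulr0 addr0.
  by rewrite mulr0 addr0.
by rewrite mulr1 add0r.
Qed.

Lemma rnorm_truncateX M v : rnorm (truncate M v) ^+ p = lp_series p v M.
Proof.
apply: (cvg_unique _ (@cvg_lp_series (truncate M v))) => //.
apply: cvg_near_cst; exists M => // n /= Mn.
rewrite /lp_series /series/= (big_cat_nat (n := M))//= [X in _ + X]big1_seq ?addr0.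
  by apply: eq_big_nat => k /andP[_ kM]; rewrite truncate_coord kM.
move=> k; rewrite mem_index_iota => /andP[_ /andP[Mk _]].
by rewrite truncate_coord ltnNge Mk rnorm0 expr0n gtn_eqF.
Qed.

Lemma truncate_tailX M v : rnorm (truncate M v) ^+ p + rnorm (v - truncate M v) ^+ p = rnorm v ^+ p.
Proof.
rewrite -rnorm_disjoint; first by rewrite addrC subrK.
move=> k; rewrite lp_addE lp_oppE truncate_coord.
by case: ifP => _; [right; rewrite subrr|left].
Qed.

Lemma rnorm_truncate M v : rnorm (truncate M v) <= rnorm v.
Proof.
apply: (ler_of_exprn (rnorm_ge0 _) (rnorm_ge0 _)).
exact: (eq_ind_r (fun z => z <= _) (lp_series_le_rnorm v M) (rnorm_truncateX M v)).
Qed.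

Lemma tail_small v (e : R) : 0 < e -> exists M0, forall M, (M0 <= M)%N ->
  rnorm (v - truncate M v) <= e.
Proof.
move=> e0; have /cvgrPdist_le/(_ (e ^+ p))[|M0 _ hM] := @cvg_lp_series v.
  by rewrite exprn_gt0.
have aux (a b c : R) : a + b = c -> c - a = b by move=> <-; rewrite addrAC subrr add0r.
exists M0 => M /hM /=; rewrite -rnorm_truncateX (aux _ _ _ (truncate_tailX M v)) => h.
exact: (ler_of_exprn (rnorm_ge0 _) (ltW e0) (le_trans (ler_norm _) h)).
Qed.

Lemma truncate_line M (z u : lp) (c : C) : truncate M (z + c *: u) = truncate M z + c *: truncate M u.
Proof.
apply: lp_ext => k; rewrite lp_addE lp_scaleE !truncate_coord lp_addE lp_scaleE.
by case: ifP => // _; rewrite mulr0 addr0.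
Qed.

(** Partial sums of the p-homogeneous polynomial with the diagonal coefficients
    c; that p is a natural number makes them holomorphic. *)
Definition diag_sum (c : nat -> C) m y : C := \sum_(0 <= k < m) c k * y k ^+ p.

Lemma coord_differentiable k x : differentiable (fun y : lp => y k) x.
Proof.
have [] // := @eps_diff R lp (fun y => y k) x (fun y => y k) 1.
- by move=> h; rewrite mul1r coord_le.
- move=> e e0; exists 1 => // h _.
  by rewrite lp_addE addrAC addrK subrr rnorm0 mulr_ge0 ?rnorm_ge0// ltW.
Qed.

Lemma diag_sum_differentiable c m x : differentiable (diag_sum c m) x.
Proof.
elim: m => [|m IH].
  rewrite (_ : diag_sum c 0 = cst 0); first exact: differentiable_cst.
  by apply/funext => y; rewrite /diag_sum big_geq.
rewrite (_ : diag_sum c m.+1 = diag_sum c m + c m *: (fun y : lp => y m ^+ p)).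
  apply: differentiableD; first exact: IH.
  apply: differentiableZ.
  have dX n : differentiable (fun y : lp => y m ^+ n) x.
    elim: n => [|n IHn].
      rewrite (_ : (fun _ => _) = cst 1); first exact: differentiable_cst.
      by apply/funext => y; rewrite expr0.
    rewrite (_ : (fun _ => _) = (fun y : lp => y m) * (fun y : lp => y m ^+ n)).
      by apply: differentiableM; [exact: coord_differentiable|exact: IHn].
    by apply/funext => y; rewrite exprS.
  exact: dX.
by apply/funext => y; rewrite /diag_sum big_nat_recr.
Qed.

Section diagonal.
Variable (c : nat -> C).
Hypothesis c1 : forall k, rnorm (c k) <= 1.

Lemma diag_term_le y k : rnorm (c k * y k ^+ p) <= rnorm (y k) ^+ p.
Proof.
by rewrite cnormM cnormX ler_piMl// exprn_ge0// rnorm_ge0.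
Qed.

Lemma diag_sum_le m y : rnorm (diag_sum c m y) <= rnorm y ^+ p.
Proof.
apply: le_trans (lp_series_le_rnorm y m).
rewrite /diag_sum (le_trans (cnorm_sum _ _ _))// /lp_series /series/=.
by apply: ler_sum => k _; exact: diag_term_le.
Qed.

Lemma diag_ex : exists P : lp -> C, forall y, clim (fun m => diag_sum c m y) (P y).
Proof.
suff H y : exists l, clim (fun m => diag_sum c m y) l by have [P hP] := choice H; exists P.
apply: clim_cauchy => e e0.
have e20 : 0 < e / 2 by rewrite divr_gt0.
have /cvgrPdist_le/(_ _ e20)[N _ hN] := @cvg_lp_series y.
have key n m : (N <= n)%N -> (n <= m)%N -> rnorm (diag_sum c m y - diag_sum c n y) <= e.
  move=> Nn nm; rewrite /diag_sum (big_cat_nat (n := n) (leq0n n) nm)/= addrAC subrr add0r.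
  rewrite (le_trans (cnorm_sum _ _ _))//.
  apply: (@le_trans _ _ (\sum_(n <= k < m) rnorm (y k) ^+ p)).
    by apply: ler_sum => k _; exact: diag_term_le.
  have -> : \sum_(n <= k < m) rnorm (y k) ^+ p = lp_series p y m - lp_series p y n.
    by rewrite /lp_series /series/= (big_cat_nat (n := n) (leq0n n) nm)/= addrAC subrr add0r.
  have h1 := hN n Nn; have h2 := hN m (leq_trans Nn nm).
  have := ler_norm (rnorm y ^+ p - lp_series p y n).
  have := lp_series_le_rnorm y m.
  by move: h1 => /=; move: e0; lra.
exists N => n m Nn Nm; have [nm|/ltnW mn] := leqP n m; last exact: key.
by rewrite rnormBC key.
Qed.

Variable P : lp -> C.
Hypothesis hP : forall y, clim (fun m => diag_sum c m y) (P y).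

Lemma diag_le y : rnorm (P y) <= rnorm y ^+ p.
Proof.
apply: (clim_bound (hP y)) => e e0; exists 0%N => n _.
by rewrite (le_trans (diag_sum_le n y))// lerDl ltW.
Qed.

Lemma diag_differentiable x : differentiable P x.
Proof.
apply: (@differentiable_clim R lp (diag_sum c) P x 1 ((rnorm x + 1) ^+ p) ltr01).
- by move=> n y _; exact: diag_sum_differentiable.
- move=> n y yx; rewrite (le_trans (diag_sum_le n y))//.
  apply: lerXn2r; rewrite ?nnegrE ?addr_ge0 ?rnorm_ge0//.
  have := rnormD (y - x) x; rewrite subrK => h.
  by apply: (le_trans h); rewrite [leRHS]addrC lerD2r ltW.
- by move=> y _; exact: hP.
Qed.

Lemma diag_lip y t : rnorm t <= 1 -> rnorm (P (y + t) - P y) <= 2 * (rnorm y + 4) ^+ p * rnorm t.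
Proof.
move=> t1.
have [||||_ h] := @cauchy_remainder R lp P y 4 ((rnorm y + 4) ^+ p) _ _ _ t.
- by rewrite ltr0n.
- by move=> z _; exact: diag_differentiable.
- move=> z zy; rewrite (le_trans (diag_le z))//.
  apply: lerXn2r; rewrite ?nnegrE ?addr_ge0 ?rnorm_ge0//.
  have := rnormD (z - y) y; rewrite subrK => h.
  by apply: (le_trans h); rewrite [leRHS]addrC lerD2r ltW.
- by rewrite divff.
rewrite (le_trans h)// ler_wpM2r ?rnorm_ge0// le_eqVlt; apply/orP; left; apply/eqP.
by generalize ((rnorm y + 4) ^+ p) => a; field.
Qed.

Lemma diag_eq y : (forall k, c k * y k ^+ p = (rnorm (y k) ^+ p)%:C) -> P y = (rnorm y ^+ p)%:C.
Proof.
move=> H; apply: clim_uniq (hP y) _ => e e0.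
have /cvgrPdist_le/(_ e e0)[N _ hN] := @cvg_lp_series y.
exists N => n /hN; rewrite distrC => h.
have -> : diag_sum c n y = (lp_series p y n)%:C.
  rewrite /lp_series /series/= rmorph_sum/=.
  by apply: eq_bigr => k _; rewrite H.
by rewrite -rmorphB/= cnormR.
Qed.

End diagonal.

(** The coefficient that turns a ^ p into its modulus; for a = 0 it is 0. *)
Definition phase (a : C) : C := (rnorm a ^+ p)%:C / a ^+ p.

Lemma phase_le1 a : rnorm (phase a) <= 1.
Proof.
rewrite /phase cnormM cnormV cnormX cnormR ger0_norm ?exprn_ge0 ?rnorm_ge0//.
have [->|a0] := eqVneq a 0; first by rewrite rnorm0 expr0n gtn_eqF// mulr0n mul0r ler01.
by rewrite divff// expf_neq0// gt_eqF// rnorm_gt0.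
Qed.

Lemma phaseE a : phase a * a ^+ p = (rnorm a ^+ p)%:C.
Proof.
have [->|a0] := eqVneq a 0; first by rewrite rnorm0 !expr0n gtn_eqF// mulr0n mulr0.
by rewrite /phase divfK// expf_neq0.
Qed.

End lp_geometry.

(** * Block sequences *)
Section blocks.
Context (R : realType) (p : nat) (p1 : (1 < p)%N).
Local Notation lp := (lp R p1).
Local Notation Hb := (Hb R p1).
Local Notation Mb := (Mb R p1).
Local Notation C := R[i].
Implicit Types (v z u : lp).

Let p0 : (0 < p)%N. Proof. exact: ltnW. Qed.

Lemma coord_sum (s : seq nat) (alpha : nat -> C) j : uniq s ->
  (\sum_(k <- s) alpha k *: lp_basis R p1 k) j = if j \in s then alpha j else 0.
Proof.
elim: s => [|k s IH] /=; first by rewrite big_nil.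
move=> /andP[ks us].
have -> : (\sum_(i <- k :: s) alpha i *: lp_basis R p1 i) j =
  alpha k * (j == k)%:R + (\sum_(i <- s) alpha i *: lp_basis R p1 i) j.
  by rewrite big_cons.
rewrite (IH us) in_cons; case: eqP => [->|_] /=; last by rewrite mulr0 add0r.
by rewrite (negPf ks) mulr1 addr0.
Qed.

(** The n-th of a sequence of non-empty successive subsets of nat has all its
    elements at least n. *)
Lemma block_support (X : nat -> lp) : block_sequence X ->
  (forall n k, (k < n)%N -> X n k = 0) /\
  (forall n m k, n != m -> X n k = 0 \/ X m k = 0).
Proof.
move=> [J [alpha [J0 JS XE]]].
have XkE n k : X n k = if k \in J n then alpha k else 0.
  by rewrite XE coord_sum// fset_uniq.
have Jn n : exists k, k \in J n by apply/fset0Pn; exact: J0.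
have Jge n k : k \in J n -> (n <= k)%N.
  elim: n k => [//|n IH] k kJ; have [j jJ] := Jn n.
  exact: leq_ltn_trans (IH j jJ) (JS n j k jJ kJ).
have Jlt n m j k : (n < m)%N -> j \in J n -> k \in J m -> (j < k)%N.
  elim: m k => [//|m IH] k; rewrite ltnS leq_eqVlt => /predU1P[->|nm] jJ kJ.
    exact: JS jJ kJ.
  have [i iJ] := Jn m.
  exact: ltn_trans (IH i nm jJ iJ) (JS m i k iJ kJ).
split=> [n k kn|n m k nm].
  by rewrite XkE; case: ifP => // /Jge; rewrite leqNgt kn.
rewrite !XkE; case: ifP => kn; last by left.
case: ifP => km; last by right.
by case: (ltngtP n m) nm => // h _; [have := Jlt _ _ _ _ h kn km|have := Jlt _ _ _ _ h km kn]; rewrite ltnn.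
Qed.

Section geometry.
Variables (X : nat -> lp) (r : R).
Hypotheses (X0 : forall n k, (k < n)%N -> X n k = 0)
  (Xdisj : forall n m k, n != m -> X n k = 0 \/ X m k = 0)
  (Xr : forall n, rnorm (X n) = r).

Lemma block_truncateX n M v : (M <= n)%N ->
  rnorm (X n + truncate M v) ^+ p = r ^+ p + rnorm (truncate M v) ^+ p.
Proof.
move=> Mn; have D k : X n k = 0 \/ truncate M v k = 0.
  by rewrite truncate_coord; case: ifP => kM; [left; rewrite X0// (leq_trans kM)|right].
transitivity (rnorm (X n) ^+ p + rnorm (truncate M v) ^+ p); first exact: rnorm_disjoint D.
by rewrite (Xr n).
Qed.

Lemma block_norm_le n M v (s : R) : (M <= n)%N -> 0 <= s ->
  r ^+ p + rnorm v ^+ p <= s ^+ p ->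
  rnorm (X n + v) <= s + rnorm (v - truncate M v).
Proof.
move=> Mn s0 rs.
have E : X n + v = (X n + truncate M v) + (v - truncate M v) by rewrite addrA addrAC addrK addrC.
rewrite {1}E; apply: le_trans (rnormD _ _) _; rewrite lerD2r.
apply: (ler_of_exprn p1 (rnorm_ge0 _) s0); rewrite (block_truncateX v Mn).
apply: le_trans rs; rewrite lerD2l.
exact: (lerXn2r p (rnorm_ge0 _) (rnorm_ge0 _) (rnorm_truncate M v)).
Qed.

(** The error made by truncating z + c u is bounded uniformly for |c| <= rho,
    so one N serves for all c. *)
Lemma block_line_le z u (rho s : R) : 0 <= s < 1 -> 0 <= rho ->
  (forall c : C, rnorm c <= rho -> r ^+ p + rnorm (z + c *: u) ^+ p <= s ^+ p) ->
  exists N, forall n, (N <= n)%N -> forall c : C, rnorm c <= rho ->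
    rnorm (X n + (z + c *: u)) <= (1 + s) / 2.
Proof.
move=> /andP[s0 s1] rho0 H; pose d := (1 - s) / 4.
have d0 : 0 < d by rewrite divr_gt0// subr_gt0.
have sd : s + (d + d) <= (1 + s) / 2 by rewrite /d; lra.
have r1 : 0 < rho + 1 by rewrite ltr_wpDl.
have [N1 h1] := tail_small z d0; have [N2 h2] := tail_small u (divr_gt0 d0 r1).
exists (maxn N1 N2) => n; rewrite geq_max => /andP[n1 n2] c cr.
have h := block_norm_le (leqnn n) s0 (H c cr).
apply: (le_trans h).
have E : z + c *: u - truncate n (z + c *: u) = (z - truncate n z) + c *: (u - truncate n u).
  by rewrite truncate_line opprD addrACA scalerBr.
rewrite E.
have b1 := h1 n n1.
have b2 : rnorm (c *: (u - truncate n u)) <= d.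
  rewrite rnormZ; apply: (@le_trans _ _ (rho * (d / (rho + 1)))).
    by apply: ler_pM; rewrite ?rnorm_ge0// h2.
  by rewrite mulrA ler_pdivrMr// mulrC ler_wpM2l ?(ltW d0)// lerDl.
have b3 := le_trans (rnormD _ _) (lerD b1 b2).
apply: (@le_trans _ _ (s + (d + d))); first by rewrite lerD2l.
exact: sd.
Qed.

(** On the first M coordinates the coefficients are matched to v, on the others
    to the blocks; this is consistent since at most one block is non-zero at a
    given coordinate. For n >= M the polynomial then takes at X n + truncate M
    v exactly the value r^p + ||truncate M v||^p, and the tail of v changes
    both sides by little. *)
Lemma block_poly v (e : R) : 0 < e ->
  exists P : lp -> C, [/\ forall y, differentiable P y,
    forall y, rnorm (P y) <= rnorm y ^+ p &
    exists N, forall n, (N <= n)%N ->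
      rnorm (P (X n + v) - (r ^+ p + rnorm v ^+ p)%:C) <= e].
Proof.
move=> e0.
have r0 : 0 <= r by rewrite -(Xr 0) rnorm_ge0.
pose K := 2 * (r + rnorm v + 4) ^+ p.
have rv4 : 0 < r + rnorm v + 4 by rewrite ltr_wpDl ?addr_ge0 ?rnorm_ge0.
have K0 : 0 < K by rewrite mulr_gt0// exprn_gt0.
pose t := Num.min 1 (Num.min (e / 2) (e / 2 / K)).
have t0 : 0 < t by rewrite !lt_min ltr01 !divr_gt0.
have t1 : t <= 1 by rewrite /t ge_min lexx.
have te : t <= e / 2 by rewrite /t !ge_min lexx orbT.
have tK : K * t <= e / 2.
  by rewrite mulrC -ler_pdivlMr// /t !ge_min lexx !orbT.
have [M hM] := tail_small v t0.
have {hM} tau := hM M (leqnn M).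
(* a k is the only non-zero value at the coordinate k among all blocks *)
have ex k : exists a : C, forall n, X n k != 0 -> X n k = a.
  have [[m mk]|no] := pselect (exists m, X m k != 0).
    exists (X m k) => n nk; have [->//|nm] := eqVneq n m.
    by have [h|h] := Xdisj k nm; [rewrite h eqxx in nk|rewrite h eqxx in mk].
  by exists 0 => n nk; exfalso; apply: no; exists n.
have [a ha] := choice ex.
have [c [cE c1]] : exists c : nat -> C,
    (forall k, c k = phase p (if (k < M)%N then v k else a k)) /\ forall k, rnorm (c k) <= 1.
  by eexists; split=> [k|k]; [reflexivity|exact: phase_le1].
have [P hP] := diag_ex p1 c1.
exists P; split=> [y|y|].
- exact: (@diag_differentiable R p p1 c c1 P hP y).
- exact: (@diag_le R p p1 c c1 P hP y).
exists M => n Mn.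
set y := X n + truncate M v; set tl := v - truncate M v.
have E : X n + v = y + tl by rewrite /y /tl addrA addrAC addrK addrC.
have Py : P y = (r ^+ p + rnorm (truncate M v) ^+ p)%:C.
  have -> : r ^+ p + rnorm (truncate M v) ^+ p = rnorm y ^+ p by exact: esym (block_truncateX v Mn).
  apply: (@diag_eq R p p1 c P hP y) => k; rewrite /y lp_addE truncate_coord cE; case: ifP => kM.
    by rewrite X0 ?add0r ?phaseE// (leq_trans kM).
  rewrite addr0; have [->|nz] := eqVneq (X n k) 0.
    by rewrite rnorm0 !expr0n gtn_eqF// mulr0n mulr0.
  by rewrite -(ha k n nz) phaseE.
have tl1 : rnorm tl <= 1 := le_trans tau t1.
have yn : rnorm y <= r + rnorm v.
  apply: le_trans (rnormD _ _) _; rewrite Xr lerD2l; exact: rnorm_truncate.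
have lip : rnorm (P (y + tl) - P y) <= e / 2.
  apply: (le_trans (@diag_lip R p p1 c c1 P hP y tl tl1)); apply: le_trans tK.
  apply: ler_pM => //; rewrite ?rnorm_ge0//.
    by rewrite mulr_ge0// exprn_ge0// addr_ge0// rnorm_ge0.
  rewrite /K ler_wpM2l//; apply: lerXn2r; rewrite ?nnegrE ?(ltW rv4)//.
    by rewrite addr_ge0// rnorm_ge0.
  by rewrite lerD2r.
have hd : rnorm (P y - (r ^+ p + rnorm v ^+ p)%:C) <= e / 2.
  have aux (A B D F : R) : B + D = F -> A + B - (A + F) = - D by move=> <-; ring.
  rewrite Py -rmorphB/= cnormR (aux _ _ _ _ (truncate_tailX M v)) -/tl.
  rewrite normrN ger0_norm; last by rewrite exprn_ge0// rnorm_ge0.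
  apply: le_trans te; apply: le_trans tau.
  rewrite -[leRHS]expr1; apply: ler_wiXn2l; rewrite ?rnorm_ge0//.
have -> : P (X n + v) - (r ^+ p + rnorm v ^+ p)%:C =
   (P (y + tl) - P y) + (P y - (r ^+ p + rnorm v ^+ p)%:C).
  by rewrite E [RHS]addrA subrK.
by apply: le_trans (rnormD _ _) _; rewrite [e]splitr lerD.
Qed.

End geometry.
End blocks.

(** * Sheets *)
Section sheets.
Context (R : realType) (p : nat) (p1 : (1 < p)%N).
Local Notation lp := (lp R p1).
Local Notation Hb := (Hb R p1).
Local Notation Mb := (Mb R p1).
Local Notation C := R[i].
Implicit Types (v z u w : lp) (chi psi th : Mb) (A : set (uball R p1)).

Let p0 : (0 < p)%N. Proof. exact: ltnW. Qed.

Lemma lerX_nneg (a b : R) n : 0 <= a -> a <= b -> a ^+ n <= b ^+ n.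
Proof. by move=> a0 ab; apply: lerXn2r => //; exact: le_trans ab. Qed.

Definition translate_set A w : set (uball R p1) := [set y' | exists2 y, A y & val y' = val y + w].

Lemma translate_set_ex A w y : rnorm (val y + w) < 1 -> A y -> exists2 y', translate_set A w y' & val y' = val y + w.
Proof. by move=> h Ay; exists (pt_ball h) => //; exists y. Qed.

Lemma translate_prec_set chi A w psi : prec chi A -> admissible A w -> is_translate chi w psi ->
  prec psi (translate_set A w).
Proof.
move=> cA gA tr; apply: (translate_prec cA gA tr) => y Ay.
exact: translate_set_ex (admissible_lt1 gA Ay) Ay.
Qed.

Lemma dilation_room (s t : R) : 0 < s -> 0 <= t -> s + t < 1 ->
  exists rho : R, [/\ 1 < rho, 0 <= s + rho * t & s + rho * t < 1].
Proof.
move=> s0 t0 st; pose h := (1 - s - t) / 2.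
have h0 : 0 < h by rewrite divr_gt0//; lra.
have ht : h * t <= h by rewrite ler_piMr ?(ltW h0)//; lra.
exists (1 + h); split; first by rewrite ltrDl.
  by rewrite addr_ge0 ?mulr_ge0 ?addr_ge0 ?(ltW h0) ?(ltW s0).
by move: ht; rewrite /h; lra.
Qed.

Lemma admissible_sball (s : R) w : 0 < s -> s + rnorm w < 1 -> admissible (@sball R p p1 s) w.
Proof.
move=> s0 sw; have [rho [rho1 _ s1]] := dilation_room s0 (rnorm_ge0 w) sw.
exists rho, (s + rho * rnorm w); split; [exact: rho1|exact: s1|].
move=> y /sballP ys c cr.
apply: (le_trans (rnormD _ _)); apply: lerD (ltW ys) _.
by rewrite rnormZ ler_wpM2r// rnorm_ge0.
Qed.

Lemma translate_sball chi (s : R) w psi : 0 < s -> s + rnorm w < 1 -> prec chi (sball s) ->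
  is_translate chi w psi -> prec psi (sball (s + rnorm w)).
Proof.
move=> s0 sw cs tr; have gs := admissible_sball s0 sw.
apply: (translate_prec cs gs tr) => y ys.
exists (pt_ball (admissible_lt1 gs ys)) => //; apply/sballP => /=.
apply: le_lt_trans (rnormD _ _) _; rewrite ltrD2r; exact: (sballP _ _).1.
Qed.

(** No block structure is involved: the room needed is provided by the ball
    that dominates chi. *)
Lemma translate_add chi (s : R) w u psi th : 0 < s -> s + rnorm w + rnorm u < 1 ->
  prec chi (sball s) -> is_translate chi w psi -> is_translate psi u th ->
  is_translate chi (w + u) th.
Proof.
move=> s0 swu cs tw tu.
have w0 := rnorm_ge0 w; have u0 := rnorm_ge0 u.
have sw : s + rnorm w < 1 by apply: le_lt_trans swu; rewrite lerDl.
have gw := admissible_sball s0 sw.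
have gwu : admissible (@sball R p p1 s) (w + u).
  apply: (admissible_sball s0); apply: le_lt_trans swu.
  by rewrite -addrA lerD2l rnormD.
have ps := translate_sball s0 sw cs tw.
have gu : admissible (@sball R p p1 (s + rnorm w)) u.
  exact: (admissible_sball (ltr_wpDr w0 s0) swu).
apply: (translate_comp cs gw gwu tw ps gu _ tu) => y ys.
exists (pt_ball (admissible_lt1 gw ys)) => //; apply/sballP => /=.
apply: le_lt_trans (rnormD _ _) _; rewrite ltrD2r; exact: (sballP _ _).1.
Qed.

Lemma Mb_base_open (U : set Mb) : Mb_base U -> open U.
Proof.
move=> bU; exists [set U]; last by rewrite bigcup_set1.
by move=> _ ->; exact: finI_from1.
Qed.

Lemma basic_nbhd_open chi (s e : R) : 0 < s < 1 -> prec chi (sball s) -> 0 < e < 1 - s ->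
  open (basic_nbhd chi e).
Proof. by move=> s01 cs e0; apply: Mb_base_open; exists chi, s, e. Qed.

Lemma basic_nbhd_refl chi (s e : R) : 0 < s < 1 -> prec chi (sball s) -> 0 < e ->
  basic_nbhd chi e chi.
Proof.
move=> /andP[s0 s1] cs e0; exists 0; first by rewrite normr0 ltcR.
by apply: translate0 cs _; apply: (admissible_sball s0); rewrite rnorm0 addr0.
Qed.

(** The open sets are unions of finite intersections of basic neighbourhoods,
    so it suffices to test the latter. *)
Lemma cvg_Mb_base (T : topologicalType) (F : T -> Mb) (t : T) :
  (forall U : set Mb, Mb_base U -> U (F t) -> nbhs t (F @^-1` U)) -> F @ t --> F t.
Proof.
move=> H V [/= X [[/= B + <-] [W BW Wt BV]]] => /(_ W BW) [/= D DM DW].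
have : nbhs t (F @^-1` W).
  rewrite -DW preimage_bigcap; apply: filter_bigI => U UD.
  apply: H; first by have := DM U UD; rewrite inE.
  by have := Wt; rewrite -DW; apply.
by apply: filterS => y Wy; apply: BV; exists W.
Qed.

Lemma ptws_ball (F0 : Hb -> C) (f : Hb) (e : R) : 0 < e ->
  nbhs (F0 : {ptws Hb -> C}) [set F | rnorm (F0 f - F f) < e].
Proof.
move=> e0.
have cp := @proj_continuous Hb (fun=> C) f F0.
have nb : nbhs (F0 f) [set y : C | rnorm (F0 f - y) < e].
  apply/nbhs_ballP; exists e%:C => /=; first by rewrite ltcR.
  by move=> y; rewrite -ball_normE/= -rnormE ltcR.
exact: (cp _ nb).
Qed.

Section block.
Variables (r : R) (phi : Mb) (x : nat -> uball R p1).
Hypotheses (r01 : 0 < r < 1) (bx : block_sequence (fun n => val (x n)))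
  (xr : forall n, rnorm (val (x n)) = r)
  (cx : cluster ((fun n => (fun f : Hb => f (x n)) : {ptws Hb -> R[i]}) @ \oo) (Mb_fun phi)).

Let X n : lp := val (x n).
Let X0 : forall n k, (k < n)%N -> X n k = 0.
Proof. by have [] := block_support bx. Qed.
Let Xdisj : forall n m k, n != m -> X n k = 0 \/ X m k = 0.
Proof. by have [] := block_support bx. Qed.
Let r0 : 0 <= r. Proof. by case/andP: r01 => /ltW. Qed.

Definition block_tail N : set (uball R p1) := [set y | exists2 n, (N <= n)%N & y = x n].

Lemma block_prec N : prec phi (block_tail N).
Proof.
apply/prec_le => f c fc; rewrite leNgt; apply/negP => h.
pose e := rnorm (phi f) - c; have e0 : 0 < e by rewrite subr_gt0.
pose B := [set F : {ptws Hb -> C} | rnorm (phi f - F f) < e].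
have nB : nbhs (Mb_fun phi : {ptws Hb -> C}) B := ptws_ball (Mb_fun phi) f e0.
pose A := [set F : {ptws Hb -> C} | exists2 n, (N <= n)%N & F = fun g : Hb => g (x n)].
have nA : ((fun n => (fun f : Hb => f (x n)) : {ptws Hb -> R[i]}) @ \oo) A.
  by exists N => // n /= Nn; exists n.
have [_ [[n Nn ->] h2]] := cx nA nB.
have {}h2 : rnorm (phi f - f (x n)) < e := h2.
have h3 : rnorm (f (x n)) <= c by apply: fc; exists n.
have h4 := rnormD (phi f - f (x n)) (f (x n)); rewrite subrK in h4.
by have := le_lt_trans h4 (ltr_leD h2 h3); rewrite /e subrK ltxx.
Qed.

Lemma root_lt1 (t : R) : 0 <= t < 1 -> exists2 T : R, 0 <= T < 1 & T ^+ p = t.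
Proof.
move=> /andP[t0 t1]; pose T := t `^ p%:R^-1.
have TE : T ^+ p = t.
  by rewrite /T -powR_mulrn ?powR_ge0// -powRrM mulVf ?powRr1// pnatr_eq0 -lt0n.
exists T => //; rewrite powR_ge0/= ltNge; apply/negP => T1.
by move: t1; rewrite ltNge -TE exprn_ege1.
Qed.

Lemma block_tail_line z u (rho s : R) : 0 <= s < 1 -> 1 < rho ->
  (forall c : C, rnorm c <= rho -> r ^+ p + rnorm (z + c *: u) ^+ p <= s ^+ p) ->
  exists N0, forall N, (N0 <= N)%N -> forall y, block_tail N y -> forall c : C, rnorm c <= rho ->
    rnorm (val y + z + c *: u) <= (1 + s) / 2.
Proof.
move=> s01 rho1 H; have rho0 : 0 <= rho by rewrite ltW// (lt_trans ltr01).
have [N0 h0] := block_line_le X0 xr s01 rho0 H.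
exists N0 => N NN _ [n Nn ->] c cr; rewrite -addrA.
exact: h0 (leq_trans NN Nn) c cr.
Qed.

(** If T < 1 is such that T^p = r^p + ||z||^p, then rho = 2 / (1 + T) is
    greater than 1 and rho T is still less than 1. *)
Lemma admissible_tail z : r ^+ p + rnorm z ^+ p < 1 -> exists N0, forall N, (N0 <= N)%N -> admissible (block_tail N) z.
Proof.
move=> rz.
have rp0 : 0 <= r ^+ p by rewrite exprn_ge0.
have zp0 : 0 <= rnorm z ^+ p by rewrite exprn_ge0// rnorm_ge0.
have t01 : 0 <= r ^+ p + rnorm z ^+ p < 1 by rewrite rz addr_ge0.
have [T /andP[T0 T1] TE] := root_lt1 t01.
pose rho := 2 / (1 + T); pose s := rho * T.
have T10 : 0 < 1 + T by rewrite ltr_wpDr.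
have rho1 : 1 < rho by rewrite /rho ltr_pdivlMr//; lra.
have s01 : 0 <= s < 1.
  rewrite /s /rho mulr_ge0 ?divr_ge0 ?(ltW T10)//=.
  by rewrite mulrAC ltr_pdivrMr//; lra.
have rho0 : 0 <= rho by rewrite ltW// (lt_trans ltr01).
have [|N0 h] := @block_tail_line 0 z rho s s01 rho1.
  have E : s ^+ p = rho ^+ p * (r ^+ p + rnorm z ^+ p) by rewrite /s (exprMn _ rho T) TE.
  move=> c cr; rewrite add0r rnormZ E (exprMn _ (rnorm c)) mulrDr lerD//.
    by apply: (ler_peMl rp0); apply: exprn_ege1; exact: ltW.
  by rewrite ler_wpM2r//; exact: (lerX_nneg p (rnorm_ge0 _) cr).
exists N0 => N NN; exists rho, ((1 + s) / 2); split=> //.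
  by case/andP: s01 => _; lra.
by move=> y yN c cr; have := h N NN y yN c cr; rewrite addr0.
Qed.

Lemma translate_block_ex z : r ^+ p + rnorm z ^+ p < 1 -> exists psi, is_translate phi z psi.
Proof.
move=> /admissible_tail[N0 /(_ N0 (leqnn _)) g]; exact: translate_ex (block_prec N0) g.
Qed.

(** Evaluate psi at a polynomial P of block_poly translated by u. The tail
    translated by z dominates psi, and there P (. + u) is close to the constant
    r^p + ||z + u||^p; on s B it is bounded by (s + ||u||)^p. *)
Lemma translate_block_norm z psi (s : R) u : r ^+ p + rnorm z ^+ p < 1 ->
  is_translate phi z psi -> 0 < s < 1 -> prec psi (sball s) ->
  r ^+ p + rnorm (z + u) ^+ p <= (s + rnorm u) ^+ p.
Proof.
move=> rz tr s01 ps; apply/ler_addgt0Pr => e e0.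
have [P [dP leP [N1 hN1]]] := block_poly X0 Xdisj xr (z + u) e0.
have [N0 hN0] := admissible_tail rz.
pose N := maxn N0 N1.
have gz : admissible (block_tail N) z by apply: hN0; exact: leq_maxl.
have pz := translate_prec_set (block_prec N) gz tr.
have hol : holB (fun y => P (y + u)).
  move=> y _; apply: (@differentiable_comp _ _ _ _ (fun y => y + u) P) => //.
have bnd : bndB (fun y => P (y + u)).
  move=> t _; exists ((`|t| + rnorm u) ^+ p) => y yt; apply: (le_trans (leP _)).
  apply: (lerX_nneg _ (rnorm_ge0 _)); apply: (le_trans (rnormD _ _)).
  by rewrite lerD2r; exact: le_trans yt (ler_norm t).
pose f := mkHb hol bnd.
have h1 : rnorm (psi f) <= (s + rnorm u) ^+ p.
  apply: ((prec_le _ _).1 ps) => y /sballP ys /=; apply: (le_trans (leP _)).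
  apply: (lerX_nneg _ (rnorm_ge0 _)); apply: (le_trans (rnormD _ _)).
  by rewrite lerD2r; exact: ltW.
set c := r ^+ p + rnorm (z + u) ^+ p in hN1 *.
have c0 : 0 <= c by rewrite addr_ge0// exprn_ge0// rnorm_ge0.
have h2 : rnorm (psi f - psi (c%:C *: (1 : Hb))) <= e.
  apply: (prec_close pz) => y' [_ [n Nn ->] E].
  change (rnorm (P (val y' + u) - c%:C * 1) <= e).
  rewrite E mulr1 -addrA; apply: hN1; exact: leq_trans (leq_maxr _ _) Nn.
rewrite MbZ Mb1 mulr1 in h2.
have h3 : rnorm (c%:C : C) = c by rewrite cnormR ger0_norm.
rewrite -h3 -[X in rnorm X](subKr (psi f)).
by apply: (le_trans (rnormB _ _)); rewrite lerD.
Qed.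

(** That s B dominates psi is not enough to compose the translations, for these
    take place along the tail of the blocks. The norm inequality, applied to
    all c u with |c| <= rho, transfers the room around s B to the translated
    tail. *)
Lemma translate_block_add z psi (s : R) u th : r ^+ p + rnorm z ^+ p < 1 ->
  is_translate phi z psi -> 0 < s < 1 -> prec psi (sball s) -> s + rnorm u < 1 ->
  is_translate psi u th ->
  r ^+ p + rnorm (z + u) ^+ p < 1 /\ is_translate phi (z + u) th.
Proof.
move=> rz tr /andP[s0 s1] ps su tu.
have s01 : 0 < s < 1 by rewrite s0.
have u0 := rnorm_ge0 u.
have su0 : 0 <= s + rnorm u by rewrite addr_ge0// ltW.
have rzu : r ^+ p + rnorm (z + u) ^+ p < 1.
  apply: le_lt_trans (translate_block_norm u rz tr s01 ps) _.
  by rewrite exprn_ilt1 ?gtn_eqF.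
split; first exact: rzu.
have [rho [rho1 s'0 s'1]] := dilation_room s0 u0 su.
set s' := s + rho * rnorm u in s'0 s'1.
have s'01 : 0 <= s' < 1 by rewrite s'0.
have s'h : (1 + s') / 2 < 1 by rewrite ltr_pdivrMr// mul1r -[2]/(1 + 1) ltrD2l.
have line (c : C) : rnorm c <= rho -> r ^+ p + rnorm (z + c *: u) ^+ p <= s' ^+ p.
  move=> cr; apply: le_trans (translate_block_norm (c *: u) rz tr s01 ps) _.
  apply: lerX_nneg; first by rewrite addr_ge0 ?rnorm_ge0 ?(ltW s0).
  by rewrite /s' lerD2l rnormZ ler_wpM2r.
have [N1 g1] := block_tail_line s'01 rho1 line.
have [N2 g2] := admissible_tail rz; have [N3 g3] := admissible_tail rzu.
pose N := maxn N1 (maxn N2 N3).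
have gz : admissible (block_tail N) z by apply: g2; rewrite /N !leq_max leqnn orbT.
have gzu : admissible (block_tail N) (z + u) by apply: g3; rewrite /N !leq_max leqnn !orbT.
have gu : admissible (translate_set (block_tail N) z) u.
  have N1N : (N1 <= N)%N by rewrite /N leq_maxl.
  exists rho, ((1 + s') / 2); split; [exact: rho1|exact: s'h|].
  by move=> y' [y yN ->] c cr; exact: (g1 N N1N y yN c cr).
apply: (translate_comp (block_prec N) gz gzu tr (translate_prec_set (block_prec N) gz tr) gu _ tu).
by move=> y yN; exact: translate_set_ex (admissible_lt1 gz yN) yN.
Qed.

Definition translates := [set psi | exists2 z, r ^+ p + rnorm z ^+ p < 1 & is_translate phi z psi].

Lemma quarter_room (s : R) : 0 < s < 1 -> exists e : R, [/\ 0 < e < 1 - s, 0 < e &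
  forall t, t < e -> s + t < 1 /\ s + t + t < 1].
Proof.
move=> /andP[s0 s1]; exists ((1 - s) / 4); split; [lra|lra|].
by move=> t te; split; lra.
Qed.

Lemma translates_open : open translates.
Proof.
rewrite openE => psi [z rz tr].
have [s s01 ps] := Mb_prec psi.
have [e [e1 e0 e2]] := quarter_room s01.
apply: (filterS (P := basic_nbhd psi e)); last first.
  apply: open_nbhs_nbhs; split; first exact: basic_nbhd_open s01 ps e1.
  exact: basic_nbhd_refl s01 ps e0.
move=> th [u]; rewrite normr_ltC => ue tu.
have [h1 h2] := translate_block_add rz tr s01 ps (e2 _ ue).1 tu.
by exists (z + u).
Qed.

(** If a small translate psi = chi^w of chi is a translate phi^z of phi, then
    chi = psi^(-w) = phi^(z - w). *)
Lemma translates_closed : closed translates.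
Proof.
rewrite -openC openE => chi nchi.
have [s s01 cs] := Mb_prec chi.
have [e [e1 e0 e2]] := quarter_room s01.
apply: (filterS (P := basic_nbhd chi e)); last first.
  apply: open_nbhs_nbhs; split; first exact: basic_nbhd_open s01 cs e1.
  exact: basic_nbhd_refl s01 cs e0.
move=> psi [w]; rewrite normr_ltC => we tw [z rz tr]; apply: nchi.
have /andP[s0 s1] := s01; have w0 := rnorm_ge0 w.
have [sw sww] := e2 _ we.
have ps := translate_sball s0 sw cs tw.
have sw01 : 0 < s + rnorm w < 1 by rewrite sw ltr_wpDr.
have sNw : s + rnorm w + rnorm (- w) < 1 by rewrite rnormN.
have [th tth] : exists th, is_translate psi (- w) th.
  by apply: translate_ex ps (admissible_sball _ sNw); case/andP: sw01.
have tc := translate_add s0 sNw cs tw tth; rewrite subrr in tc.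
have g0 : admissible (@sball R p p1 s) 0 by apply: (admissible_sball s0); rewrite rnorm0 addr0.
have E := is_translate_inj tc (translate0 cs g0); rewrite E in tth.
have [h1 h2] := translate_block_add rz tr sw01 ps sNw tth.
by exists (z - w).
Qed.

Lemma translate_block0 : r ^+ p + rnorm (0 : lp) ^+ p < 1 /\ is_translate phi 0 phi.
Proof.
have rp : r ^+ p < 1 by case/andP: r01 => _ r1; rewrite exprn_ilt1 ?gtn_eqF.
have rz : r ^+ p + rnorm (0 : lp) ^+ p < 1 by rewrite rnorm0 expr0n gtn_eqF// addr0.
split; first exact: rz.
have [N0 /(_ N0 (leqnn _)) g] := admissible_tail rz.
exact: translate0 (block_prec N0) g.
Qed.

Lemma translates_self : translates phi.
Proof. by have [h1 h2] := translate_block0; exists 0. Qed.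

(** The path t |-> phi^(tz), for 0 <= t <= 1, is continuous because phi^(t'z)
    is the translate of phi^(tz) by (t' - t) z. *)
Lemma translates_connected z psi : r ^+ p + rnorm z ^+ p < 1 -> is_translate phi z psi ->
  connected_component [set: Mb] phi psi.
Proof.
move=> rz tr.
(* outside of [0, 1] the path may leave the domain; any value does there *)
have ex (t : R) : exists th, r ^+ p + rnorm (t%:C *: z) ^+ p < 1 -> is_translate phi (t%:C *: z) th.
  have [/translate_block_ex[th h]|h] := pselect (r ^+ p + rnorm (t%:C *: z) ^+ p < 1).
    by exists th => _.
  by exists phi => h'; case: (h h').
have [F hF] := choice ex.
have in01 (t : R) : `[0, 1]%classic t -> r ^+ p + rnorm (t%:C *: z) ^+ p < 1.
  rewrite /= in_itv/= => /andP[t0 t1]; apply: le_lt_trans rz.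
  rewrite lerD2l rnormZ cnormR (ger0_norm t0).
  apply: lerX_nneg; first by apply: mulr_ge0 t0 (rnorm_ge0 _).
  exact: ler_piMl (rnorm_ge0 _) t1.
have i0 : `[0, 1]%classic (0 : R) by rewrite /= in_itv/= lexx ler01.
have i1 : `[0, 1]%classic (1 : R) by rewrite /= in_itv/= lexx ler01.
have F0 : F 0 = phi.
  have h := hF 0 (in01 0 i0); rewrite scale0r in h.
  exact: is_translate_inj h translate_block0.2.
have F1 : F 1 = psi.
  have h := hF 1 (in01 1 i1); rewrite scale1r in h.
  exact: is_translate_inj h tr.
have z1 : 0 < rnorm z + 1 by rewrite ltr_wpDl// rnorm_ge0.
have cF : {within `[0, 1]%classic, continuous F}.
  apply: continuous_in_subspaceT => t /set_mem t01; apply: cvg_Mb_base => U bU UF.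
  have rt := in01 t t01; have tt := hF t rt.
  case: bU UF => chi [s [e [s01 cs e01 ->]]] [w]; rewrite normr_ltC => we tw.
  have /andP[s0 s1] := s01.
  have [s' s'01 ps'] := Mb_prec (F t).
  have /andP[s'0 s'1] := s'01.
  (* the first bound allows for translating F t by u, the second keeps chi^(w +
     u) in the given basic neighbourhood of chi *)
  pose d := Num.min ((1 - s') / (rnorm z + 1)) ((e - rnorm w) / (rnorm z + 1)).
  have d0 : 0 < d by rewrite lt_min !divr_gt0// subr_gt0.
  apply/nbhs_ballP; exists d => //= t' tt'.
  pose u : lp := (t' - t)%:C *: z.
  have ud : rnorm u < 1 - s' /\ rnorm u < e - rnorm w.
    rewrite /ball/= lt_min !ltr_pdivlMr// in tt'.
    have /andP[a1 a2] := tt'.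
    have b : rnorm u <= `|t - t'| * (rnorm z + 1).
      by rewrite rnormZ cnormR distrC ler_wpM2l// lerDl.
    by split; exact: le_lt_trans b _.
  have [u1 u2] := ud.
  have su : s' + rnorm u < 1 by rewrite -ltrBrDl.
  have [th tth] := translate_ex ps' (admissible_sball s'0 su).
  have [h1 h2] := translate_block_add rt tt s'01 ps' su tth.
  have E : t%:C *: z + u = t'%:C *: z by rewrite -scalerDl -rmorphD/= subrKC.
  rewrite E in h1 h2.
  have Ft' : F t' = th := is_translate_inj (hF t' h1) h2.
  rewrite /= Ft'; exists (w + u).
    rewrite normr_ltC; apply: le_lt_trans (rnormD _ _) _.
    by rewrite -ltrBrDl.
  apply: (translate_add s0 _ cs tw tth).
  have /andP[_ e1] := e01; rewrite -addrA -ltrBrDl; apply: lt_trans e1.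
  by rewrite -ltrBrDl.
apply: (@connected_component_max _ _ (F @` `[0, 1]%classic)) => //.
- by exists 0.
- by apply: connected_continuous_connected cF; exact: segment_connected.
- by exists 1.
Qed.

Lemma sheet_translates : sheet phi = translates.
Proof.
apply/seteqP; split=> [psi [D [Dphi _ cD] Dpsi]|psi [z rz tr]]; last exact: translates_connected rz tr.
have DW : D `&` translates = D.
  apply: cD.
  - by exists phi; split=> //; exact: translates_self.
  - by exists translates => //; exact: translates_open.
  - by exists translates => //; exact: translates_closed.
by have [] : (D `&` translates) psi by rewrite DW.
Qed.

End block.
End sheets.

Theorem proposition5p4 (R : realType) (p : nat) (p1 : (1 < p)%N) (r : R)
    (phi : Mb R p1) :
  0 < r < 1 -> block_hom r phi ->
  (forall z : lp R p1, `|z| ^+ p + r%:C ^+ p < 1 ->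
     exists psi : Mb R p1, is_translate phi z psi) /\
  sheet phi =
    [set psi | exists2 z : lp R p1,
       `|z| ^+ p + r%:C ^+ p < 1 & is_translate phi z psi].
Proof.
move=> r01 [x [bx xr cx]].
have xr' n : rnorm (val (x n)) = r by rewrite /rnorm xr.
have nE (z : lp R p1) : (`|z| ^+ p + r%:C ^+ p < 1) = (r ^+ p + rnorm z ^+ p < 1).
  by rewrite -rnormE -!rmorphXn/= -rmorphD/= -[1]/((1 : R)%:C) ltcR addrC.
split=> [z|]; first by rewrite nE => rz; exact: (translate_block_ex r01 bx xr' cx rz).
rewrite (sheet_translates r01 bx xr' cx) /translates.
by apply/seteqP; split=> psi [z rz tr]; exists z => //; [rewrite nE|rewrite -nE].
Qed.
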